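(* Let $(\mu_t)_{t\in[0,T]}$ be an absolutely continuous curve with respect to $W_{m,2}$, and let $(v_t)_{t\in(0,T)}$ be an associated Borel velocity field, i.e. $(\mu,v)\in CE(0,T)$ and $\left(\int_M m_{\mu_t}|v_t|^2\,d\mu_t\right)^{1/2}=|\dot\mu|(t)$ for a.e. $t\in(0,T)$. Then $$\mathcal{E}(\mu_T)-\mathcal{E}(\mu_0)+\frac12\int_0^T\int_M m_{\mu_t}|v_t|^2\,d\mu_t\,dt+\frac12\int_0^T\int_M\frac{1}{m_{\mu_t}}|\mathcal{D}W[\mu_t]|_*^2\,d\mu_t\,dt\ \ge\ 0.$$ Moreover, equality holds if and only if $(\mu_t)$ is a weak solution of $$\partial_t\mu-\operatorname{div}\left(\frac{1}{m_\mu}\mathcal{J}_2(\mathcal{D}W[\mu])\,\mu\right)=0\quad\text{on }(0,T)\times M .$$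
   Context: $M$ is a compact $n$-dimensional Riemannian manifold without boundary; $|\cdot|$ is the Riemannian norm on tangent spaces $T_xM$ and $|\cdot|_*$ the dual norm on $T_x^*M$. $\mathcal{P}(M)$ is the space of Borel probability measures on $M$ with the narrow topology. $K\in C(M\times M)$ is a continuous kernel for which there is a constant $C>0$ with $K(x,y)\ge C$ for all $x,y\in M$. For $\mu\in\mathcal{P}(M)$ the mobility is $m_\mu(x)=\int_M K(x,y)\,d\mu(y)$. For $T>0$, $CE(0,T)$ is the set of pairs $(\mu,v)$ where $\mu:t\in[0,T]\mapsto\mu_t\in\mathcal{P}(M)$ is narrowly continuous, $v:(x,t)\in M\times(0,T)\mapsto v_t(x)\in T_xM$ is a Borel time-dependent velocity field with $\int_0^T\int_M|v_t(x)|\,d\mu_t(x)\,dt<\infty$, and $$\int_0^T\int_M \partial_t\varphi(x,t)+\langle \mathcal{D}\varphi(x,t),v_t(x)\rangle\,d\mu_t(x)\,dt=0\quad\forall\varphi\in C^1_c(M\times(0,T)),$$ where $\mathcal{D}$ denotes the differential in the variable $x\in M$. $CE(0,T;\nu\to\eta)$ is the subset of pairs with $\mu_0=\nu$ and $\mu_T=\eta$. The modified transport distance is $$W_{m,2}^2(\mu_0,\mu_1)=\inf\left\{\int_0^1\int_M m_{\mu_t}(x)|v_t(x)|^2\,d\mu_t(x)\,dt:\ (\mu,v)\in CE(0,1;\mu_0\to\mu_1)\right\}.$$ In a metric space $(X,d)$ a curve $\gamma:[0,T]\to X$ is absolutely continuous if there is $g\in L^1(0,T)$ with $d(\gamma_s,\gamma_r)\le\int_s^r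 g(t)\,dt$ for all $0\le s\le r\le T$; its metric derivative is $|\dot\gamma|(t)=\lim_{h\to0}d(\gamma_{t+h},\gamma_t)/|h|$ (exists for a.e. $t$). Every curve absolutely continuous with respect to $W_{m,2}$ admits an associated velocity field as in the claim. $W\in C^1(M\times M)$ is a symmetric interaction kernel, $\mathcal{E}(\mu)=\frac12\int_{M\times M}W(x,y)\,d\mu(x)\,d\mu(y)$, and $W[\mu](x)=\int_M W(x,y)\,d\mu(y)$. The inverse duality map is $\mathcal{J}_2:\xi\in T_x^*M\mapsto|\xi|_*\operatorname{arg\,max}_{y\in T_xM,\,|y|=1}\xi(y)\in T_xM$ (with $\mathcal{J}_2(0)=0$), i.e. the Riesz isomorphism; it maps the differential of a function to its gradient. A curve $(\mu_t)$ is a weak solution of $\partial_t\mu+\operatorname{div}(w\mu)=0$, with $w$ depending on $\mu_t$, if $(\mu,w)\in CE(0,T)$. *)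

(* Defs.v *)
From HB Require Import structures.
From mathcomp Require Import all_boot all_order all_algebra.
From mathcomp Require Import all_classical all_reals all_analysis.

Set Implicit Arguments.
Unset Strict Implicit.
Unset Printing Implicit Defensive.
Import Order.TTheory GRing.Theory Num.Theory numFieldNormedType.Exports.
Local Open Scope classical_set_scope.
Local Open Scope ring_scope.

(* Class C^k on the open set U; the definition by directional derivatives is
   the usual one because it is only used with V finite-dimensional. *)
Fixpoint Ck (R : realType) (V W : normedModType R) (k : nat) (U : set V)
    (f : V -> W) : Prop :=
  match k with
  | 0 => forall p, U p -> {for p, continuous f}
  | k'.+1 => (forall p, U p -> differentiable f p) /\
             (forall w : V, Ck k' U (fun p => 'D_w f p))
  end.

Definition smooth_on (R : realType) (V W : normedModType R) (U : set V)
    (f : V -> W) : Prop := forall k, Ck k U f.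

(* An n-dimensional C^oo manifold without boundary. The functions [chart_coord i] and
   [chart_inv i] are total; they are mutually inverse homeomorphisms between [chart_dom i]
   and the open set [chart_coord i @` chart_dom i] of R^n, and carry no information
   elsewhere. [chart_at x] is an arbitrary choice of a chart around x. *)
Record smooth_manifold (R : realType) (n : nat) (M : ptopologicalType) := {
  chart : Type ;
  chart_dom : chart -> set M ;
  chart_coord : chart -> M -> 'rV[R]_n ;
  chart_inv : chart -> 'rV[R]_n -> M ;
  chart_at : M -> chart ;
  manifold_hausdorff : hausdorff_space M ;
  manifold_second_countable : @second_countable M ;
  mem_chart_at : forall x, chart_dom (chart_at x) x ;
  dom_open : forall i, open (chart_dom i) ;
  codom_open : forall i, open (chart_coord i @` chart_dom i) ;
  coordK : forall i x, chart_dom i x -> chart_inv i (chart_coord i x) = x ;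
  coord_continuous : forall i x, chart_dom i x -> {for x, continuous (chart_coord i)} ;
  param_continuous : forall i u, (chart_coord i @` chart_dom i) u ->
    {for u, continuous (chart_inv i)} ;
  transition_smooth : forall i j,
    smooth_on (chart_coord i @` (chart_dom i `&` chart_dom j)) (chart_coord j \o chart_inv i)
}.

Section Manifold.
Context {R : realType} {n : nat} {M : ptopologicalType}.

(* T_xM is identified with R^n by the coordinates of the chart [chart_at x]:
   v stands for \sum_j v_j \partial_j in that chart. Since this chart need not
   vary continuously with x, regularity of vector fields and of metrics is always
   expressed after passing to the coordinates of a fixed chart. *)
Definition tangent (S : smooth_manifold R n M) (x : M) : Type := 'rV[R]_n.

Definition cotangent (S : smooth_manifold R n M) (x : M) : Type :=
  {linear tangent S x -> R^o}.

Variable S : smooth_manifold R n M.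

(* [to_chart i v] are the coordinates of v in the chart i; [of_chart i x] is the
   inverse operation. Meaningful for x in [chart_dom i]. *)
Definition to_chart (i : chart S) (x : M) (v : tangent S x) : 'rV[R]_n :=
  'd (chart_coord i \o chart_inv (chart_at S x)) (chart_coord (chart_at S x) x) v.

Definition of_chart (i : chart S) (x : M) (u : 'rV[R]_n) : tangent S x :=
  'd (chart_coord (chart_at S x) \o chart_inv i) (chart_coord i x) u.

Definition mdiff (f : M -> R) (x : M) : cotangent S x :=
  'd (f \o chart_inv (chart_at S x) : 'rV[R]_n -> R^o) (chart_coord (chart_at S x) x).

Record riemannian_metric := RiemannianMetric {
  metric : forall x : M, tangent S x -> tangent S x -> R ;
  metric_linear : forall (x : M) (a : R) (u v w : tangent S x),
    @metric x (a *: u + v) w = a * @metric x u w + @metric x v w ;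
  metric_sym : forall (x : M) (u v : tangent S x),
    @metric x u v = @metric x v u ;
  metric_pos : forall (x : M) (v : tangent S x),
    v <> 0 -> 0 < @metric x v v ;
  metric_smooth : forall (i : chart S) (a b : 'rV[R]_n),
    smooth_on (chart_coord i @` chart_dom i)
      (fun u => @metric (chart_inv i u) (of_chart i (chart_inv i u) a)
                                    (of_chart i (chart_inv i u) b) : R^o)
}.

Definition C1_on_product (f : M -> M -> R) : Prop := forall i j : chart S,
  Ck 1 ((chart_coord i @` chart_dom i) `*` (chart_coord j @` chart_dom j))
    (fun p : 'rV[R]_n * 'rV[R]_n => f (chart_inv i p.1) (chart_inv j p.2) : R^o).

(* C^1_c(M x ]0, T[), as functions on M x R vanishing outside a compact subset
   of M x ]0, T[ *)
Definition C1c (T : R) (phi : M -> R -> R) : Prop :=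
  (forall i : chart S,
     Ck 1 ((chart_coord i @` chart_dom i) `*` `]0, T[)
       (fun p : 'rV[R]_n * R => phi (chart_inv i p.1) p.2 : R^o)) /\
  (exists K : set (M * R), [/\ compact K, K `<=` setT `*` `]0, T[ &
     forall x t, ~ K (x, t) -> phi x t = 0]).

Variable g : riemannian_metric.

Definition tnorm (x : M) (v : tangent S x) : R := Num.sqrt (metric g v v).

Definition dual_norm (x : M) (xi : cotangent S x) : R :=
  sup [set xi v | v in [set v : tangent S x | tnorm v <= 1]].

(* For xi = 0 the maximizer is not unique, but the factor vanishes. *)
Definition J2 (x : M) (xi : cotangent S x) : tangent S x :=
  dual_norm xi *:
    (xget 0 [set y : 'rV[R]_n | tnorm (y : tangent S x) = 1 /\
       forall z : tangent S x, tnorm z = 1 -> xi z <= xi y] : 'rV[R]_n).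

End Manifold.

Notation borelType M := (g_sigma_algebraType (@open M)).

(* Two elements of P(M) are identified when they agree on Borel sets. *)
Notation proba R M := (probability (borelType M) R).

Section MetricSpace.
Context {R : realType} {X : Type}.
Variable d : X -> X -> \bar R.

Definition absolutely_continuous_curve (T : R) (c : R -> X) : Prop :=
  exists2 h : R -> R,
    (@lebesgue_measure R).-integrable `]0, T[ (EFin \o h) &
    forall s r, 0 <= s -> s <= r -> r <= T ->
      (d (c s) (c r) <= \int[@lebesgue_measure R]_(t in `]s, r[) (h t)%:E)%E.

(* the limit defining the metric derivative at t exists and equals l *)
Definition has_metric_derivative (c : R -> X) (t : R) (l : \bar R) : Prop :=
  (d (c (t + h)%R) (c t) * (`|h|^-1)%:E)%E @[h --> 0^'] --> l.

End MetricSpace.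

Section Transport.
Context {R : realType} {n : nat} {M : ptopologicalType}.
Variables (S : smooth_manifold R n M) (g : riemannian_metric S).
Local Notation leb := (@lebesgue_measure R).

Definition narrowly_continuous (T : R) (mu : R -> proba R M) : Prop :=
  forall f : M -> R, continuous f -> bounded_fun f ->
    {within `[0, T], continuous (fun t => \int[mu t]_x f x)}.

Definition Borel_velocity (T : R) (v : R -> forall x : M, tangent S x) : Prop :=
  forall (i : chart S) (j : 'I_n),
    measurable_fun ((chart_dom i `*` `]0, T[) : set (borelType M * measurableTypeR R))
      (fun p => to_chart i (v p.2 p.1) ord0 j).

Definition CE (T : R) (mu : R -> proba R M)
    (v : R -> forall x : M, tangent S x) : Prop :=
  [/\ narrowly_continuous T mu,
      Borel_velocity T v,
      (\int[leb]_(t in `]0%R, T[) \int[mu t]_x (tnorm g (v t x))%:E < +oo)%E &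
      forall phi : M -> R -> R, C1c S T phi ->
        (\int[leb]_(t in `]0%R, T[) \int[mu t]_x
           (derive1 (phi x) t + mdiff S (phi^~ t) x (v t x))%R%:E = 0)%E].

Definition CE_from_to (T : R) (nu eta : proba R M) (mu : R -> proba R M)
    (v : R -> forall x : M, tangent S x) : Prop :=
  [/\ CE T mu v,
      forall A : set (borelType M), measurable A -> mu 0 A = nu A &
      forall A : set (borelType M), measurable A -> mu T A = eta A].

Definition mobility (K : M -> M -> R) (mu : proba R M) (x : M) : R :=
  \int[mu]_y K x y.

Definition kinetic (K : M -> M -> R) (mu : proba R M)
    (v : forall x : M, tangent S x) : \bar R :=
  (\int[mu]_x (mobility K mu x * tnorm g (v x) ^+ 2)%:E)%E.

(* The distance takes the value +oo when no admissible curve has finite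
   action. *)
Definition Wm2 (K : M -> M -> R) (mu0 mu1 : proba R M) : \bar R :=
  sqrte (ereal_inf
    [set a | exists mu v, CE_from_to 1 mu0 mu1 mu v /\
       a = (\int[leb]_(t in `]0%R, 1%R[) kinetic K (mu t) (v t))%E]).

Definition potential (W : M -> M -> R) (mu : proba R M) (x : M) : R :=
  \int[mu]_y W x y.

Definition energy (W : M -> M -> R) (mu : proba R M) : R :=
  2^-1 * \int[(mu \x mu)%E]_p W p.1 p.2.

Definition slope_term (K W : M -> M -> R) (mu : proba R M) : \bar R :=
  (\int[mu]_x ((mobility K mu x)^-1 *
                dual_norm g (mdiff S (potential W mu) x) ^+ 2)%:E)%E.

(* Valued in \bar R: the metric derivative of an absolutely continuous curve is
   only integrable, so that the kinetic part may be infinite. *)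
Definition dissipation (K W : M -> M -> R) (T : R) (mu : R -> proba R M)
    (v : R -> forall x : M, tangent S x) : \bar R :=
  ((energy W (mu T) - energy W (mu 0%R))%:E
   + (2^-1)%:E * (\int[leb]_(t in `]0%R, T[) kinetic K (mu t) (v t))
   + (2^-1)%:E * (\int[leb]_(t in `]0%R, T[) slope_term K W (mu t)))%E.

Definition gradient_velocity (K W : M -> M -> R) (mu : proba R M) (x : M) :
    tangent S x :=
  - ((mobility K mu x)^-1 *:
      (J2 g (mdiff S (potential W mu) x) : 'rV[R]_n)).

End Transport.

(* Main.v *)
Require Import Defs.
From HB Require Import structures.
From mathcomp Require Import all_boot all_order all_algebra.
From mathcomp Require Import all_classical all_reals all_analysis.
From mathcomp Require Import measurable_realfun ring lra.
Import Order.TTheory GRing.Theory Num.Theory numFieldNormedType.Exports.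
Local Open Scope classical_set_scope.
Local Open Scope ring_scope.

Set Implicit Arguments.
Unset Strict Implicit.
Unset Printing Implicit Defensive.

(** Write m for the mobility of mu_t, xi for the differential of the potential
    W[mu_t] and w = - m^-1 J_2(xi) for the gradient velocity. Two facts carry
    the proof.

    Chain rule ([chain_rule]): for every velocity u that satisfies the continuity
    equation with mu, the energy changes between times 0 and T by the integral of
    xi(u_t) over space-time. For a fixed C^1 function f, testing the equation
    against psi(t) f(x), with psi a C^1 approximation of the indicator of ]s, t[,
    shows that the integral of f against mu_t - mu_s is that of Df(u) over ]s, t[
    ([increment_formula]). As W is symmetric, E(mu_t) - E(mu_s) is half the sum of
    the increments along mu of the integrals of W[mu_t] and W[mu_s]. Over a fine
    subdivision both differentials are uniformly close to D W[mu_r], by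
    compactness ([potential_modulus]), and the total error is arbitrarily small.

    Completed square: J_2(xi) is the Riesz representative of xi, hence
    m |v|^2 + 2 xi(v) + m^-1 |xi|^2 = m |v - w|^2 pointwise
    ([completed_square]). By the chain rule for v, the dissipation is half the
    integral of m |v - w|^2 as soon as the action of v is finite
    ([dissipation_square]), and it is +oo otherwise. So it is nonnegative, and if
    it vanishes then v = w almost everywhere, so that w inherits the continuity
    equation from v ([null_dissipation]).

    Conversely, let w satisfy the continuity equation. Restricted to [a, b] and
    rescaled to [0, 1], the pair (mu, w) competes in the definition of the
    distance between mu_a and mu_b, whose square is thus at most b - a times the
    action of w on ]a, b[ ([Wm2_action]). By Lebesgue differentiation the squared
    metric derivative, which is the action density of v, is at most that of w
    for almost every time ([metric_derivative_le], [kinetic_le_slope]), that is,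
    at most the slope term. The chain rule for w says that the energy drops by
    exactly the integrated slope term, and the dissipation is at most 0
    ([weak_solution_dissipation]).

    All double integrals in space and time are taken against one measure
    mu_t(dx) dt on the product ([space_time]); tangent vectors are handled
    through their coordinates in fixed charts, where regularity is expressed. *)

(** * Borel sets of products *)

(** Such a set is a countable union of rectangles. *)
Lemma measurable_prod_base d1 d2 (T1 : measurableType d1) (T2 : measurableType d2)
    (B1 : set (set T1)) (B2 : set (set T2)) (O : set (T1 * T2)) :
  countable B1 -> countable B2 ->
  B1 `<=` measurable -> B2 `<=` measurable ->
  (forall p, O p -> exists A B, [/\ B1 A, B2 B, (A `*` B) p & A `*` B `<=` O]) ->
  measurable O.
Proof.
move=> c1 c2 m1 m2 hO.
pose D := [set AB : set T1 * set T2 | (B1 `*` B2) AB /\ AB.1 `*` AB.2 `<=` O].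
have cD : countable D.
  by apply: (@sub_countable _ _ _ (B1 `*` B2)); [apply: subset_card_le => x [] | exact: countableX].
have -> : O = \bigcup_(AB in D) (AB.1 `*` AB.2).
  apply/seteqP; split=> [p Op|p [AB [_ h]] /h //].
  by have [A [B [BA BB pAB sO]]] := hO p Op; exists (A, B).
have [/pfcard_geP [D0|[f]]] := cD.
  by rewrite D0 bigcup_set0; exact: measurable0.
rewrite (_ : bigcup _ _ = \bigcup_n ((f n).1 `*` (f n).2)).
  apply: bigcupT_measurable => n.
  have [[/m1 ? /m2 ?] _] : D (f n) by exact: funS.
  exact: measurableX.
apply/seteqP; split=> [p [AB DAB ABp]|p [n _ np]].
  have [n _ fn] : (f @` setT) AB by apply: (surj (f:=f)).
  by exists n => //; rewrite fn.
by exists (f n) => //; exact: funS.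
Qed.

Lemma basis_open_nbhs (X : topologicalType) (B : set (set X)) (x : X) (U : set X) :
  basis B -> nbhs x U -> exists V, [/\ B V, open V, V x & V `<=` U].
Proof.
move=> [Bo Bx] Ux; have [V [BV Vx] VU] := Bx x U Ux.
by exists V; split => //; exact: Bo.
Qed.

(** With only one second countable factor the Borel sigma-algebra of a product
    may be larger than the product sigma-algebra; here the rectangles of the two
    countable bases suffice. *)
Lemma open_prod_measurable (X Y : ptopologicalType) (O : set (X * Y)) :
  @second_countable X -> @second_countable Y -> open O ->
  measurable (O : set (borelType X * borelType Y)).
Proof.
move=> [B1 c1 b1] [B2 c2 b2] oO.
apply: (@measurable_prod_base _ _ (borelType X) (borelType Y) B1 B2) => //.
- by move=> A BA; apply: sub_sigma_algebra; exact: (proj1 b1).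
- by move=> A BA; apply: sub_sigma_algebra; exact: (proj1 b2).
move=> [x y] Oxy.
have /= [[U V] [/= Ux Vy] UV] := open_nbhs_nbhs (conj oO Oxy).
have [A [BA oA Ax AU]] := basis_open_nbhs b1 Ux.
have [B [BB oB By' BV]] := basis_open_nbhs b2 Vy.
exists A, B; split => // -[a b] [/= /AU ? /BV ?]; exact: UV.
Qed.

Lemma rat_balls_countable (R : realType) :
  countable [set A : set R | exists q e : rat, A = `](ratr q), (ratr e)[%classic].
Proof.
rewrite (_ : [set _ | _] = [set `](ratr p.1), (ratr p.2)[%classic | p in [set: rat * rat]]).
  by apply: sub_countable (countableP (T := (rat * rat)%type) setT); exact: card_image_le.
apply/seteqP; split => A /=; first by move=> [q [e ->]]; exists (q, e).
by move=> [[q e] _ <-]; exists q, e.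
Qed.

Lemma open_prodR_measurable (R : realType) (X : ptopologicalType) (O : set (X * R)) :
  @second_countable X -> open O ->
  measurable (O : set (borelType X * measurableTypeR R)).
Proof.
move=> [B1 c1 b1] oO.
apply: (@measurable_prod_base _ _ (borelType X) (measurableTypeR R) B1 _ _ c1
  (@rat_balls_countable R)).
- by move=> A BA; apply: sub_sigma_algebra; exact: (proj1 b1).
- by move=> A [q [e ->]]; exact: measurable_itv.
move=> [x y] Oxy.
have /= [[U V] [/= Ux Vy] UV] := open_nbhs_nbhs (conj oO Oxy).
have [A [BA oA Ax AU]] := basis_open_nbhs b1 Ux.
have /nbhs_ballP [e /= e0 eV] := Vy.
have /rat_in_itvoo [q /itvP q1] : y - e < y by rewrite ltrBlDr ltrDl.
have /rat_in_itvoo [r /itvP r1] : y < y + e by rewrite ltrDl.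
exists A, `](ratr q), (ratr r)[%classic; split => //.
- by exists q, r.
- by split => //=; rewrite in_itv /= q1 r1.
move=> [a b] [/= /AU ? ]; rewrite in_itv /= => /andP[qb br]; apply: UV; split => //=.
apply: eV; rewrite /ball /= ltr_distlC; apply/andP; split.
  by apply: le_lt_trans qb; rewrite q1.
by apply: lt_le_trans br _; rewrite r1.
Qed.

Section open_continuous_measurable.
Context {R : realType}.
Variable X : ptopologicalType.
Hypothesis X2 : @second_countable X.

Lemma open_borel_measurable (U : set X) : open U -> measurable (U : set (borelType X)).
Proof. by move=> oU; apply: sub_sigma_algebra. Qed.

Let preim_open (Y : topologicalType) (D : set Y) (f : Y -> R) (V : set R) :
  open D -> (forall p, D p -> {for p, continuous f}) -> open V ->
  open (D `&` f @^-1` V).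
Proof.
move=> oD cf oV; rewrite openE => y [Dy Vy]; apply: filterI.
  exact: open_nbhs_nbhs.
exact: (cf y Dy) _ (open_nbhs_nbhs (conj oV Vy)).
Qed.

Lemma open_continuous_borel (D : set X) (f : X -> R) : open D ->
  (forall x, D x -> {for x, continuous f}) ->
  measurable_fun (D : set (borelType X)) (f : borelType X -> measurableTypeR R).
Proof.
move=> oD cf; move=> mD; apply: (measurability _ (RGenOpens.measurableE R)) => //=.
move=> _ [_ [a [b ->]] <-]; apply: open_borel_measurable.
by apply: preim_open => //; exact: interval_open.
Qed.

Lemma open_continuous_prod (Y : ptopologicalType) (D : set (X * Y)) (f : X * Y -> R) :
  @second_countable Y -> open D ->
  (forall x, D x -> {for x, continuous f}) ->
  measurable_fun (D : set (borelType X * borelType Y)) (f : _ -> measurableTypeR R).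
Proof.
move=> Y2 oD cf; move=> mD; apply: (measurability _ (RGenOpens.measurableE R)) => //=.
move=> _ [_ [a [b ->]] <-]; apply: open_prod_measurable => //.
by apply: preim_open => //; exact: interval_open.
Qed.

(** Joint measurability in space and time is always obtained from continuity on
    an open set, such as a chart domain times an interval of times. *)
Lemma open_continuous_prodR (D : set (X * R)) (f : X * R -> R) : open D ->
  (forall x, D x -> {for x, continuous f}) ->
  measurable_fun (D : set (borelType X * measurableTypeR R)) (f : _ -> measurableTypeR R).
Proof.
move=> oD cf; move=> mD; apply: (measurability _ (RGenOpens.measurableE R)) => //=.
move=> _ [_ [a [b ->]] <-]; apply: open_prodR_measurable => //.
by apply: preim_open => //; exact: interval_open.
Qed.

End open_continuous_measurable.

(** * Narrowly continuous curves are measurable kernels *)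

Lemma continuous_compact_bounded {R : realType} {X : topologicalType} (f : X -> R) :
  compact [set: X] -> continuous f -> exists C, 0 <= C /\ forall x, `|f x| <= C.
Proof.
move=> cX cf.
have /compact_bounded[N [_ Nf]] : compact (f @` setT).
  by apply: continuous_compact => //; exact: continuous_subspaceT.
exists (`|N| + 1); split=> [|x]; first by rewrite addr_ge0.
by apply: Nf => //; rewrite ltr_pwDr // ler_norm.
Qed.

Section compact_space.
Context {R : realType} {M : ptopologicalType}.
Hypothesis cM : compact [set: M].
Hypothesis M2 : @second_countable M.
Hypothesis hM : hausdorff_space M.

Lemma continuous_borel (f : M -> R) : continuous f ->
  measurable_fun setT (f : borelType M -> measurableTypeR R).
Proof. by move=> cf; apply: (@open_continuous_borel R M setT f) => [|x _]; [exact: openT|exact: cf]. Qed.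

Lemma probability_bounded_integrable d (T : measurableType d) (P : probability T R)
    (f : T -> R) (C : R) :
  measurable_fun setT f -> (forall x, `|f x| <= C) -> P.-integrable setT (EFin \o f).
Proof.
move=> mf fC; apply: measurable_bounded_integrable => //.
  by apply: le_lt_trans (probability_le1 P _) _ => //; exact: ltry.
by exists C; split; [exact: num_real | move=> y Cy x _; exact: le_trans (fC x) (ltW Cy)].
Qed.

Lemma continuous_probability_integrable (P : proba R M) (f : M -> R) :
  continuous f -> P.-integrable setT (EFin \o f).
Proof.
move=> cf; have [C [_ fC]] := continuous_compact_bounded cM cf.
exact: probability_bounded_integrable (continuous_borel cf) fC.
Qed.

(** Compact Hausdorff spaces are regular. *)
Lemma compact_regular_basis (B : set (set M)) (U : set M) (x : M) : basis B ->
  open U -> U x -> exists V, [/\ B V, V x & closure V `<=` U].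
Proof.
move=> bB oU Ux.
have cx : closed [set x] by exact: (accessible_closed_set1 (hausdorff_accessible hM)).
have [|V Vx VU] := compact_normal hM cM cx (t := U).
  by move=> _ ->; exact: open_nbhs_nbhs.
have [A [BA oA Ax AV]] := basis_open_nbhs bB (Vx x erefl).
by exists A; split => //; apply: subset_trans VU; exact: closureS.
Qed.

(** By second countability, U is a countable union of basis sets whose closures
    lie in U; the approximations are Urysohn functions for the finite unions of
    these closures. *)
Lemma open_indic_lim (U : set M) : open U ->
  exists f : nat -> M -> R, [/\ forall n, continuous (f n),
    forall n x, 0 <= f n x <= 1 &
    forall x, f n x @[n --> \oo] --> (\1_U x : R)].
Proof.
move=> oU; have [B cB bB] := M2.
pose D := [set V | B V /\ closure V `<=` U].
have cD : countable D by apply: sub_countable cB; apply: subset_card_le => V [].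
have [V [VU UV]] : exists V : nat -> set M, (forall n, closure (V n) `<=` U) /\
    (forall x, U x -> exists n, V n x).
  have [/pfcard_geP [D0|[f]]] := cD.
    exists (fun=> set0); split=> [n|x Ux]; first by rewrite closure0.
    have [V [BV Vx VU]] := compact_regular_basis bB oU Ux.
    by have : D V by []; rewrite D0.
  exists f; split=> [n|x Ux].
    by have [] : D (f n) by exact: funS.
  have [V [BV Vx VU]] := compact_regular_basis bB oU Ux.
  have [n _ fn] : (f @` setT) V by apply: (surj (f:=f)).
  by exists n; rewrite fn.
pose F n := \big[setU/set0]_(k < n) closure (V k).
have cF n : closed (F n) by apply: closed_bigsetU => k _; exact: closed_closure.
have FU n : F n `<=` U by rewrite /F -(bigcup_mkord n (fun k => closure (V k))) => x [k _ /VU].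
have sep n : uniform_separator (~` U) (F n).
  apply/normal_uniform_separator.
  - exact: compact_normal.
  - exact: open_closedC.
  - exact: cF.
  - by rewrite setIC; apply/disjoints_subset; rewrite setCK.
exists (fun n => @Urysohn M R (~` U) (F n)); split.
- by move=> n; exact: Urysohn_continuous.
- move=> n x; have := @Urysohn_range M R (~` U) (F n) _ (imageT _ x).
  by rewrite /= in_itv.
move=> x; apply: cvg_near_cst; rewrite indicE.
case: (boolP (x \in U)) => [/set_mem Ux|/negP xU].
  have [n Vx] := UV x Ux.
  exists n.+1 => //= m /= nm.
  apply: (Urysohn_sub1 (sep m)); exists x => //.
  rewrite /F -(bigcup_mkord m (fun k => closure (V k))); exists n => //=.
  exact: subset_closure.
apply: nearW => n; apply: (Urysohn_sub0 (sep n)); exists x => //.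
by move=> Ux; apply: xU; rewrite inE.
Qed.

(** Narrow continuity only concerns times in [0, T]. Composing the curve with
    this retraction of R onto [0, T] gives a curve that is continuous at all
    times and agrees with the given one on [0, T]. *)
Definition clamp (T t : R) : R := Num.max 0 (Num.min T t).

Lemma clamp_itv (T t : R) : 0 <= T -> 0 <= clamp T t <= T.
Proof.
by move=> T0; rewrite /clamp le_max lexx /= ge_max T0 ge_min lexx.
Qed.

Lemma clamp_id (T t : R) : 0 <= t <= T -> clamp T t = t.
Proof. by case/andP => t0 tT; rewrite /clamp (min_idPr tT) (max_idPr t0). Qed.

Lemma clamp_continuous (T : R) : continuous (clamp T).
Proof.
move=> t; apply: (@continuous_max _ R^o (cst 0) (fun t => Num.min T t)); first exact: cvg_cst.
by apply: (@continuous_min _ R^o (cst T) id); [exact: cvg_cst|exact: cvg_id].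
Qed.

Section kernel_of_curve.
Variables (T : R) (mu : R -> proba R M).
Hypothesis T0 : 0 <= T.
Hypothesis nmu : narrowly_continuous T mu.

Lemma narrow_clamp (f : M -> R) : continuous f ->
  continuous (fun t => \int[mu (clamp T t)]_x f x).
Proof.
move=> cf t.
have [C [_ fC]] := continuous_compact_bounded cM cf.
have /nmu -/(_ cf) bf : bounded_fun f.
  by exists C; split; [exact: num_real|move=> y Cy x _; exact: le_trans (fC x) (ltW Cy)].
have /subspace_continuousP /(_ (clamp T t)) h := bf.
have {}h := h (clamp_itv t T0).
apply: (cvg_comp (clamp T) _ _ h).
move=> E /= hE; have := clamp_continuous (T := T) hE.
rewrite /= !nbhs_simpl /=; apply: filterS => s; apply.
exact: (clamp_itv s T0).
Qed.

(** The sets A for which this holds form a Dynkin system, and it contains the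
    open sets because their indicators are limits of continuous functions. *)
Lemma measurable_clamp_kernel (A : set (borelType M)) : measurable A ->
  measurable_fun [set: R] (fun t : R => mu (clamp T t) A).
Proof.
move=> mA; apply: (@dynkin_induction _ (borelType M) open
  (fun A => measurable_fun [set: R] (fun t : R => mu (clamp T t) A))) => //.
- exact: openI.
- rewrite (_ : (fun _ => _) = cst 1%E); first exact: measurable_cst.
  by apply/funext => t; exact: probability_setT.
- move=> U oU; have [f [cf f01 fU]] := open_indic_lim oU.
  apply: (emeasurable_fun_cvg (fun n t => \int[mu (clamp T t)]_x (f n x)%:E)%E) => [n|t _].
    have fin t : (\int[mu (clamp T t)]_x (f n x)%:E)%E \is a fin_num.
      exact: integrable_fin_num (continuous_probability_integrable _ (cf n)).
    rewrite (_ : (fun _ => _) = EFin \o (fun t => \int[mu (clamp T t)]_x f n x)).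
      by apply/measurable_EFinP; apply: continuous_measurable_fun; exact: narrow_clamp.
    by apply/funext => t; rewrite /Rintegral /= fineK; [|exact: fin].
  have mU : measurable (U : set (borelType M)) by exact: open_borel_measurable.
  rewrite (_ : mu _ U = \int[mu (clamp T t)]_x (\1_U x)%:E)%E; last first.
    by rewrite integral_indic // setIT.
  have [|||||_ _] := @dominated_convergence _ (borelType M) R (mu (clamp T t)) setT measurableT
    (fun n x => (f n x)%:E) (fun x => (\1_U x)%:E) (cst 1%E).
  + by move=> n; apply/measurable_EFinP; exact: continuous_borel.
  + by apply/measurable_EFinP; exact: measurable_indic.
  + by apply: aeW => x _; apply: cvg_EFin; [exact: nearW|exact: fU].
  + by apply: finite_measure_integrable_cst.
  + apply: aeW => x n _; rewrite /= lee_fin.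
    by have /andP[f0 f1] := f01 n x; rewrite ger0_norm.
  by [].
- move=> S mS hS.
  rewrite (_ : (fun _ => _) = (fun t => 1 - mu (clamp T t) S)%E).
    by apply: emeasurable_funB => //; exact: measurable_cst.
  by apply/funext => t; rewrite probability_setC.
- move=> F mF tF hF.
  rewrite (_ : (fun _ => _) = (fun t => \sum_(n <oo) mu (clamp T t) (F n))%E).
    by apply: ge0_emeasurable_sum => // n.
  by apply/funext => t; rewrite measure_semi_bigcup //; exact: bigcup_measurable.
Qed.

End kernel_of_curve.
End compact_space.

(** * Integration against k_t(dx) dt *)

Section joint_measure.
Context {R : realType} d (X : measurableType d).
Local Notation RR := (measurableTypeR R).
Variable k : RR -> probability X R.
Hypothesis mk : forall A, measurable A -> measurable_fun [set: RR] (fun t : RR => k t A).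
Local Notation leb := (@lebesgue_measure R).

(** The kernel k, as a constant to which the canonical structure can be
    attached. *)
Definition curve_kernel of (forall A, measurable A -> measurable_fun [set: RR] (fun t : RR => k t A))
  : RR -> {measure set X -> \bar R} := fun t => k t.
Let kk := curve_kernel mk.
HB.instance Definition _ := @isKernel.Build _ _ RR X R kk mk.
HB.instance Definition _ := @Kernel_isProbability.Build _ _ RR X R kk
  (fun t => @probability_setT _ _ _ (k t)).

Lemma ge0_measurable_fiber_integral (f : X * RR -> \bar R) :
  measurable_fun setT f -> (forall z, 0 <= f z)%E ->
  measurable_fun [set: RR] (fun t : RR => \int[k t]_x f (x, t))%E.
Proof.
move=> mf f0.
apply: (@measurable_fun_integral_finite_kernel _ _ RR X R
   (fun p => f (p.2, p.1)) kk) => [z|].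
  exact: f0.
by apply: (measurableT_comp mf); exact: measurable_swap.
Qed.

(** The measure k_t(dx) dt. It lets the double integrals of the problem be
    treated as integrals over a product, for functions without product
    structure. *)
Definition joint_measure of (forall A, measurable A -> measurable_fun [set: RR] (fun t : RR => k t A))
  : set (X * RR) -> \bar R :=
  fun A => (\int[leb]_t k t (ysection A t))%E.
Let jm := joint_measure mk.

Let jm0 : jm set0 = 0%E.
Proof.
rewrite /jm /joint_measure integral0_eq // => t _.
by rewrite ysection0 measure0.
Qed.

Let jm_ge0 A : (0 <= jm A)%E.
Proof. by apply: integral_ge0 => t _; exact: measure_ge0. Qed.

Let measurable_slice (A : set (X * RR)) : measurable A ->
  measurable_fun [set: RR] (fun t : RR => k t (ysection A t)).
Proof.
move=> mA.
rewrite (_ : (fun _ => _) = (fun t : RR => \int[k t]_x (\1_A (x, t))%:E))%E.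
  by apply: (ge0_measurable_fiber_integral (f := fun z => (\1_A z)%:E)) => [|z]; [exact/measurable_EFinP/measurable_indic|rewrite lee_fin].
apply/funext => t.
rewrite -[RHS]/(\int[k t]_x (\1_A (x, t))%:E)%E.
rewrite (_ : (fun x => _) = (fun x => (\1_(ysection A t) x)%:E)); last first.
  by apply/funext => x; rewrite !indicE mem_ysection.
by rewrite integral_indic ?setIT //; exact: measurable_ysection.
Qed.

Let jm_sigma : semi_sigma_additive jm.
Proof.
move=> F mF tF mUF.
rewrite (_ : jm (\bigcup_n F n) = \sum_(n <oo) jm (F n))%E.
  by apply: is_cvg_ereal_nneg_natsum => n _; exact: jm_ge0.
rewrite /jm /joint_measure -(@integral_nneseries _ _ _ leb setT measurableT (fun n t => k t (ysection (F n) t))); last 2 first.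
- by move=> n; exact: measurable_slice.
- by move=> n t _; exact: measure_ge0.
apply: eq_integral => t _; rewrite ysection_bigcup measure_semi_bigcup //.
- by move=> n; exact: measurable_ysection.
- by apply: trivIset_ysection.
- by apply: bigcup_measurable => n _; exact: measurable_ysection.
Qed.

HB.instance Definition _ := isMeasure.Build _ (X * RR)%type R jm jm0 jm_ge0 jm_sigma.

Import HBNNSimple.

Let jm_nnsfun (f : {nnsfun (X * RR) >-> R}) :
  (\int[jm]_z (f z)%:E = \int[leb]_t \int[k t]_x (f (x, t))%:E)%E.
Proof.
under [in LHS]eq_integral do rewrite fimfunE -fsumEFin//.
rewrite ge0_integral_fsum//; last 2 first.
  - by move=> r; exact/measurable_EFinP/measurableT_comp.
  - by move=> r z _; rewrite EFinM nnfun_muleindic_ge0.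
have mi (r : R) : measurable (f @^-1` [set r]) by exact: measurable_sfunP.
have mfib (r : R) : measurable_fun [set: RR] (fun t : RR => \int[k t]_x (\1_(f @^-1` [set r]) (x, t))%:E)%E.
  by apply: (ge0_measurable_fiber_integral (f := fun z => (\1_(f @^-1` [set r]) z)%:E)) => [|z]; [exact/measurable_EFinP/measurable_indic|rewrite lee_fin].
have msl (r : R) (t : RR) : measurable_fun setT (fun x : X => (\1_(f @^-1` [set r]) (x, t))%:E).
  by apply/measurable_EFinP; apply: measurableT_comp; [exact: measurable_indic|exact: pair2_measurable].
under [in RHS]eq_integral.
  move=> t _.
  under eq_integral.
    by move=> x _; rewrite fimfunE -fsumEFin//; over.
  rewrite /= ge0_integral_fsum//; last 2 first.
    - by move=> r; under eq_fun do rewrite EFinM; apply: measurable_funeM; exact: msl.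
    - by move=> r z _; rewrite EFinM nnfun_muleindic_ge0.
  under eq_fsbigr.
    move=> r _.
    under eq_integral do rewrite EFinM.
    rewrite (_ : integral _ _ _ = r%:E * \int[k t]_x (\1_(f @^-1` [set r]) (x, t))%:E)%E; last first.
      have [r0|r0] := leP 0 r.
        by rewrite ge0_integralZl // => *; rewrite lee_fin.
      rewrite !integral0_eq ?mule0 // => x _; rewrite preimage_nnfun0// indic0 ?mule0 //.
    over.
  over.
rewrite /= ge0_integral_fsum//; last 2 first.
  - by move=> r; apply: measurable_funeM.
  - move=> r t _.
    have [r0|r0] := leP 0 r.
      by rewrite mule_ge0 ?lee_fin // integral_ge0 // => *; rewrite lee_fin.
    by rewrite integral0_eq ?mule0 // => x _; rewrite preimage_nnfun0// indic0.
apply: eq_fsbigr => r _.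
rewrite (integralZl_indic _ (fun r => f @^-1` [set r]))//; last first.
  by move=> r0; rewrite preimage_nnfun0.
rewrite integral_indic// setIT.
have [r0|r0] := leP 0 r; last first.
  by rewrite preimage_nnfun0 // measure0 mule0 integral0_eq // => t _; rewrite integral0_eq ?mule0 // => x _; rewrite indic0.
rewrite ge0_integralZl //; last by move=> t _; apply: integral_ge0 => x _; rewrite lee_fin.
congr (_ * _)%E; rewrite /= /jm /joint_measure; apply: eq_integral => t _.
rewrite (_ : (fun x => _) = (fun x => (\1_(ysection (f @^-1` [set r]) t) x)%:E)); last first.
  by apply/funext => x; rewrite !indicE mem_ysection.
by rewrite integral_indic ?setIT //; exact: measurable_ysection.
Qed.

Lemma ge0_integral_jointT (f : X * RR -> \bar R) : (forall z, 0 <= f z)%E ->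
  measurable_fun setT f ->
  (\int[jm]_z f z = \int[leb]_t \int[k t]_x f (x, t))%E.
Proof.
move=> f0 mf.
pose f_ := nnsfun_approx measurableT mf.
have mfib n : measurable_fun [set: RR] (fun t : RR => \int[k t]_x (f_ n (x, t))%:E)%E.
  by apply: (ge0_measurable_fiber_integral (f := fun z => (f_ n z)%:E)) => [|z]; [exact/measurable_EFinP|rewrite lee_fin].
have msl n t : measurable_fun setT (fun x : X => (f_ n (x, t))%:E).
  by apply/measurable_EFinP; apply: measurableT_comp; [by []|exact: pair2_measurable].
transitivity (\int[jm]_z (lim ((f_ n z)%:E @[n --> \oo])))%E.
  by apply/eq_integral => z _; apply/esym/cvg_lim => //=; exact: cvg_nnsfun_approx.
rewrite monotone_convergence//; last 3 first.
  by move=> n; exact/measurable_EFinP.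
  by move=> n z _; rewrite lee_fin.
  by move=> z _ a b ab; rewrite lee_fin; exact/lefP/nd_nnsfun_approx.
under eq_fun do rewrite jm_nnsfun.
transitivity (\int[leb]_t lim ((\int[k t]_x (f_ n (x, t))%:E) @[n --> \oo]))%E.
  rewrite -monotone_convergence//; last 2 first.
  - by move=> n t _; apply: integral_ge0 => z _; rewrite lee_fin.
  - move=> t _ a b ab; apply: ge0_le_integral => //.
    + by move=> z _; rewrite lee_fin.
    + by move=> z _; rewrite lee_fin; exact/lefP/nd_nnsfun_approx.
apply: eq_integral => t _; rewrite -monotone_convergence//; last 2 first.
  - by move=> n z _; rewrite lee_fin.
  - by move=> z _ a b ab; rewrite lee_fin; exact/lefP/nd_nnsfun_approx.
by apply: eq_integral => x _; apply/cvg_lim => //; exact: cvg_nnsfun_approx.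
Qed.

Section domain.
Variables (E : set RR).
Hypothesis mE : measurable E.
Let XE : set (X * RR) := setT `*` E.
Let mXE : measurable XE. Proof. exact: measurableX. Qed.

Let in_XE x t : ((x, t) \in XE) = (t \in E).
Proof. by apply/idP/idP; rewrite !inE => // -[]. Qed.

Lemma measurable_fiber d' (Z : sigmaRingType d') (f : X * RR -> Z) (t : RR) : E t -> measurable_fun XE f ->
  measurable_fun setT (fun x => f (x, t)).
Proof.
move=> Et mf; apply: (measurable_comp mXE _ mf (@pair2_measurable _ _ X RR t)).
by move=> _ [x _ <-].
Qed.

Lemma measurable_fiber_integral (f : X * RR -> \bar R) : measurable_fun XE f ->
  measurable_fun E (fun t : RR => \int[k t]_x f (x, t))%E.
Proof.
move=> mf.
rewrite (_ : (fun _ => _) =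
  (fun t => \int[k t]_x f^\+ (x, t) - \int[k t]_x f^\- (x, t))%E); last first.
  by apply/funext => t; rewrite [LHS]integralE; congr (_ - _)%E; apply: eq_integral => x _; rewrite ?funeposE ?funenegE.
have h (g : X * RR -> \bar R) : measurable_fun XE g -> (forall z, 0 <= g z)%E ->
    measurable_fun E (fun t : RR => \int[k t]_x g (x, t))%E.
  move=> mg g0.
  apply: (@eq_measurable_fun _ _ _ _ _ (fun t : RR => \int[k t]_x ((g \_ XE) (x, t)))%E).
    move=> t tE; apply: eq_integral => x _.
    by rewrite patchE in_XE tE.
  apply: measurable_funTS; apply: ge0_measurable_fiber_integral.
    by apply/(measurable_restrictT _ _).1.
  by apply: erestrict_ge0 => z _; exact: g0.
apply: emeasurable_funB; apply: h => //.
- exact: measurable_funepos.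
- exact: measurable_funeneg.
Qed.

Lemma ge0_integral_joint (f : X * RR -> \bar R) : (forall z, XE z -> 0 <= f z)%E ->
  measurable_fun XE f ->
  (\int[jm]_(z in XE) f z = \int[leb]_(t in E) \int[k t]_x f (x, t))%E.
Proof.
move=> f0 mf; rewrite integral_mkcond ge0_integral_jointT.
- rewrite [RHS]integral_mkcond; apply: eq_integral => t _.
  rewrite patchE; case: ifPn => tE.
    by apply: eq_integral => x _; rewrite patchE in_XE tE.
  by apply: integral0_eq => x _; rewrite patchE in_XE (negbTE tE).
- exact: erestrict_ge0.
- by apply/(measurable_restrictT _ _).1.
Qed.

Lemma integral_joint (f : X * RR -> \bar R) : jm.-integrable XE f ->
  (\int[jm]_(z in XE) f z = \int[leb]_(t in E) \int[k t]_x f (x, t))%E.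
Proof.
move=> fi; have mf := measurable_int _ fi.
rewrite integralE !ge0_integral_joint //; last 2 first.
- exact: measurable_funeneg.
- exact: measurable_funepos.
rewrite -integralB //; last 2 first.
- apply/integrableP; split.
    by apply: (measurable_fiber_integral (f := f^\+)%E); exact: measurable_funepos.
  under eq_integral => t _.
    rewrite gee0_abs; last by apply: integral_ge0.
    over.
  rewrite -ge0_integral_joint //; last exact: measurable_funepos.
  exact: integral_funepos_lt_pinfty.
- apply/integrableP; split.
    by apply: (measurable_fiber_integral (f := f^\-)%E); exact: measurable_funeneg.
  under eq_integral => t _.
    rewrite gee0_abs; last by apply: integral_ge0.
    over.
  rewrite -ge0_integral_joint //; last exact: measurable_funeneg.
  exact: integral_funeneg_lt_pinfty.
by apply: eq_integral => t _; rewrite [RHS]integralE; congr (_ - _)%E; apply: eq_integral => x _; rewrite ?funeposE ?funenegE.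
Qed.

End domain.
End joint_measure.

(** * Differentials in charts and Riesz representation *)

Section differential_near.
Context {R : realType} {V W : normedModType R}.

(** The differential is recognized from a plain epsilon estimate, without Landau
    notation. *)
Lemma diff_intro (f : V -> W) (x : V) (L : {linear V -> W}) : continuous L ->
  (forall e : R, 0 < e -> \forall h \near (0 : V), `|f (h + x) - f x - L h| <= e * `|h|) ->
  differentiable f x /\ 'd f x = L :> (V -> W).
Proof.
move=> cL hL.
have E : f \o shift x = cst (f x) + L +o_ 0 id.
  by apply/eqaddoP => e e0; near=> h; rewrite /= !fctE /= opprD addrA; near: h; exact: hL.
have dL := diff_unique cL E.
split=> //; apply/diff_locallyP; rewrite dL; split => //.
Unshelve. all: by end_near. Qed.

Lemma near_eq_differentiable (f g : V -> W) (x : V) : (\near x, f x = g x) ->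
  differentiable f x -> differentiable g x.
Proof.
move=> fg df.
have [] // := @diff_intro g x ('d f x); first exact: diff_continuous.
move=> e e0.
have /eqaddoP /(_ e e0) := diff_locally df.
have : \forall h \near (0 : V), f (h + x) = g (h + x).
  by rewrite (near_shift x) /=; near=> y; rewrite /= sub0r addrNK; near: y.
apply: filterS2 => h fgh.
by rewrite /= !fctE /= opprD addrA -fgh (nbhs_singleton fg).
Unshelve. all: by end_near. Qed.

Lemma near_eq_diff (f g : V -> W) (x : V) : (\near x, f x = g x) ->
  differentiable f x -> forall v, 'd f x v = 'd g x v.
Proof.
move=> fg df v; have dg := near_eq_differentiable fg df.
by rewrite -!deriveE //; exact: near_eq_derive.
Qed.

End differential_near.

Section chain_rule.
Context {R : realType} {U V W : normedModType R}.

Lemma diff_chain (f : U -> V) (h : V -> W) x y v : f x = y ->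
  differentiable f x -> differentiable h y -> 'd (h \o f) x v = 'd h y ('d f x v).
Proof. by move=> <- df dh; rewrite diff_comp. Qed.

Lemma differentiable_chain (f : U -> V) (h : V -> W) x y : f x = y ->
  differentiable f x -> differentiable h y -> differentiable (h \o f) x.
Proof. by move=> <-; exact: differentiable_comp. Qed.

Lemma near_diff_chain (f : U -> V) (h : V -> W) (F : U -> W) x y v : f x = y ->
  differentiable f x -> differentiable h y -> (\near x, h (f x) = F x) ->
  'd F x v = 'd h y ('d f x v).
Proof.
move=> fx df dh hF; rewrite -(diff_chain v fx df dh).
by apply/esym; apply: (near_eq_diff hF); exact: differentiable_chain fx df dh.
Qed.

End chain_rule.

Section charts.
Context {R : realType} {n : nat} {M : ptopologicalType}.
Variable S : smooth_manifold R n M.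

Definition chart_image (i : chart S) := chart_coord i @` chart_dom i.

Lemma chart_image_open (i : chart S) : open (chart_image i).
Proof. exact: codom_open. Qed.

Lemma chart_invK (i : chart S) u : chart_image i u -> chart_coord i (chart_inv i u) = u.
Proof. by move=> [x ix <-]; rewrite coordK. Qed.

(** By continuity of the parametrization at the coordinates of x. *)
Lemma near_chart_inv (i : chart S) x (A : set M) : chart_dom i x -> nbhs x A ->
  \forall u \near chart_coord i x, chart_image i u /\ A (chart_inv i u).
Proof.
move=> ix xA.
have iu : chart_image i (chart_coord i x) by exists x.
near=> u; split; near: u.
  by apply: open_nbhs_nbhs; split => //; exact: chart_image_open.
by apply: (param_continuous iu); rewrite coordK.
Unshelve. all: by end_near. Qed.

Lemma transition_differentiable (i j : chart S) x : chart_dom i x -> chart_dom j x ->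
  differentiable (chart_coord j \o chart_inv i) (chart_coord i x).
Proof. by move=> ix jx; have [+ _] := @transition_smooth _ _ _ S i j 1; apply; exists x. Qed.

Lemma chart_dom_nbhs (i : chart S) x : chart_dom i x -> nbhs x (chart_dom i).
Proof. by move=> ix; apply: open_nbhs_nbhs; split => //; exact: dom_open. Qed.

Lemma transitionK (i j : chart S) x : chart_dom i x -> chart_dom j x -> forall v,
  'd (chart_coord i \o chart_inv j) (chart_coord j x)
    ('d (chart_coord j \o chart_inv i) (chart_coord i x) v) = v.
Proof.
move=> ix jx v.
have dij := transition_differentiable ix jx.
have dji := transition_differentiable jx ix.
have e : (chart_coord j \o chart_inv i) (chart_coord i x) = chart_coord j x.
  by rewrite /= coordK.
rewrite -(near_diff_chain (F := id) v e dij dji); first by rewrite diff_val.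
near=> u; rewrite /=.
have [iu ju] : chart_image i u /\ chart_dom j (chart_inv i u).
  by near: u; apply: near_chart_inv => //; exact: chart_dom_nbhs.
by rewrite (coordK ju) chart_invK.
Unshelve. all: by end_near. Qed.

Lemma to_chartK (i : chart S) x : chart_dom i x -> forall v : tangent S x,
  of_chart i x (to_chart i v) = v.
Proof. by move=> ix v; rewrite /of_chart /to_chart transitionK //; exact: mem_chart_at. Qed.

Lemma of_chartK (i : chart S) x : chart_dom i x -> forall u,
  to_chart i (of_chart i x u : tangent S x) = u.
Proof. by move=> ix v; rewrite /of_chart /to_chart transitionK //; exact: mem_chart_at. Qed.

Lemma to_chartD (i : chart S) x (u v : tangent S x) : to_chart i ((u : 'rV_n) + v : tangent S x) = to_chart i u + to_chart i v.
Proof. by rewrite /to_chart linearD. Qed.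

Lemma to_chartZ (i : chart S) x a (u : tangent S x) : to_chart i (a *: (u : 'rV_n) : tangent S x) = a *: to_chart i u.
Proof. by rewrite /to_chart linearZ. Qed.

(** [mdiff] is defined in the chart chosen at x. The chain rule for the
    transition map gives the same value in every chart around x. *)
Lemma mdiff_chart (f : M -> R) (i : chart S) x (v : tangent S x) : chart_dom i x ->
  differentiable (f \o chart_inv i : _ -> R^o) (chart_coord i x) ->
  mdiff S f x v = 'd (f \o chart_inv i : _ -> R^o) (chart_coord i x) (to_chart i v).
Proof.
move=> ix df; rewrite /mdiff /to_chart.
set k := chart_at S x; have kx : chart_dom k x by exact: mem_chart_at.
have dki := transition_differentiable kx ix.
have e : (chart_coord i \o chart_inv k) (chart_coord k x) = chart_coord i x.
  by rewrite /= coordK.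
apply: (near_diff_chain v e dki df).
near=> u; rewrite /=.
have [ku iu] : chart_image k u /\ chart_dom i (chart_inv k u).
  by near: u; apply: near_chart_inv => //; exact: chart_dom_nbhs.
by rewrite (coordK iu).
Unshelve. all: by end_near. Qed.

Definition chart_vec (j : 'I_n) : 'rV[R]_n := delta_mx 0 j.

Lemma linear_chart_sum (V : lmodType R) (L : {linear 'rV[R]_n -> V}) (u : 'rV[R]_n) :
  L u = \sum_j u 0 j *: L (chart_vec j).
Proof. by rewrite {1}(row_sum_delta u) linear_sum; apply: eq_bigr => j _; rewrite linearZ. Qed.

Lemma covector_chart (i : chart S) x (xi : cotangent S x) (v : tangent S x) : chart_dom i x ->
  xi v = \sum_j to_chart i v 0 j * xi (of_chart i x (chart_vec j)).
Proof.
move=> ix; rewrite -{1}(to_chartK ix v) /of_chart.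
rewrite (linear_chart_sum ('d (chart_coord (chart_at S x) \o chart_inv i) (chart_coord i x))).
by rewrite linear_sum; apply: eq_bigr => j _; rewrite linearZ.
Qed.

Section metric_algebra.
Variable g : riemannian_metric S.
Section at_point.
Variable x : M.
Implicit Types u v w : tangent S x.
Local Notation "<< u , v >>" := (metric g (u : tangent S x) (v : tangent S x)).

Lemma metricDl u v w : << (u : 'rV_n) + v, w >> = << u, w >> + << v, w >>.
Proof. by have := metric_linear g 1 u v w; rewrite scale1r mul1r. Qed.

Lemma metric0l v : << (0 : 'rV_n), v >> = 0.
Proof. by have := metricDl (0 : 'rV_n) (0 : 'rV_n) v; rewrite addr0 => /eqP; rewrite -subr_eq0 opprD addrA subrr add0r oppr_eq0 => /eqP. Qed.

Lemma metricZl a u v : << a *: (u : 'rV_n), v >> = a * << u, v >>.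
Proof. by have := metric_linear g a u (0 : 'rV_n) v; rewrite addr0 metric0l addr0. Qed.

Lemma metricDr u v w : << w, (u : 'rV_n) + v >> = << w, u >> + << w, v >>.
Proof. by rewrite !(Defs.metric_sym g w) metricDl. Qed.

Lemma metricZr a u v : << v, a *: (u : 'rV_n) >> = a * << v, u >>.
Proof. by rewrite !(Defs.metric_sym g v) metricZl. Qed.

Lemma metric_ge0 v : 0 <= << v, v >>.
Proof.
have [->|v0] := eqVneq (v : 'rV_n) 0; first by rewrite metric0l.
by apply/ltW/metric_pos/eqP.
Qed.

Lemma metric_eq0 v : << v, v >> = 0 -> v = 0 :> 'rV_n.
Proof.
move=> vv; apply: contrapT => v0; have := @metric_pos _ _ _ _ g x v v0.
by rewrite vv ltxx.
Qed.

Lemma tnorm_ge0 v : 0 <= tnorm g v. Proof. exact: sqrtr_ge0. Qed.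

Lemma tnorm_sq v : tnorm g v ^+ 2 = << v, v >>.
Proof. by rewrite sqr_sqrtr // metric_ge0. Qed.

Lemma tnorm_eq0 v : tnorm g v = 0 -> v = 0 :> 'rV_n.
Proof. by move=> v0; apply: metric_eq0; rewrite -tnorm_sq v0 expr0n. Qed.

Lemma tnormZ a v : tnorm g (a *: (v : 'rV_n) : tangent S x) = `|a| * tnorm g v.
Proof.
by rewrite /tnorm metricZl metricZr mulrA -expr2 sqrtrM ?sqr_ge0 // sqrtr_sqr.
Qed.

Lemma cauchy_schwarz u v : `|<< u, v >>| <= tnorm g u * tnorm g v.
Proof.
rewrite -(@ler_pXn2r _ 2) ?nnegrE ?mulr_ge0 ?tnorm_ge0 // exprMn !tnorm_sq real_normK ?num_real //.
have [vv0|vv0] := eqVneq (<< v, v >>) 0.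
  by rewrite (metric_eq0 vv0) Defs.metric_sym metric0l expr0n /= metric0l mulr0.
have vp : 0 < << v, v >> by rewrite lt_def vv0 metric_ge0.
have := metric_ge0 ((<< v, v >> *: (u : 'rV_n)) + (- << u, v >>) *: (v : 'rV_n)).
rewrite metricDl !metricDr !metricZl !metricZr (Defs.metric_sym g v u).
set a := << u, v >>; set b := << v, v >> in vp *; set c := << u, u >>.
rewrite (_ : _ + _ = b * (b * c - a ^+ 2)); last by ring.
by rewrite pmulr_rge0 // subr_ge0 mulrC.
Qed.

Definition gram (i : chart S) : 'M[R]_n :=
  \matrix_(a, b) << of_chart i x (chart_vec a), of_chart i x (chart_vec b) >>.

Definition cov_row (i : chart S) (xi : cotangent S x) : 'rV[R]_n :=
  \row_a xi (of_chart i x (chart_vec a)).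

(** In a fixed chart the metric is a matrix that depends continuously on the
    point, contrary to its expression in the chart chosen at each point. *)
Lemma metric_gram (i : chart S) u v : chart_dom i x ->
  << u, v >> = \sum_a \sum_b to_chart i u 0 a * to_chart i v 0 b * gram i a b.
Proof.
move=> ix; rewrite -{1}(to_chartK ix u) -{1}(to_chartK ix v) /of_chart.
set L := 'd _ _; rewrite (linear_chart_sum L (to_chart i u)) (linear_chart_sum L (to_chart i v)).
have suml (s : seq 'I_n) (c : 'I_n -> R) (F : 'I_n -> 'rV[R]_n) w :
    << \sum_(a <- s) c a *: F a, w >> = \sum_(a <- s) c a * << F a, w >>.
  elim: s => [|a s IH]; first by rewrite !big_nil metric0l.
  by rewrite !big_cons metricDl metricZl IH.
rewrite suml; apply: eq_bigr => a _.
rewrite Defs.metric_sym suml mulr_sumr; apply: eq_bigr => b _.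
by rewrite Defs.metric_sym mxE /of_chart mulrA.
Qed.

Lemma gram_unit (i : chart S) : chart_dom i x -> gram i \in unitmx.
Proof.
move=> ix; rewrite -row_free_unit -kermx_eq0; apply/eqP/row_matrixP => k.
rewrite row0; set r := row k _.
have r0 : r *m gram i = 0 by rewrite -row_mul mulmx_ker row0.
clearbody r.
have := metric_gram (of_chart i x r) (of_chart i x r) ix.
rewrite of_chartK // exchange_big /=.
rewrite big1 => [|b _].
  by move/metric_eq0 => e; rewrite -(of_chartK ix r) e /to_chart linear0.
have /matrixP /(_ 0 b) := r0; rewrite !mxE => e.
rewrite (eq_bigr (fun a => r 0 b * (r 0 a * gram i a b))); last by move=> a _; rewrite mulrAC mulrCA mulrA mulrAC -mulrA mulrC.
by rewrite -mulr_sumr e mulr0.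
Qed.

(** The vector representing xi: its coordinates solve a linear system whose
    matrix is the Gram matrix. *)
Definition riesz (xi : cotangent S x) : tangent S x :=
  of_chart (chart_at S x) x (cov_row (chart_at S x) xi *m invmx (gram (chart_at S x))).

Lemma riesz_chartP (i : chart S) (xi : cotangent S x) v : chart_dom i x ->
  << of_chart i x (cov_row i xi *m invmx (gram i)), v >> = xi v.
Proof.
move=> ix; rewrite (metric_gram _ _ ix) of_chartK // (covector_chart xi v ix).
rewrite exchange_big /=; apply: eq_bigr => b _.
set r := _ *m _.
have /matrixP /(_ 0 b) : r *m gram i = cov_row i xi by rewrite mulmxKV // gram_unit.
rewrite !mxE => <-.
by rewrite mulr_sumr; apply: eq_bigr => a _; ring.
Qed.

Lemma rieszP (xi : cotangent S x) v : << riesz xi, v >> = xi v.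
Proof. by apply: riesz_chartP; exact: mem_chart_at. Qed.

(** Uniqueness of the representative makes its expression independent of the
    chart, which [riesz_chart] exploits. *)
Lemma riesz_unique (xi : cotangent S x) (r : tangent S x) : (forall v, << r, v >> = xi v) -> r = riesz xi.
Proof.
move=> h; apply/eqP; rewrite -(subr_eq0 (r : 'rV_n)); apply/eqP/metric_eq0.
by rewrite metricDl -scaleN1r metricZl h rieszP mulN1r subrr.
Qed.

Lemma riesz_chart (i : chart S) (xi : cotangent S x) : chart_dom i x ->
  to_chart i (riesz xi) = cov_row i xi *m invmx (gram i).
Proof.
move=> ix; rewrite -(riesz_unique (r := of_chart i x (cov_row i xi *m invmx (gram i)))).
  exact: of_chartK.
by move=> v; exact: riesz_chartP.
Qed.

Lemma riesz_self (xi : cotangent S x) : xi (riesz xi) = tnorm g (riesz xi) ^+ 2.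
Proof. by rewrite tnorm_sq rieszP. Qed.

Lemma dual_normE (xi : cotangent S x) : dual_norm g xi = tnorm g (riesz xi).
Proof.
set r := riesz xi; rewrite /dual_norm; set A := [set _ | _ in _].
have ub : ubound A (tnorm g r).
  move=> _ [v /= v1 <-]; rewrite -rieszP -/r (le_trans (ler_norm _)) //.
  by rewrite (le_trans (cauchy_schwarz _ _)) // ler_piMr // tnorm_ge0.
apply/eqP; rewrite eq_le; apply/andP; split.
  apply: ge_sup => //; exists 0; exists (0 : 'rV_n); last by rewrite linear0.
  by rewrite /= /tnorm metric0l sqrtr0.
have [->|r0] := eqVneq (tnorm g r) 0.
  apply: ub_le_sup; first by exists (tnorm g r).
  exists (0 : 'rV_n); last by rewrite linear0.
  by rewrite /= /tnorm metric0l sqrtr0.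
apply: ub_le_sup; first by exists (tnorm g r).
exists ((tnorm g r)^-1 *: (r : 'rV_n)) => /=.
  by rewrite tnormZ normfV ger0_norm ?tnorm_ge0 // mulVf.
by rewrite linearZ /= riesz_self -/r expr2 [LHS]mulrA mulVf // mul1r.
Qed.

(** The unit vector r/|r|, where r represents xi, maximizes xi on the unit
    sphere by the Cauchy-Schwarz inequality, and the equality case shows that it
    is the only maximizer. *)
Lemma J2_riesz (xi : cotangent S x) : J2 g xi = riesz xi.
Proof.
rewrite /J2 dual_normE; set r := riesz xi.
have [r0|r0] := eqVneq (tnorm g r) 0.
  by rewrite r0 scale0r; apply/esym/tnorm_eq0.
pose y := (tnorm g r)^-1 *: (r : 'rV_n).
have y1 : tnorm g (y : tangent S x) = 1.
  by rewrite tnormZ normfV ger0_norm ?tnorm_ge0 // mulVf.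
have xy : xi y = tnorm g r.
  by rewrite linearZ /= riesz_self -/r expr2 [LHS]mulrA mulVf // mul1r.
set A := [set _ | _].
have Ay : A y.
  split=> // z z1; rewrite xy -rieszP -/r (le_trans (ler_norm _)) //.
  by rewrite (le_trans (cauchy_schwarz _ _)) // z1 mulr1.
rewrite (xget_subset1 0 Ay) //.
  by rewrite scalerA divff // scale1r.
suff un z : A z -> z = y by move=> a b /un -> /un ->.
move=> [z1 /(_ y y1)]; rewrite xy -rieszP -/r => rz.
apply/eqP; rewrite -subr_eq0; apply/eqP/(@metric_eq0 (z - y)).
apply/eqP; rewrite eq_le metric_ge0 andbT.
have yz : << y, z >> = (tnorm g r)^-1 * << r, z >> by rewrite metricZl.
clearbody y.
rewrite -scaleN1r metricDl !metricDr !metricZl !metricZr -!tnorm_sq z1 y1.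
rewrite (Defs.metric_sym g z y) yz.
have : 1 <= (tnorm g r)^-1 * << r, z >>.
  by rewrite ler_pdivlMl ?mulr1 // lt_def r0 tnorm_ge0.
by lra.
Qed.

(** Expanding the square, the cross term is the pairing with xi because J_2(xi)
    represents xi. *)
Lemma completed_square (xi : cotangent S x) (m : R) v : 0 < m ->
  m * tnorm g ((v : 'rV_n) + m^-1 *: (J2 g xi : 'rV_n) : tangent S x) ^+ 2 =
  m * tnorm g v ^+ 2 + 2 * xi v + m^-1 * dual_norm g xi ^+ 2.
Proof.
move=> m0; rewrite J2_riesz dual_normE !tnorm_sq.
rewrite metricDl !metricDr !metricZl !metricZr (Defs.metric_sym g v) !rieszP.
rewrite -[xi (riesz xi)]rieszP.
by field; rewrite gt_eqF.
Qed.

Lemma tnorm_scaled_J2 (xi : cotangent S x) (m : R) : 0 < m ->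
  m * tnorm g (- (m^-1 *: (J2 g xi : 'rV_n)) : tangent S x) ^+ 2 = m^-1 * dual_norm g xi ^+ 2.
Proof.
move=> m0; rewrite J2_riesz dual_normE -scaleNr !tnorm_sq !metricZl !metricZr.
by field; rewrite gt_eqF.
Qed.

Lemma pairing_scaled_J2 (xi : cotangent S x) (m : R) : 0 < m ->
  xi (- (m^-1 *: (J2 g xi : 'rV_n)) : tangent S x) = - (m^-1 * dual_norm g xi ^+ 2).
Proof.
by move=> m0; rewrite J2_riesz dual_normE -scaleNr linearZ /= riesz_self; exact: mulNr.
Qed.

Lemma dual_norm_ge0 (xi : cotangent S x) : 0 <= dual_norm g xi.
Proof. by rewrite dual_normE tnorm_ge0. Qed.

Lemma dual_norm_bound (xi : cotangent S x) (C : R) : 0 <= C ->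
  (forall v, `|xi v| <= C * tnorm g v) -> dual_norm g xi <= C.
Proof.
move=> C0 h; rewrite dual_normE; have := h (riesz xi); rewrite riesz_self.
have [->//|r0] := eqVneq (tnorm g (riesz xi)) 0.
rewrite ger0_norm ?sqr_ge0 // expr2 ler_pM2r // lt_def r0; exact: tnorm_ge0.
Qed.

End at_point.
End metric_algebra.
End charts.

(** * Compactness, and measurability of fields *)

Lemma cvg_sumR {R : realType} (U I : Type) (F : set_system U) {FF : Filter F} (r : seq I)
    (f : I -> U -> R) (a : I -> R) : (forall i, f i x @[x --> F] --> a i) ->
  \sum_(i <- r) f i x @[x --> F] --> \sum_(i <- r) a i.
Proof.
move=> fa; elim: r => [|i r IH].
  by under eq_fun do rewrite big_nil; rewrite big_nil; exact: cvg_cst.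
by under eq_fun do rewrite big_cons; rewrite big_cons; apply: cvgD.
Qed.

Section tube.
Context {R : realType} {M : topologicalType}.
Hypothesis cM : compact [set: M].

(** The tube lemma. *)
Lemma near_compact_all (X : topologicalType) (x0 : X) (P : X -> M -> Prop) :
  (forall y : M, nbhs (x0, y) [set p : X * M | P p.1 p.2]) ->
  \forall x \near x0, forall y : M, P x y.
Proof.
move=> h.
have /compact_near_coveringP /(_ X (nbhs x0) P) := cM.
move=> h0; suff : \forall x \near x0, setT `<=` P x.
  by apply: filterS => x Ax y; exact: Ax.
apply: h0 => y _.
have [[A B] [/= Ax By] AB] := h y.
by exists (B, A) => // -[y' x'] [/= By' Ax']; exact: (AB (x', y')).
Qed.

Lemma near_compact_dist (X : topologicalType) (x0 : X) (P : X -> M -> R) (e : R) : 0 < e ->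
  (forall y, {for (x0, y), continuous (fun p : X * M => P p.1 p.2)}) ->
  \forall x \near x0, forall y, `|P x y - P x0 y| <= e.
Proof.
move=> e0 cP; apply: near_compact_all => y.
have h : nbhs (x0, y) [set p : X * M | `|P x0 y - P p.1 p.2| < e / 2].
  by move: (cP y) => /cvgrPdist_lt; apply; rewrite divr_gt0.
have h2 : nbhs (x0, y) [set p : X * M | `|P x0 y - P x0 p.2| < e / 2].
  have [[A B] [/= Ax By] AB] := h; exists (A, B) => // -[x' y'] [/= Ax' By'].
  by apply: (AB (x0, y')); split => //=; exact: nbhs_singleton.
apply: filterS2 h h2 => p /= h1 h3.
rewrite -{1}(subrK (P x0 y) (P p.1 p.2)) -addrA (le_trans (ler_normD _ _)) //.
by rewrite [leRHS](splitr e) lerD // ltW // distrC.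
Qed.

End tube.

Section charts_topology.
Context {R : realType} {n : nat} {M : ptopologicalType}.
Variable S : smooth_manifold R n M.
Hypothesis cM : compact [set: M].
Variable g : riemannian_metric S.
Local Notation RR := (measurableTypeR R).

Lemma chart_cover : exists idx : nat -> chart S, forall x, exists k, chart_dom (idx k) x.
Proof.
have := cM; rewrite compact_cover => /(_ M setT (fun x => chart_dom (chart_at S x))).
case=> [x _|x _|D _ cov].
- exact: dom_open.
- by exists x => //; exact: mem_chart_at.
exists (fun k => chart_at S (nth point (finmap.enum_fset D) k)) => x.
have [y /= yD xy] := cov x I.
by exists (index y (finmap.enum_fset D)); rewrite nth_index.
Qed.

Lemma chart_dom_measurable (i : chart S) : measurable (chart_dom i : set (borelType M)).
Proof. by apply: open_borel_measurable; exact: dom_open. Qed.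

(** By compactness, countably many charts cover the manifold. *)
Lemma measurable_chartwise d (Z : sigmaRingType d) (E : set RR) (f : M * R -> Z) : measurable E ->
  (forall i : chart S, measurable_fun (chart_dom i `*` E : set (borelType M * RR)) f) ->
  measurable_fun (setT `*` E : set (borelType M * RR)) f.
Proof.
move=> mE mf; have [idx cov] := chart_cover.
rewrite (_ : _ `*` _ = \bigcup_k (chart_dom (idx k) `*` E)); last first.
  apply/seteqP; split=> [[x t] [_ /= Et]|[x t] [k _ [_ Et]]//].
  by have [k xk] := cov x; exists k.
apply/measurable_fun_bigcup => // k.
by apply: measurableX => //; exact: chart_dom_measurable.
Qed.

(** Continuity in a chart is continuity on the manifold. *)
Lemma continuous_from_chart (Y : topologicalType) (i : chart S) (x : M) (f : M -> Y)
  (F : 'rV[R]_n -> Y) : chart_dom i x ->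
  (forall y, chart_dom i y -> f y = F (chart_coord i y)) ->
  {for chart_coord i x, continuous F} -> {for x, continuous f}.
Proof.
move=> ix fF cF; have := @continuous_comp _ _ _ (chart_coord i) F x (Defs.coord_continuous ix) cF.
rewrite /prop_for /continuous_at /= -fF //; apply: cvg_trans; apply: near_eq_cvg.
have := chart_dom_nbhs ix; apply: filterS => y iy.
by rewrite /= fF.
Qed.

Lemma gram_continuous (i : chart S) (x : M) a b : chart_dom i x ->
  {for x, continuous (fun y => gram g y i a b)}.
Proof.
move=> ix.
pose F (u : 'rV[R]_n) := metric g (of_chart i (chart_inv i u) (chart_vec a) : tangent S (chart_inv i u)) (of_chart i (chart_inv i u) (chart_vec b)).
apply: (@continuous_from_chart _ i x _ F) => //.
  by move=> y iy; rewrite /F mxE coordK.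
by apply: (@metric_smooth _ _ _ _ g i (chart_vec a) (chart_vec b) 0); exists x.
Qed.

(** At x0 the quadratic form of the metric is bounded below on the compact unit
    sphere by some m > 0; near x0 its coefficients change so little that m/2
    remains a lower bound. *)
Lemma tnorm_lower_bound (i : chart S) (x0 : M) : chart_dom i x0 ->
  exists c : R, 0 < c /\ \forall x \near x0, chart_dom i x /\
    forall v : tangent S x, c * `|to_chart i v| <= tnorm g v.
Proof.
move=> ix0.
pose q x (a : 'rV[R]_n) := \sum_j \sum_k a 0 j * a 0 k * gram g x i j k.
have qE x : chart_dom i x -> forall v : tangent S x, q x (to_chart i v) = tnorm g v ^+ 2.
  by move=> ix v; rewrite tnorm_sq (metric_gram g v v ix).
have [m [m0 qm]] : exists m : R, 0 < m /\ forall a : 'rV[R]_n, m * `|a| ^+ 2 <= q x0 a.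
  pose sph := [set a : 'rV[R]_n | `|a| = 1].
  have cq : continuous (q x0).
    move=> a; apply: (cvg_sumR (F := nbhs a)) => j.
    apply: (cvg_sumR (F := nbhs a)) => k.
    apply: cvgM; last exact: cvg_cst.
    by apply: cvgM; exact: coord_continuous.
  have [s1|s0] := pselect (sph !=set0); last first.
    (* An empty sphere means that the dimension is 0. *)
    exists 1; split=> // a; have [->|a0] := eqVneq a 0.
      rewrite normr0 expr0n /= mulr0 /q; apply: sumr_ge0 => j _; apply: sumr_ge0 => k _.
      by rewrite !mxE !mul0r.
    case: s0; exists (`|a|^-1 *: a); rewrite /sph /= normrZ normfV normr_id mulVf //.
    by rewrite normr_eq0.
  have csph : compact sph.
    apply: bounded_closed_compact.
      exists 1; split; [exact: num_real|move=> y y1 a /= ->; exact: ltW].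
    rewrite (_ : sph = (fun a : 'rV[R]_n => `|a|) @^-1` [set 1]) //.
    by apply: (@closed_comp _ _ (fun a : 'rV[R]_n => `|a|)) => [a _|]; [exact: norm_continuous|exact: closed_eq].
  have [a a1 am] := EVT_min_rV s1 csph (continuous_subspaceT cq).
  have aN0 : a <> 0 by move=> a0; move: a1; rewrite inE /sph /= a0 normr0 => /eqP; rewrite eq_sym oner_eq0.
  exists (q x0 a); split.
    rewrite -(of_chartK ix0 a) qE // exprn_gt0 // lt_def tnorm_ge0 andbT.
    apply/eqP => /tnorm_eq0 e; apply: aN0.
    by rewrite -(of_chartK ix0 a) e /to_chart linear0.
  move=> b; have [->|b0] := eqVneq b 0.
    rewrite normr0 expr0n /= mulr0 /q; apply: sumr_ge0 => j _; apply: sumr_ge0 => k _.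
    by rewrite !mxE !mul0r.
  have nb0 : `|b| != 0 by rewrite normr_eq0.
  have bs : sph (`|b|^-1 *: b).
    by rewrite /sph /= normrZ normfV normr_id mulVf.
  apply: (@le_trans _ _ (q x0 (`|b|^-1 *: b) * `|b| ^+ 2)).
    by rewrite ler_wpM2r ?sqr_ge0 // am // inE.
  rewrite /q mulr_suml le_eqVlt; apply/orP; left; apply/eqP.
  apply: eq_bigr => j _; rewrite mulr_suml; apply: eq_bigr => k _.
  by rewrite !mxE; field.
(* A change of at most e in each of the n^2 coefficients changes the form by at
   most m/2 on the unit sphere; the successor avoids dividing by 0 when n = 0.
   *)
pose e := m / 2 / (n * n).+1%:R.
have e0 : 0 < e by rewrite !divr_gt0.
(* The bound is on the square of the norm, hence the square root. *)
exists (Num.sqrt (m / 2)); split; first by rewrite sqrtr_gt0 divr_gt0.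
have near_gram : \forall x \near x0, forall j k, `|gram g x0 i j k - gram g x i j k| < e.
  apply: filter_forall => j; apply: filter_forall => k.
  by have /cvgrPdist_lt := gram_continuous (a := j) (b := k) ix0; apply.
near=> x.
have ix : chart_dom i x by near: x; exact: chart_dom_nbhs.
split=> // v; set a := to_chart i v.
rewrite -(@ler_pXn2r _ 2) ?nnegrE ?mulr_ge0 ?sqrtr_ge0 ?tnorm_ge0 ?normr_ge0 // exprMn.
rewrite sqr_sqrtr; last by rewrite divr_ge0 // ltW.
rewrite -qE // -/a.
have aj j : `|a 0 j| <= `|a|.
  by rewrite {2}/Num.norm /= mx_normrE; apply: (le_bigmax _ (fun ij => `|a ij.1 ij.2|) (0, j)).
have : q x0 a - q x a <= m / 2 * `|a| ^+ 2.
  rewrite /q -sumrB (le_trans (y := \sum_(j < n) \sum_(k < n) e * `|a| ^+ 2)) //.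
    apply: ler_sum => j _; rewrite -sumrB; apply: ler_sum => k _.
    rewrite -mulrBr (le_trans (ler_norm _)) // normrM mulrC ler_pM ?normr_ge0 //.
      by apply/ltW; move: j k; near: x.
    by rewrite normrM expr2 ler_pM.
  have -> : \sum_(j < n) \sum_(k < n) e * `|a| ^+ 2 = (n * n)%:R * e * `|a| ^+ 2.
    by rewrite !sumr_const !card_ord -mulrnA -mulrA mulr_natl.
  rewrite ler_wpM2r ?sqr_ge0 //.
  rewrite /e mulrCA -[leRHS]mulr1 ler_wpM2l ?divr_ge0 ?ltW //.
  by rewrite ltr_pdivrMr // mul1r ltr_nat.
have := qm a; move: (q x0 a) (q x a) (`|a| ^+ 2) => A B C; lra.
Unshelve. all: by end_near. Qed.

Section measurable_fields.
Variable E : set RR.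
Hypothesis mE : measurable E.
Implicit Types (v : R -> forall x : M, tangent S x) (xi : R -> forall x : M, cotangent S x).

Definition Borel_field v := forall (i : chart S) (j : 'I_n),
  measurable_fun (chart_dom i `*` E : set (borelType M * RR))
   (fun p => to_chart i (v p.2 p.1) ord0 j).

(** The coordinates of the covector field in the basis dual to that of the
    chart. *)
Definition Borel_covector xi := forall (i : chart S) (j : 'I_n),
  measurable_fun (chart_dom i `*` E : set (borelType M * RR))
   (fun p => cov_row i (xi p.2 p.1) ord0 j).

Let mdom (i : chart S) : measurable (chart_dom i `*` E : set (borelType M * RR)).
Proof. by apply: measurableX => //; exact: chart_dom_measurable. Qed.

Lemma measurable_pairing xi v : Borel_covector xi -> Borel_field v ->
  measurable_fun (setT `*` E : set (borelType M * RR)) (fun p => xi p.2 p.1 (v p.2 p.1)).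
Proof.
move=> mxi mv; apply: measurable_chartwise => // i.
apply: (eq_measurable_fun (fun p : borelType M * RR => \sum_j to_chart i (v p.2 p.1) 0 j * cov_row i (xi p.2 p.1) 0 j)).
  move=> p; rewrite inE => -[ip _]; rewrite (covector_chart (xi p.2 p.1) _ ip).
  by apply: eq_bigr => j _; rewrite mxE.
by apply: measurable_sum => j; apply: measurable_funM.
Qed.

Lemma measurable_gram (i : chart S) a b :
  measurable_fun (chart_dom i `*` E : set (borelType M * RR)) (fun p => gram g p.1 i a b).
Proof.
apply: (measurable_comp (F := chart_dom i : set (borelType M)) (f := fun x : borelType M => gram g x i a b)).
- exact: chart_dom_measurable.
- by move=> _ [p [ip _] <-].
- apply: open_continuous_borel; first exact: dom_open.
  by move=> x ix; exact: gram_continuous.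
- by apply: measurable_funTS; exact: measurable_fst.
Qed.

Lemma measurable_metric v w : Borel_field v -> Borel_field w ->
  measurable_fun (setT `*` E : set (borelType M * RR)) (fun p => metric g (v p.2 p.1) (w p.2 p.1)).
Proof.
move=> mv mw; apply: measurable_chartwise => // i.
apply: (eq_measurable_fun (fun p : borelType M * RR => \sum_a \sum_b to_chart i (v p.2 p.1) 0 a * to_chart i (w p.2 p.1) 0 b * gram g p.1 i a b)).
  by move=> p; rewrite inE => -[ip _]; rewrite (metric_gram g _ _ ip).
apply: measurable_sum => a; apply: measurable_sum => b.
by apply: measurable_funM; [apply: measurable_funM|exact: measurable_gram].
Qed.

Lemma measurable_tnorm v : Borel_field v ->
  measurable_fun (setT `*` E : set (borelType M * RR)) (fun p => tnorm g (v p.2 p.1)).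
Proof.
move=> mv; rewrite /tnorm; apply: (@measurableT_comp _ _ _ _ _ _ (@Num.sqrt R)) => //; last exact: measurable_metric.
by apply: continuous_measurable_fun; exact: sqrt_continuous.
Qed.

Lemma measurable_inv (f : M * R -> R) (D : set (borelType M * RR)) : measurable D -> measurable_fun D f ->
  measurable_fun D (fun p => (f p)^-1).
Proof.
move=> mD mf.
have m1 : measurable_fun [set r : R | r != 0] (@GRing.inv R).
  apply: open_continuous_measurable_fun; first exact: open_neq.
  by move=> r; rewrite inE /= => r0; exact: inv_continuous.
have m0 : measurable_fun [set: R] (@GRing.inv R).
  rewrite (_ : setT = [set r : R | r != 0] `|` [set 0]).
    apply/measurable_funU => //; first by apply: open_measurable; exact: open_neq.
    split=> //; exact: measurable_fun_set1.
  by apply/seteqP; split=> r //= _; have [->|r0] := eqVneq r 0; [right|left].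
exact: (measurableT_comp m0 mf).
Qed.

Lemma measurable_det m (A : M * R -> 'M[R]_m) (D : set (borelType M * RR)) : (forall a b, measurable_fun D (fun p => A p a b)) ->
  measurable_fun D (fun p => \det (A p)).
Proof.
move=> mA; apply: measurable_sum => s; apply: measurable_funM; first exact: measurable_cst.
by apply: measurable_prod => j _; exact: mA.
Qed.

(** By Cramer, the coordinates of the representative are rational functions of
    those of the covector and of the Gram matrix. *)
Lemma Borel_riesz xi : Borel_covector xi -> Borel_field (fun t x => riesz g (xi t x)).
Proof.
move=> mxi i j.
apply: (eq_measurable_fun (fun p : borelType M * RR => \sum_k cov_row i (xi p.2 p.1) 0 k *
   ((\det (gram g p.1 i))^-1 * cofactor (gram g p.1 i) j k))).
  move=> p; rewrite inE => -[ip _]; rewrite (riesz_chart g _ ip) mxE.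
  by apply: eq_bigr => k _; rewrite /invmx (gram_unit g ip) !mxE.
apply: measurable_sum => k; apply: measurable_funM; first exact: mxi.
apply: measurable_funM.
  by apply: measurable_inv => //; apply: measurable_det => a b; exact: measurable_gram.
apply: measurable_funM; first exact: measurable_cst.
apply: measurable_det => a b.
rewrite (_ : (fun p => _) = (fun p : borelType M * RR => gram g p.1 i (lift j a) (lift k b))).
  exact: measurable_gram.
by apply/funext => p; rewrite 2!mxE.
Qed.

Lemma Borel_fieldZ (f : M * R -> R) v : measurable_fun (setT `*` E : set (borelType M * RR)) f ->
  Borel_field v -> Borel_field (fun t x => f (x, t) *: (v t x : 'rV[R]_n)).
Proof.
move=> mf mv i j.
rewrite (_ : (fun p => _) = (fun p => f p * to_chart i (v p.2 p.1) 0 j)); last first.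
  by apply/funext => -[x t]; rewrite to_chartZ mxE.
apply: measurable_funM => //; apply: measurable_funS mf => //.
  exact: measurableX.
by move=> p [].
Qed.

End measurable_fields.
End charts_topology.

(** * Differentiation under the integral sign *)

Lemma pair_continuousl (X Y : topologicalType) (x : X) : continuous (fun y : Y => (x, y)).
Proof. by move=> y; apply: (cvg_pair (G := nbhs x) (H := nbhs y)); [exact: cvg_cst|exact: cvg_id]. Qed.

Lemma near_forall_ord (X : topologicalType) (x : X) n (f : 'I_n -> X -> Prop) :
  (forall j, \forall u \near x, f j u) -> \forall u \near x, forall j, f j u.
Proof. by move=> h; apply: filter_forall => j; exact: h. Qed.

Lemma diff_line {R : realType} (V : normedModType R) (h u : V) (s : R^o) :
  differentiable (fun s : R^o => s *: h + u) s /\ 'd (fun s : R^o => s *: h + u) s 1 = h.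
Proof.
have [d E] := @is_diffD R R^o V ( *:%R^~ h) (cst u) ( *:%R^~ h) 0 s (is_diff_scalel s h) (is_diff_cst u s).
split; first exact: d.
by move: E => /(congr1 (fun f : R^o -> V => f 1)); rewrite /= fctE addr0 scale1r.
Qed.

(** The mean value theorem on the segment from u to u + h. *)
Lemma mean_value_line {R : realType} (V : normedModType R) (f : V -> R^o) (u h : V) :
  (forall s : R, s \in `[0, 1] -> differentiable f (s *: h + u)) ->
  exists2 s : R, s \in `]0, 1[ & f (h + u) - f u = 'd f (s *: h + u) h.
Proof.
move=> df.
pose A (s : R^o) : V := s *: h + u.
have dA s : differentiable A s by exact: (diff_line h u s).1.
have dA1 s : 'd A s 1 = h by exact: (diff_line h u s).2.
pose G (s : R) : R := f (s *: h + u).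
have dG (s : R) : s \in `[0, 1] -> is_derive s (1 : R) G ('d f (s *: h + u) h).
  move=> s01; have dfs := df s s01.
  have dfA : differentiable (f \o A) s by apply: differentiable_chain (erefl _) (dA s) dfs.
  apply: DeriveDef; first exact: diff_derivable dfA.
  rewrite (deriveE (1 : R^o) dfA).
  by rewrite (diff_chain (1 : R^o) (erefl _) (dA s) dfs) dA1.
pose dGf (s : R) : R := 'd f (s *: h + u) h.
have {}dG (s : R) : s \in `[0, 1] -> is_derive s (1 : R) G (dGf s) by exact: dG.
have G1 : G 1 = f (h + u) by rewrite /G scale1r.
have G0 : G 0 = f u by rewrite /G scale0r add0r.
suff [s s01 E] : exists2 s : R, s \in `]0, 1[ & G 1 - G 0 = dGf s.
  by exists s => //; rewrite -G1 -G0 E.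
clearbody G dGf => {dA dA1 A df G1 G0}.
have l01 : (0 : R) < 1 by exact: ltr01.
have M := @MVT R G dGf 0 1 l01.
have dG' : forall s : R, s \in `]0, 1[ -> is_derive s (1 : R) G (dGf s).
  by move=> s s01; apply: dG; move: s01; rewrite !in_itv /= => /andP[? ?]; rewrite !ltW.
have cG : {within `[0, 1], continuous G}.
  by apply: derivable_within_continuous => s s01; by have [] := dG s s01.
have {}M := M dG'.
have [s s01 E] := M cG.
by exists s => //; rewrite E subr0 mulr1.
Qed.

Section integral_dist.
Context {R : realType} {M : ptopologicalType}.
Hypothesis cM : compact [set: M].

Lemma Rintegral_dist_le (P : proba R M) (f h : M -> R) (e : R) :
  continuous f -> continuous h -> (forall y, `|f y - h y| <= e) ->
  `|\int[P]_y f y - \int[P]_y h y| <= e.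
Proof.
move=> cf ch fh.
have If := continuous_probability_integrable cM P cf.
have Ih := continuous_probability_integrable cM P ch.
rewrite -RintegralB //.
have Ifh : P.-integrable setT (EFin \o (fun y => f y - h y)).
  by apply: continuous_probability_integrable => //; move=> y; apply: cvgB; [exact: cf|exact: ch].
apply: (le_trans (le_normr_Rintegral measurableT Ifh)).
have -> : e = \int[P]_y e.
  by rewrite Rintegral_cst // /= probability_setT mulr1.
apply: le_Rintegral => //.
- by apply: (integrable_norm Ifh).
- by apply: finite_measure_integrable_cst.
Qed.

Lemma Rintegral_sumZ (P : proba R M) (I : Type) (s : seq I) (c : I -> R) (f : I -> M -> R) :
  (forall j, continuous (f j)) ->
  \int[P]_y (\sum_(j <- s) c j * f j y) = \sum_(j <- s) c j * \int[P]_y f j y.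
Proof.
move=> cf.
have cZ j : continuous (fun y => c j * f j y).
  by move=> y; apply: cvgM; [exact: cvg_cst|exact: cf].
elim: s => [|j s IH].
  under eq_Rintegral do rewrite big_nil.
  by rewrite big_nil Rintegral_cst // mul0r.
under eq_Rintegral do rewrite big_cons.
rewrite big_cons RintegralD //; last 2 first.
- exact: continuous_probability_integrable.
- apply: continuous_probability_integrable => // y.
  by apply: (cvg_sumR (F := nbhs y)) => k; exact: cZ.
rewrite IH RintegralZl //; exact: continuous_probability_integrable.
Qed.

Section curve.
Hypothesis M2 : @second_countable M.
Hypothesis hM : hausdorff_space M.
Variables (T : R) (mu : R -> proba R M).
Hypothesis T0 : 0 <= T.
Hypothesis nmu : narrowly_continuous T mu.

(** Uniform convergence of P x to P x0 handles the dependence on x, and narrow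
    continuity the dependence on t. *)
Lemma joint_continuous_integral (X : topologicalType) (P : X -> M -> R) (x0 : X) (t0 : R) :
  (forall y, {for (x0, y), continuous (fun p : X * M => P p.1 p.2)}) ->
  (\forall x \near x0, continuous (P x)) ->
  {for (x0, t0), continuous (fun p : X * R => \int[mu (clamp T p.2)]_y P p.1 y)}.
Proof.
move=> cP ncP; apply/cvgrPdist_le => e e0.
have e2 : 0 < e / 2 by rewrite divr_gt0.
have h1 : \forall x \near x0, (forall y, `|P x y - P x0 y| <= e / 2) /\ continuous (P x).
  by apply: filterI ncP; exact: near_compact_dist.
have cx0 : continuous (P x0) := nbhs_singleton ncP.
have h2 : \forall t \near t0, `|\int[mu (clamp T t0)]_y P x0 y - \int[mu (clamp T t)]_y P x0 y| <= e / 2.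
  have ct : continuous (fun t => \int[mu (clamp T t)]_y P x0 y) by exact: narrow_clamp.
  by have /cvgrPdist_le := ct t0; apply.
exists ([set x | (forall y, `|P x y - P x0 y| <= e / 2) /\ continuous (P x)],
  [set t | `|\int[mu (clamp T t0)]_y P x0 y - \int[mu (clamp T t)]_y P x0 y| <= e / 2]) => //.
move=> [x t] /= [[hx cx] ht].
rewrite -(subrK (\int[mu (clamp T t)]_y P x0 y) (\int[mu (clamp T t0)]_y P x0 y)) -addrA.
rewrite (le_trans (ler_normD _ _)) // [leRHS](splitr e) lerD //.
by apply: Rintegral_dist_le => // y; rewrite distrC.
Qed.

End curve.

Section diff_under_integral.
Context {n : nat}.
Local Notation V := 'rV[R]_n.
Variables (F : V -> M -> R) (O : set V) (u0 : V).
Local Notation Q j u y := ('d (F^~ y : V -> R^o) u (chart_vec j)).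
Hypothesis oO : open O.
Hypothesis Ou0 : O u0.
Hypothesis dF : forall u y, O u -> differentiable (F^~ y : V -> R^o) u.
Hypothesis cF : forall u, O u -> continuous (F u).
Hypothesis cQ : forall j u (y : M), O u -> {for (u, y), continuous (fun p : V * M => Q j p.1 p.2)}.

Lemma coord_le_norm (h : V) j : `|h 0 j| <= `|h|.
Proof. by rewrite {2}/Num.norm /= mx_normrE; apply: (le_bigmax _ (fun ij => `|h ij.1 ij.2|) (0, j)). Qed.

Lemma diff_row_sum (f : V -> R^o) u (w : V) : 'd f u w = \sum_j w 0 j * 'd f u (chart_vec j).
Proof. exact: linear_chart_sum. Qed.

Lemma cQ_slice j u : O u -> continuous (fun y => Q j u y).
Proof.
move=> Ou y; apply: (@continuous_comp _ _ _ (fun y : M => (u, y)) (fun p : V * M => Q j p.1 p.2)).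
  exact: pair_continuousl.
exact: cQ.
Qed.

(** The partial derivatives converge uniformly in y, M being compact; so the
    increments of F are uniformly close to their linear parts, by the mean value
    theorem, and this survives integration. *)
Lemma diff_under_integral (P : proba R M) :
  differentiable (fun u => \int[P]_y F u y : R^o) u0 /\
  forall w, 'd (fun u => \int[P]_y F u y : R^o) u0 w = \sum_j w 0 j * \int[P]_y Q j u0 y.
Proof.
pose L (w : V) : R^o := \sum_j w 0 j * \int[P]_y Q j u0 y.
have Llin : linear L.
  move=> a u v; rewrite /L scaler_sumr -big_split /=; apply: eq_bigr => j _.
  by rewrite !mxE mulrDl -mulrA.
pose LL : {linear V -> R^o} := HB.pack L (GRing.isLinear.Build _ _ _ _ L Llin).
suff [] : differentiable (fun u => \int[P]_y F u y : R^o) u0 /\ 'd (fun u => \int[P]_y F u y : R^o) u0 = LL :> (V -> R^o).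
  move=> d E; split; first exact: d.
  by move=> w; exact: (congr1 (fun f : V -> R^o => f w) E).
apply: diff_intro.
  move=> w; apply: (cvg_sumR (F := nbhs w)) => j; apply: cvgM; last exact: cvg_cst.
  exact: coord_continuous.
move=> e e0.
pose d := e / n.+1%:R.
have d0 : 0 < d by rewrite divr_gt0.
have nearO : \forall u \near u0, O u by exact: (open_nbhs_nbhs (conj oO Ou0)).
have nearQ : \forall u \near u0, forall j y, `|Q j u y - Q j u0 y| <= d.
  apply: near_forall_ord => j.
  by apply: (near_compact_dist cM (P := fun u y => Q j u y) d0) => y; exact: cQ.
have : \forall u \near u0, O u /\ forall j y, `|Q j u y - Q j u0 y| <= d by exact: filterI.
move=> /nbhs_ballP [r /= r0 hr].
near=> h.
have hr0 : `|h| < r.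
  near: h; apply/nbhs_ballP; exists r => // k; rewrite -ball_normE /= sub0r normrN //.
have hball (s : R) : s \in `[0, 1] -> ball u0 r (s *: h + u0).
  rewrite in_itv /= => /andP[s0 s1]; rewrite -ball_normE /= distrC addrK normrZ ger0_norm //.
  by rewrite (le_lt_trans _ hr0) // ler_piMl.
have Oh : O (h + u0).
  by rewrite -(scale1r h); have [] := hr _ (hball 1 _) => //; rewrite in_itv /= ler01 lexx.
have step y : `|F (h + u0) y - (F u0 y + \sum_j h 0 j * Q j u0 y)| <= e * `|h|.
  have [s s01 E] : exists2 s : R, s \in `]0, 1[ &
     F (h + u0) y - F u0 y = 'd (F^~ y : V -> R^o) (s *: h + u0) h.
    apply: (@mean_value_line _ _ (F^~ y)) => s /hball /hr [Os _]; exact: dF.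
  have {}s01 : s \in `[0, 1] by move: s01; rewrite !in_itv /= => /andP[? ?]; rewrite !ltW.
  have [_ hQ] := hr _ (hball s s01).
  have {}E : F (h + u0) y - F u0 y = \sum_j h 0 j * Q j (s *: h + u0) y by rewrite E; exact: diff_row_sum.
  rewrite opprD addrA E.
  rewrite -sumrB.
  rewrite (le_trans (ler_norm_sum _ _ _)) // (@le_trans _ _ (\sum_(j < n) `|h| * d)) //.
    apply: ler_sum => j _; rewrite -mulrBr normrM ler_pM //.
    exact: coord_le_norm.
  rewrite sumr_const card_ord -mulr_natl mulrCA [leRHS]mulrC ler_wpM2l //.
  by rewrite /d mulrCA -[leRHS]mulr1 ler_wpM2l ?ltW // ltr_pdivrMr // mul1r ltr_nat.
have cs : continuous (fun y => F u0 y + \sum_j h 0 j * Q j u0 y).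
  move=> y; apply: cvgD; first exact: cF.
  apply: (cvg_sumR (F := nbhs y)) => j; apply: cvgM; first exact: cvg_cst.
  exact: cQ_slice.
have := Rintegral_dist_le P (cF Oh) cs step.
have Iq j : P.-integrable setT (EFin \o (fun y => Q j u0 y)).
  by apply: continuous_probability_integrable => //; exact: cQ_slice.
have -> : \int[P]_y (F u0 y + \sum_j h 0 j * Q j u0 y) = \int[P]_y F u0 y + LL h; last first.
  by rewrite opprD addrA.
have csum : continuous (fun y => \sum_j h 0 j * Q j u0 y).
  move=> y; apply: (cvg_sumR (F := nbhs y)) => j; apply: cvgM; first exact: cvg_cst.
  exact: cQ_slice.
rewrite RintegralD //; last 2 first.
- by apply: continuous_probability_integrable => //; exact: cF.
- exact: continuous_probability_integrable.
congr (_ + _); rewrite /LL /= /L.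
by apply: Rintegral_sumZ => j; exact: cQ_slice.
Unshelve. all: by end_near. Qed.

End diff_under_integral.
End integral_dist.

(** * The potential of a measure *)

Lemma near_continuous_at (X Y : topologicalType) (f h : X -> Y) (x : X) :
  (\near x, h x = f x) -> {for x, continuous h} -> {for x, continuous f}.
Proof.
move=> hf ch; rewrite /prop_for /continuous_at -(nbhs_singleton hf).
by apply: cvg_trans ch; exact: near_eq_cvg.
Qed.

Lemma partial_diff {R : realType} (U V W : normedModType R) (F : U * V -> W) (u : U) (c : V) :
  differentiable F (u, c) ->
  differentiable (fun u' => F (u', c)) u /\ forall w, 'd (fun u' => F (u', c)) u w = 'd F (u, c) (w, 0).
Proof.
move=> dF.
have dp : differentiable (fun u' : U => (u', cst c u')) u.
  by apply: differentiable_pair => //; exact: differentiable_cst.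
split=> [|w].
  exact: (differentiable_chain (f := fun u' : U => (u', c)) (erefl _) dp dF).
rewrite (diff_chain (f := fun u' : U => (u', c)) w (erefl _) dp dF).
congr ('d F (u, c) _).
have dc : differentiable (cst c : U -> V) u by exact: differentiable_cst.
have di : differentiable (@id U) u by [].
have := diff_pair di dc => /(congr1 (fun f : U -> U * V => f w)) /=.
by rewrite diff_cst diff_val.
Qed.

Lemma nbhs_prod (X Y : topologicalType) (x : X) (y : Y) (A : set X) (B : set Y) :
  nbhs x A -> nbhs y B -> nbhs (x, y) (A `*` B).
Proof. by move=> xA yB; exists (A, B). Qed.

Lemma pair_map_continuous (X Y Z T : topologicalType) (f : X -> Z) (h : Y -> T) x y :
  {for x, continuous f} -> {for y, continuous h} ->
  {for (x, y), continuous (fun p : X * Y => (f p.1, h p.2))}.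
Proof.
move=> cf ch; apply: (cvg_pair (G := nbhs (f x)) (H := nbhs (h y))).
- by apply: (cvg_comp fst f _ cf); exact: cvg_fst.
- by apply: (cvg_comp snd h _ ch); exact: cvg_snd.
Qed.

Section interaction.
Context {R : realType} {n : nat} {M : ptopologicalType}.
Variable S : smooth_manifold R n M.
Hypothesis cM : compact [set: M].
Variable W : M -> M -> R.
Hypothesis hW : C1_on_product S W.
Local Notation V := 'rV[R]_n.
Local Notation Wi i u y := (W (chart_inv i u) y).

Definition W_chart (i k : chart S) (p : V * V) : R^o := W (chart_inv i p.1) (chart_inv k p.2).

Lemma W_chart_diff (i k : chart S) u c : chart_image i u -> chart_image k c -> differentiable (W_chart i k) (u, c).
Proof. by move=> iu kc; have [+ _] := hW i k; apply. Qed.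

Lemma W_partial_diff (i : chart S) u y : chart_image i u ->
  differentiable (fun u : V => Wi i u y : R^o) u /\
  forall w, 'd (fun u : V => Wi i u y : R^o) u w = 'd (W_chart i (chart_at S y)) (u, chart_coord (chart_at S y) y) (w, 0).
Proof.
move=> iu; set k := chart_at S y.
have ky : chart_dom k y by exact: mem_chart_at.
have kc : chart_image k (chart_coord k y) by exists y.
have := partial_diff (W_chart_diff iu kc).
by rewrite (_ : (fun u' => _) = (fun u : V => Wi i u y)) //; apply/funext => u'; rewrite /W_chart /= coordK.
Qed.

Lemma W_chart_continuous (i k : chart S) u c : chart_image i u -> chart_image k c -> {for (u, c), continuous (W_chart i k)}.
Proof. by move=> iu kc; apply: differentiable_continuous; exact: W_chart_diff. Qed.

Lemma near_chart_image (i : chart S) u : chart_image i u -> \forall u' \near u, chart_image i u'.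
Proof. by move=> iu; apply: open_nbhs_nbhs; split => //; exact: chart_image_open. Qed.

Lemma W_slice_diff (i k : chart S) u y w : chart_image i u -> chart_dom k y ->
  'd (fun u : V => Wi i u y : R^o) u w = 'D_(w, 0) (W_chart i k) (u, chart_coord k y).
Proof.
move=> iu ky; have kc : chart_image k (chart_coord k y) by exists y.
have [_ /(_ w)] := partial_diff (W_chart_diff iu kc).
rewrite deriveE; last exact: W_chart_diff.
move=> <-; rewrite (_ : (fun u : V => Wi i u y : R^o) = (fun u' => W_chart i k (u', chart_coord k y))) //.
by apply/funext => u'; rewrite /W_chart /= coordK.
Qed.

Lemma W_partial_continuous (i : chart S) (w : V) u y : chart_image i u ->
  {for (u, y), continuous (fun p : V * M => 'd (fun u : V => Wi i u p.2 : R^o) (p.1) w)}.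
Proof.
move=> iu; set k := chart_at S y.
have ky : chart_dom k y by exact: mem_chart_at.
have kc : chart_image k (chart_coord k y) by exists y.
have [_ /(_ (w, 0)) cD] := hW i k.
apply: (near_continuous_at (h := fun p : V * M => 'D_(w, 0) (W_chart i k) (p.1, chart_coord k p.2))).
  have : nbhs (u, y) (chart_image i `*` chart_dom k).
    by apply: nbhs_prod; [exact: near_chart_image|exact: chart_dom_nbhs].
  by apply: filterS => -[u' y'] [/= iu' ky']; rewrite (W_slice_diff w iu' ky').
apply: (@continuous_comp _ _ _ (fun p : V * M => (p.1, chart_coord k p.2)) ('D_(w, 0) (W_chart i k))).
  by apply: (@pair_map_continuous _ _ _ _ id); [exact: cvg_id|exact: Defs.coord_continuous].
by apply: cD.
Qed.

Lemma W_continuous x y : {for (x, y), continuous (fun p : M * M => W p.1 p.2)}.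
Proof.
set i := chart_at S x; set k := chart_at S y.
have ix : chart_dom i x by exact: mem_chart_at.
have ky : chart_dom k y by exact: mem_chart_at.
apply: (near_continuous_at (h := fun p : M * M => W_chart i k (chart_coord i p.1, chart_coord k p.2))).
  have : nbhs (x, y) (chart_dom i `*` chart_dom k) by apply: nbhs_prod; exact: chart_dom_nbhs.
  by apply: filterS => -[x' y'] [/= ix' ky']; rewrite /W_chart /= !coordK.
apply: (@continuous_comp _ _ _ (fun p : M * M => (chart_coord i p.1, chart_coord k p.2)) (W_chart i k)).
  by apply: pair_map_continuous; exact: Defs.coord_continuous.
by apply: W_chart_continuous; [exists x|exists y].
Qed.

Lemma W_slice_continuous x : continuous (W x).
Proof.
move=> y; apply: (@continuous_comp _ _ _ (fun y : M => (x, y)) (fun p : M * M => W p.1 p.2)).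
  exact: pair_continuousl.
exact: W_continuous.
Qed.

Lemma potential_diff (P : proba R M) (i : chart S) u : chart_image i u ->
  differentiable (potential W P \o chart_inv i : V -> R^o) u /\
  forall w, 'd (potential W P \o chart_inv i : V -> R^o) u w =
    \sum_j w 0 j * \int[P]_y 'd (fun u : V => Wi i u y : R^o) u (chart_vec j).
Proof.
move=> iu.
have dF u' y : chart_image i u' -> differentiable (fun u : V => Wi i u y : R^o) u'.
  by move=> iu'; have [] := W_partial_diff y iu'.
have cF u' : chart_image i u' -> continuous (fun y => Wi i u' y).
  by move=> iu'; exact: W_slice_continuous.
have cQ j u' y : chart_image i u' ->
    {for (u', y), continuous (fun p : V * M => 'd (fun u : V => Wi i u p.2 : R^o) (p.1) (chart_vec j))}.
  by move=> iu'; exact: W_partial_continuous.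
have := @diff_under_integral R M cM n (fun u y => Wi i u y) (chart_image i) u (chart_image_open (i:=i)) iu dF cF cQ P.
exact.
Qed.

Lemma mdiff_potential (P : proba R M) (i : chart S) x (v : tangent S x) : chart_dom i x ->
  mdiff S (potential W P) x v =
  \sum_j to_chart i v 0 j * \int[P]_y 'd (fun u : V => Wi i u y : R^o) (chart_coord i x) (chart_vec j).
Proof.
move=> ix; have iu : chart_image i (chart_coord i x) by exists x.
have [d e] := potential_diff P iu.
have H := @mdiff_chart R n M S (potential W P) i x v ix.
have {}H := H d.
have {}e := e (to_chart i v).
refine (eq_trans H _).
refine e.
Qed.

(** The partial derivatives of the potential of P in the chart i, taken under
    the integral sign. *)
Definition dpot (i : chart S) (P : proba R M) (j : 'I_n) (x : M) : R :=
  \int[P]_y 'd (fun u : V => Wi i u y : R^o) (chart_coord i x) (chart_vec j).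

Lemma cov_row_potential (P : proba R M) (i : chart S) x j : chart_dom i x ->
  cov_row i (mdiff S (potential W P) x) 0 j = dpot i P j x.
Proof.
move=> ix; rewrite mxE (mdiff_potential _ _ ix) of_chartK // (bigD1 j) //= big1 ?addr0.
  by rewrite mxE !eqxx mul1r.
by move=> k kj; rewrite mxE (negbTE kj) mul0r.
Qed.

Section along_curve.
Hypothesis M2 : @second_countable M.
Hypothesis hM : hausdorff_space M.
Variables (T : R) (mu : R -> proba R M).
Hypothesis T0 : 0 <= T.
Hypothesis nmu : narrowly_continuous T mu.

Lemma dpot_continuous (i : chart S) j x0 t0 : chart_dom i x0 ->
  {for (x0, t0), continuous (fun p : M * R => dpot i (mu (clamp T p.2)) j p.1)}.
Proof.
move=> ix0.
have cQ x y : chart_dom i x -> {for (x, y), continuous (fun p : M * M => 'd (fun u : V => Wi i u p.2 : R^o) (chart_coord i p.1) (chart_vec j))}.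
  move=> ix.
  apply: (@continuous_comp _ _ _ (fun p : M * M => (chart_coord i p.1, p.2)) (fun p : V * M => 'd (fun u : V => Wi i u p.2 : R^o) (p.1) (chart_vec j))).
    by apply: (@pair_map_continuous _ _ _ _ _ id); [exact: Defs.coord_continuous|exact: cvg_id].
  by apply: W_partial_continuous; exists x.
apply: (joint_continuous_integral cM T0 nmu (P := fun x y => 'd (fun u : V => Wi i u y : R^o) (chart_coord i x) (chart_vec j))).
  by move=> y; exact: cQ.
have := chart_dom_nbhs ix0; apply: filterS => x ix y.
apply: (@continuous_comp _ _ _ (fun y : M => (x, y)) (fun p : M * M => 'd (fun u : V => Wi i u p.2 : R^o) (chart_coord i p.1) (chart_vec j))).
  exact: pair_continuousl.
exact: cQ.
Qed.

Lemma mobility_continuous (K : M -> M -> R) x0 t0 : continuous (fun p : M * M => K p.1 p.2) ->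
  {for (x0, t0), continuous (fun p : M * R => mobility K (mu (clamp T p.2)) p.1)}.
Proof.
move=> cK.
apply: (joint_continuous_integral cM T0 nmu (P := K)); first by move=> y; exact: cK.
apply: nearW => x y.
apply: (@continuous_comp _ _ _ (fun y : M => (x, y)) (fun p : M * M => K p.1 p.2)).
  exact: pair_continuousl.
exact: cK.
Qed.

End along_curve.
End interaction.

(** * Estimates on potentials, uniform in time *)

Section uniform_potential.
Context {R : realType} {n : nat} {M : ptopologicalType}.
Variable S : smooth_manifold R n M.
Hypothesis cM : compact [set: M].
Hypothesis M2 : @second_countable M.
Hypothesis hM : hausdorff_space M.
Variable g : riemannian_metric S.
Variable W : M -> M -> R.
Hypothesis hW : C1_on_product S W.
Variables (T : R) (mu : R -> proba R M).
Hypothesis T0 : 0 <= T.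
Hypothesis nmu : narrowly_continuous T mu.
Local Notation Dpot t x := (mdiff S (potential W (mu (clamp T t))) x).

Lemma mdiff_potential_coord (P : proba R M) (i : chart S) x (v : tangent S x) : chart_dom i x ->
  mdiff S (potential W P) x v = \sum_j to_chart i v 0 j * dpot W i P j x.
Proof.
move=> ix; rewrite (covector_chart _ _ ix); apply: eq_bigr => j _.
by have := cov_row_potential cM hW P j ix; rewrite mxE => ->.
Qed.

Lemma mdiff_potential_coord_diff (P Q : proba R M) (i : chart S) x (v : tangent S x) : chart_dom i x ->
  mdiff S (potential W P) x v - mdiff S (potential W Q) x v =
  \sum_j to_chart i v 0 j * (dpot W i P j x - dpot W i Q j x).
Proof.
move=> ix; have e1 := mdiff_potential_coord P v ix; have e2 := mdiff_potential_coord Q v ix.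
refine (eq_trans (f_equal2 (fun a b => a - b) e1 e2) _).
by rewrite -sumrB; apply: eq_bigr => j _; rewrite mulrBr.
Qed.

Lemma sum_coord_le (a : 'rV[R]_n) (b : 'I_n -> R) (d : R) : (forall j, `|b j| <= d) ->
  `|\sum_j a 0 j * b j| <= n%:R * d * `|a|.
Proof.
move=> bd; rewrite (le_trans (ler_norm_sum _ _ _)) // (@le_trans _ _ (\sum_(j < n) `|a| * d)) //.
  by apply: ler_sum => j _; rewrite normrM ler_pM // coord_le_norm.
by rewrite sumr_const card_ord -(mulr_natl (`|a| * d)) -mulrA [d * _]mulrC.
Qed.

Lemma near_dpot (i : chart S) x0 t0 (e : R) : 0 < e -> chart_dom i x0 ->
  exists r : R, 0 < r /\ \forall x \near x0, forall t, `|t0 - t| < r -> forall j,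
     `|dpot W i (mu (clamp T t0)) j x0 - dpot W i (mu (clamp T t)) j x| < e.
Proof.
move=> e0 ix0.
have : \forall p \near (x0, t0), forall j,
     `|dpot W i (mu (clamp T t0)) j x0 - dpot W i (mu (clamp T p.2)) j p.1| < e.
  apply: near_forall_ord => j.
  by have /cvgrPdist_lt := dpot_continuous (j := j) (t0 := t0) cM hW T0 nmu ix0; apply.
move=> [[A B] [/= Ax Bt] AB].
have /nbhs_ballP [r /= r0 rB] := Bt.
exists r; split => //; apply: filterS Ax => x Ax t tr; exact: (AB (x, t) (conj Ax (rB t tr))).
Qed.

Lemma compact_cylinder : compact ([set: M] `*` `[0, T]).
Proof. by apply: compact_setX => //; exact: segment_compact. Qed.

(** Locally the coefficients of the differential are bounded and the coordinates
    of v are controlled by |v|; compactness of M x [0, T] makes the constant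
    global. *)
Lemma potential_bound : exists C : R, 0 <= C /\
  forall t x (v : tangent S x), `|Dpot t x v| <= C * tnorm g v.
Proof.
have /compact_near_coveringP /(_ R +oo
  (fun C p => forall v : tangent S p.1, `|Dpot p.2 p.1 v| <= C * tnorm g v) _) h := compact_cylinder.
have {h} : \forall C \near +oo, ([set: M] `*` `[0, T]) `<=` (fun p => forall v : tangent S p.1, `|Dpot p.2 p.1 v| <= C * tnorm g v).
  apply: h => -[x0 t0] _.
  have ix0 := mem_chart_at S x0; set i := chart_at S x0 in ix0.
  have [c [c0 hc]] := tnorm_lower_bound g ix0.
  have [r [r0 hr]] := near_dpot t0 (ltr01) ix0.
  pose B : R := \sum_j `|dpot W i (mu (clamp T t0)) j x0| + 1.
  have B0 : 0 < B by rewrite ltr_wpDl // sumr_ge0.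
  exists (([set x | forall t, `|t0 - t| < r -> forall j,
     `|dpot W i (mu (clamp T t0)) j x0 - dpot W i (mu (clamp T t)) j x| < 1] `&`
     [set x | chart_dom i x /\ forall v : tangent S x, c * `|to_chart i v| <= tnorm g v]) `*` ball t0 r,
     [set C | n%:R * B / c <= C]).
    split=> /=; last by exists (n%:R * B / c); split; [exact: num_real|move=> C /ltW].
    apply: nbhs_prod; first exact: filterI.
    exact: nbhsx_ballx.
  move=> [[x t] C] /= [[[hx [ix cx]] tr] hC] v.
  rewrite (mdiff_potential_coord _ _ ix).
  apply: (@le_trans _ _ (n%:R * B * `|to_chart i v|)).
    apply: sum_coord_le => j.
    rewrite -(subrK (dpot W i (mu (clamp T t0)) j x0) (dpot W i _ _ _)) (le_trans (ler_normD _ _)) //.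
    rewrite addrC lerD //.
      rewrite (bigD1 j) //= lerDl; exact: sumr_ge0.
    by rewrite distrC ltW // hx.
  apply: (@le_trans _ _ (n%:R * B / c * tnorm g v)).
    rewrite -[leRHS]mulrA ler_wpM2l //; first by rewrite mulr_ge0 // ltW.
    by rewrite ler_pdivlMl.
  by rewrite ler_wpM2r // tnorm_ge0.
move=> [C0 [_ hC]]; exists (`|C0| + 1); split; first by rewrite addr_ge0.
move=> t x v.
have := hC (`|C0| + 1) _ (x, clamp T t) _ v; rewrite /= (clamp_id (t := clamp T t)); last exact: clamp_itv.
apply.
  by rewrite ltr_pwDr // ler_norm.
by split => //=; rewrite in_itv /=; exact: clamp_itv.
Qed.

(** Uniform continuity in time of the differential of the potential, obtained
    like the bound, by compactness of M x [0, T]. *)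
Lemma potential_modulus (e : R) : 0 < e -> exists d : R, 0 < d /\
  forall t s, 0 <= t <= T -> `|t - s| < d -> forall x (v : tangent S x),
    `|Dpot t x v - Dpot s x v| <= e * tnorm g v.
Proof.
move=> e0.
have /compact_near_coveringP /(_ R 0^'+
  (fun d p => forall s, `|p.2 - s| < d -> forall v : tangent S p.1, `|Dpot p.2 p.1 v - Dpot s p.1 v| <= e * tnorm g v) _) h := compact_cylinder.
have {h} : \forall d \near 0^'+, ([set: M] `*` `[0, T]) `<=`
   (fun p => forall s, `|p.2 - s| < d -> forall v : tangent S p.1, `|Dpot p.2 p.1 v - Dpot s p.1 v| <= e * tnorm g v).
  apply: h => -[x0 t0] _.
  have ix0 := mem_chart_at S x0; set i := chart_at S x0 in ix0.
  have [c [c0 hc]] := tnorm_lower_bound g ix0.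
  (* Each of the n coefficients moves by at most 2 q between t and s, both near
     t0, and the coordinates of v are at most |v| / c. *)
  pose q := e * c / 2 / n.+1%:R.
  have q0 : 0 < q by rewrite !divr_gt0 ?mulr_gt0.
  have [r [r0 hr]] := near_dpot t0 q0 ix0.
  exists (([set x | forall t, `|t0 - t| < r -> forall j,
     `|dpot W i (mu (clamp T t0)) j x0 - dpot W i (mu (clamp T t)) j x| < q] `&`
     [set x | chart_dom i x /\ forall v : tangent S x, c * `|to_chart i v| <= tnorm g v]) `*` ball t0 (r / 2),
     [set d | d < r / 2]).
    split=> /=; last first.
      by apply: nbhs_right_lt; rewrite divr_gt0.
    apply: nbhs_prod; first exact: filterI.
    by apply: nbhsx_ballx; rewrite divr_gt0.
  move=> [[x t] d] /= [[[hx [ix cx]] tr] hd] s ts v.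
  have tr1 : `|t0 - t| < r.
    by apply: lt_trans tr _; rewrite ltr_pdivrMr // ltr_pMr // ltr1n.
  have sr1 : `|t0 - s| < r.
    rewrite -(subrK t t0) -addrA (le_lt_trans (ler_normD _ _)) // (splitr r) ltrD //.
    exact: lt_trans ts hd.
  rewrite (mdiff_potential_coord_diff _ _ _ ix).
  apply: (@le_trans _ _ (n%:R * (q + q) * `|to_chart i v|)).
    apply: sum_coord_le => j.
    rewrite -(subrK (dpot W i (mu (clamp T t0)) j x0) (dpot W i _ _ _)) -addrA (le_trans (ler_normD _ _)) //.
    by apply: lerD; [rewrite distrC; exact: ltW (hx t tr1 j)|exact: ltW (hx s sr1 j)].
  apply: (@le_trans _ _ (e * (c * `|to_chart i v|))).
    rewrite mulrA ler_wpM2r //.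
    rewrite (_ : q + q = e * c / n.+1%:R); last by rewrite /q; field.
    rewrite mulrCA -[leRHS]mulr1 ler_wpM2l //; first by rewrite mulr_ge0 // ltW.
    by rewrite ltW // ltr_pdivrMr // mul1r ltr_nat.
  by rewrite ler_wpM2l // ltW.
move=> hd.
have [d [d0 Hd]] : exists d, 0 < d /\ ([set: M] `*` `[0, T]) `<=`
   (fun p => forall s, `|p.2 - s| < d -> forall v : tangent S p.1, `|Dpot p.2 p.1 v - Dpot s p.1 v| <= e * tnorm g v).
  have := filterI (nbhs_right_gt (0 : R)) hd => /(_ _) /filter_ex [d [d0 Hd]]; by exists d.
exists d; split => // t s t0T ts x v.
by apply: (Hd (x, t)) => //; split => //=; rewrite in_itv.
Qed.

End uniform_potential.

(** * Smooth steps *)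

Section smooth_step.
Context {R : realType}.
Implicit Types x a e : R.

(** The square of the positive part, of class C^1; it is the building block of a
    C^1 step. *)
Definition sqpos x := Num.max 0 x ^+ 2.

Lemma sqpos_derive x : is_derive x (1 : R) sqpos (2 * Num.max 0 x).
Proof.
have [x0|x0|<-] := ltgtP 0 x.
- apply: (near_eq_is_derive (f := fun y : R => y ^+ 2)).
    near=> y; rewrite /sqpos.
    have y0 : 0 < y by near: y; exact: lt_nbhsr.
    by rewrite (max_idPr (ltW y0)).
  apply: is_derive_eq.
  by rewrite /GRing.scale /= !mulr1 mulrDl mul1r.
- apply: (near_eq_is_derive (f := cst 0)).
    near=> y; rewrite /sqpos.
    have y0 : y < 0 by near: y; exact: lt_nbhsl.
    by rewrite (max_idPl (ltW y0)) expr0n.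
  by rewrite mulr0; exact: is_derive_cst.
have [d E] : differentiable (sqpos : R^o -> R^o) 0 /\ 'd (sqpos : R^o -> R^o) 0 = 'd (cst 0 : R^o -> R^o) (0 : R^o) :> (R^o -> R^o).
  apply: (@diff_intro R R^o R^o sqpos 0 ('d (cst 0 : R^o -> R^o) (0 : R^o))).
    by apply: diff_continuous; exact: differentiable_cst.
  move=> e e0; near=> h.
  rewrite diff_cst /= addr0 /sqpos maxxx expr0n /= !subr0 normrX.
  have he : `|h| < e by near: h; apply/nbhs_ballP; exists e => //= k; rewrite -ball_normE /= sub0r normrN.
  rewrite expr2 ler_pM // ?normr_ge0 //.
    rewrite (le_trans _ (ltW he)) //; case: (ltP 0 h) => h0; by rewrite ?normr0.
  by case: (ltP 0 h) => h0; rewrite ?normr0.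
rewrite mulr0; apply: DeriveDef; first exact: diff_derivable d.
rewrite (deriveE (1 : R^o) d).
rewrite (congr1 (fun f : R^o -> R^o => f 1) E).
by rewrite diff_cst.
Unshelve. all: by end_near. Qed.

(** The quadratic spline that rises from 0 at 0 to 1 at 1 with the knot 1/2. *)
Definition step x := 2 * (sqpos x - 2 * sqpos (x - 2^-1) + sqpos (x - 1)).
Definition dstep x := 4 * (Num.max 0 x - 2 * Num.max 0 (x - 2^-1) + Num.max 0 (x - 1)).

(** A step that rises on [a, a + e]. *)
Definition rstep a e x := step ((x - a) / e).
Definition drstep a e x := dstep ((x - a) / e) / e.

Lemma sqpos_affine_derive (c e x : R) : is_derive x (1 : R) (fun y : R => sqpos ((y - c) / e)) (2 * Num.max 0 ((x - c) / e) / e).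
Proof.
have h := sqpos_derive ((x - c) / e).
have d1 : is_derive x (1 : R) (fun y : R => (y - c) / e) e^-1.
  by apply: is_derive_eq; rewrite /= subr0 scaler1 scaler0 add0r.
have d2 : derivable (fun y : R => (y - c) / e) x 1 by [].
apply: DeriveDef.
  apply/derivable1_diffP; apply: differentiable_comp; first exact/derivable1_diffP.
  by apply/derivable1_diffP; exact: ex_derive.
have d3 : derivable sqpos ((x - c) / e) 1 by have [] := h.
rewrite -derive1E.
refine (eq_trans (@derive1_comp R (fun y : R => (y - c) / e) sqpos x d2 d3) _).
have [_ E1] := h; have [_ E2] := d1.
by rewrite !derive1E E1 E2.
Qed.

Lemma step_le0 x : x <= 0 -> step x = 0.
Proof.
by move=> x0; rewrite /step /sqpos !(max_idPl _) ?expr0n /=; lra.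
Qed.

Lemma step_ge1 x : 1 <= x -> step x = 1.
Proof.
by move=> x1; rewrite /step /sqpos !(max_idPr _); lra.
Qed.

Lemma step_itv x : 0 <= step x <= 1.
Proof.
have [x0|x0] := leP x 0; first by rewrite step_le0 // lexx ler01.
have [x1|x1] := leP 1 x; first by rewrite step_ge1 // lexx ler01.
rewrite /step /sqpos (max_idPr (ltW x0)) (max_idPl (_ : x - 1 <= 0)) ?expr0n /=; last by lra.
have [h|h] := leP x 2^-1.
  by rewrite (max_idPl _) ?expr0n /=; nra.
by rewrite (max_idPr _); nra.
Qed.

Lemma dstep_ge0 x : 0 <= dstep x.
Proof.
rewrite /dstep.
have [x0|x0] := leP x 0.
  by rewrite !(max_idPl _); lra.
have [x1|x1] := leP 1 x.
  by rewrite !(max_idPr _); lra.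
rewrite (max_idPl (_ : x - 1 <= 0)); last by lra.
have [h|h] := leP x 2^-1.
  by rewrite (max_idPl (_ : x - 2^-1 <= 0)); lra.
by rewrite (max_idPr (_ : 0 <= x - 2^-1)); lra.
Qed.

Lemma dstep_out x : (x <= 0) || (1 <= x) -> dstep x = 0.
Proof.
rewrite /dstep => /orP[x0|x1]; first by rewrite !(max_idPl _); lra.
by rewrite !(max_idPr _); lra.
Qed.

Lemma dstep_continuous : continuous dstep.
Proof.
move=> x; apply: cvgM; first exact: cvg_cst.
have cmax (c : R) : (fun y : R => Num.max 0 (y - c)) y @[y --> x] --> Num.max 0 (x - c).
  by apply: (@continuous_max _ _ (cst 0) (fun y => y - c)); [exact: cvg_cst|apply: cvgB; [exact: cvg_id|exact: cvg_cst]].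
apply: cvgD; last exact: cmax.
apply: cvgB; first by have := cmax 0; rewrite subr0; under eq_fun do rewrite subr0.
by apply: cvgM; [exact: cvg_cst|exact: cmax].
Qed.

Variables (a e : R).
Hypothesis e0 : 0 < e.

Lemma rstep_derive x : is_derive x (1 : R) (rstep a e) (drstep a e x).
Proof.
have h1 := sqpos_affine_derive a e x.
have h2 := sqpos_affine_derive (a + e / 2) e x.
have h3 := sqpos_affine_derive (a + e) e x.
rewrite (_ : rstep a e = (fun y => 2 * (sqpos ((y - a) / e) - 2 * sqpos ((y - (a + e / 2)) / e) + sqpos ((y - (a + e)) / e)))); last first.
  apply/funext => y; rewrite /rstep /step.
  have -> : (y - a) / e - 2^-1 = (y - (a + e / 2)) / e by field; rewrite gt_eqF.
  by have -> : (y - a) / e - 1 = (y - (a + e)) / e by field; rewrite gt_eqF.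
apply: is_derive_eq.
rewrite /drstep /dstep.
have -> : (x - a) / e - 2^-1 = (x - (a + e / 2)) / e by field; rewrite gt_eqF.
have -> : (x - a) / e - 1 = (x - (a + e)) / e by field; rewrite gt_eqF.
rewrite /GRing.scale /=.
by field; rewrite gt_eqF.
Qed.

Lemma drstep_ge0 x : 0 <= drstep a e x.
Proof. by rewrite /drstep divr_ge0 ?dstep_ge0 // ltW. Qed.

Lemma drstep_out x : ~~ (a < x < a + e) -> drstep a e x = 0.
Proof.
rewrite negb_and -!leNgt => h; rewrite /drstep dstep_out ?mul0r //.
case/orP: h => h; apply/orP; [left|right].
  by rewrite ler_pdivrMr // mul0r subr_le0.
by rewrite ler_pdivlMr // mul1r lerBrDr addrC.
Qed.

Lemma drstep_continuous : continuous (drstep a e).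
Proof.
move=> x; apply: cvgM; last exact: cvg_cst.
apply: (cvg_comp (fun y => (y - a) / e) dstep); last exact: dstep_continuous.
by apply: cvgM; [apply: cvgB; [exact: cvg_id|exact: cvg_cst]|exact: cvg_cst].
Qed.

Lemma rstep_before x : x <= a -> rstep a e x = 0.
Proof. by move=> xa; rewrite /rstep step_le0 // ler_pdivrMr // mul0r subr_le0. Qed.

Lemma rstep_after x : a + e <= x -> rstep a e x = 1.
Proof. by move=> xa; rewrite /rstep step_ge1 // ler_pdivlMr // mul1r lerBrDr addrC. Qed.

Lemma rstep_itv x : 0 <= rstep a e x <= 1.
Proof. exact: step_itv. Qed.

Lemma rstep_continuous : continuous (rstep a e).
Proof.
move=> x; apply: differentiable_continuous; apply/derivable1_diffP.
by have [] := rstep_derive x.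
Qed.

End smooth_step.

Section step_average.
Context {R : realType}.
Local Notation leb := (@lebesgue_measure R).
Variable T : R.
Hypothesis T0 : 0 < T.

Lemma itv_continuous_integrable (f : R -> R) : continuous f -> leb.-integrable `]0, T[ (EFin \o f).
Proof.
move=> cf; apply: (@integrableS _ _ _ leb `[0, T]) => //.
  by apply: subset_itv; rewrite bnd_simp.
by apply: continuous_compact_integrable; [exact: segment_compact|exact: continuous_subspaceT].
Qed.

Lemma drstep_integral (a e : R) : 0 < e -> 0 <= a -> a + e <= T ->
  \int[leb]_(x in `]0, T[) drstep a e x = 1.
Proof.
move=> e0 a0 aT.
have cD := drstep_continuous (a := a) (e := e).
have cS := rstep_continuous (a := a) e0.
have E : (\int[leb]_(x in `[0%R, T]) (drstep a e x)%:E = (rstep a e T)%:E - (rstep a e 0)%:E)%E.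
  apply: continuous_FTC2 => //.
  - exact: continuous_subspaceT.
  - split; first by move=> x _; have [] := rstep_derive a e0 x.
    + by apply: cvg_at_right_filter; exact: cS.
    + by apply: cvg_at_left_filter; exact: cS.
  - by move=> x _; rewrite derive1E; have [] := rstep_derive a e0 x.
rewrite (rstep_before e0 a0) (rstep_after e0 aT) sube0 in E.
rewrite /Rintegral -(@integral_itv_bndoo R 0 T _ true false); first by rewrite E.
by apply/measurable_EFinP; apply: measurable_funTS; exact: continuous_measurable_fun.
Qed.

(** The derivative of the step is a probability density on [a, a + e], hence an
    approximation of a Dirac mass when this interval shrinks to s. *)
Lemma step_average (F : R -> R) (s eta : R) : continuous F -> 0 < eta ->
  exists d, 0 < d /\ forall a e, 0 < e -> 0 <= a -> a + e <= T -> `|a - s| < d -> `|a + e - s| < d ->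
    `|\int[leb]_(x in `]0, T[) (drstep a e x * F x) - F s| <= eta.
Proof.
move=> cF eta0.
have : \forall x \near s, `|F x - F s| < eta.
  by have /cvgrPdist_lt /(_ _ eta0) := cF s; apply: filterS => x; rewrite distrC.
move=> /nbhs_ballP [d /= d0 hd]; exists d; split => // a e e0 a0 aT das daes.
have cD := drstep_continuous (a := a) (e := e).
have iD := itv_continuous_integrable cD.
have iDF : leb.-integrable `]0, T[ (EFin \o (fun x => drstep a e x * F x)).
  by apply: itv_continuous_integrable => x; apply: cvgM; [exact: cD|exact: cF].
have iDFs : leb.-integrable `]0, T[ (EFin \o (fun x => drstep a e x * F s)).
  by apply: itv_continuous_integrable => x; apply: cvgM; [exact: cD|exact: cvg_cst].
have mD : measurable (`]0, T[ : set R) by exact: measurable_itv.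
have -> : F s = \int[leb]_(x in `]0, T[) (drstep a e x * F s).
  by rewrite RintegralZr // drstep_integral // mul1r.
rewrite -RintegralB //.
have iB : leb.-integrable `]0, T[ (EFin \o (fun x => drstep a e x * F x - drstep a e x * F s)).
  apply: itv_continuous_integrable => x; apply: cvgB; first by apply: cvgM; [exact: cD|exact: cF].
  by apply: cvgM; [exact: cD|exact: cvg_cst].
apply: le_trans; first by apply: le_normr_Rintegral.
have -> : eta = \int[leb]_(x in `]0, T[) (drstep a e x * eta).
  by rewrite RintegralZr // drstep_integral // mul1r.
apply: le_Rintegral => //.
- exact: (integrable_norm iB).
- by apply: itv_continuous_integrable => x; apply: cvgM; [exact: cD|exact: cvg_cst].
move=> x _; rewrite -mulrBr normrM (ger0_norm (drstep_ge0 a e0 x)).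
have [/andP[ax xa]|/(drstep_out e0) ->] := boolP (a < x < a + e); last by rewrite !mul0r.
rewrite ler_wpM2l ?drstep_ge0 //; apply/ltW/hd; rewrite /ball /=.
rewrite ltr_norml in das; rewrite ltr_norml in daes; rewrite ltr_norml.
by lra.
Qed.

End step_average.

(** * Functions of class C^1 and separated test functions *)

Section product_calculus.
Context {R : realType} {U V : normedModType R}.

Lemma fst_diff (p : U * V) : differentiable (fst : U * V -> U) p /\ forall w, 'd (fst : U * V -> U) p w = w.1.
Proof.
have lf : linear (fst : U * V -> U) by [].
pose L : {linear (U * V)%type -> U} := HB.pack (fst : U * V -> U) (GRing.isLinear.Build _ _ _ _ _ lf).
have [|e e0|d e] := @diff_intro R _ _ (fst : U * V -> U) p L.
- by move=> q; exact: cvg_fst.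
- have N : forall h : (U * V)%type, `|(h + p).1 - p.1 - L h| <= e * `|h|.
    by move=> h; rewrite /= addrK subrr normr0 mulr_ge0 // ltW.
  exact: (@filterE _ (nbhs (0 : (U * V)%type)) (nbhs_filter _) _ N).
by split => // w; rewrite e.
Qed.

Lemma snd_diff (p : U * V) : differentiable (snd : U * V -> V) p /\ forall w, 'd (snd : U * V -> V) p w = w.2.
Proof.
have lf : linear (snd : U * V -> V) by [].
pose L : {linear (U * V)%type -> V} := HB.pack (snd : U * V -> V) (GRing.isLinear.Build _ _ _ _ _ lf).
have [|e e0|d e] := @diff_intro R _ _ (snd : U * V -> V) p L.
- by move=> q; exact: cvg_snd.
- have N : forall h : (U * V)%type, `|(h + p).2 - p.2 - L h| <= e * `|h|.
    by move=> h; rewrite /= addrK subrr normr0 mulr_ge0 // ltW.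
  exact: (@filterE _ (nbhs (0 : (U * V)%type)) (nbhs_filter _) _ N).
by split => // w; rewrite e.
Qed.

(** The product rule for functions of separate variables. *)
Lemma separated_diff (f : U -> R) (psi : V -> R) (p : U * V) :
  differentiable f p.1 -> differentiable psi p.2 ->
  differentiable (fun q : U * V => psi q.2 * f q.1) p /\
  forall w, 'd (fun q : U * V => psi q.2 * f q.1) p w = psi p.2 * 'd f (p.1) (w.1) + f p.1 * 'd psi (p.2) (w.2).
Proof.
move=> df dpsi.
have [d1 e1] := fst_diff p; have [d2 e2] := snd_diff p.
have D1 := differentiable_chain (erefl _) d1 df.
have D2 := differentiable_chain (erefl _) d2 dpsi.
split; first exact: (differentiableM D2 D1).
move=> w; have := diffM D2 D1 => /(congr1 (fun f : U * V -> R => f w)).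
move=> E; refine (eq_trans E _).
have E1 := eq_trans (diff_chain w (erefl _) d1 df) (f_equal ('d f (p.1)) (e1 w)).
have E2 := eq_trans (diff_chain w (erefl _) d2 dpsi) (f_equal ('d psi (p.2)) (e2 w)).
exact: f_equal2 (f_equal (fun z => psi p.2 * z) E1) (f_equal (fun z => f p.1 * z) E2).
Qed.

End product_calculus.

Section C1_functions.
Context {R : realType} {n : nat} {M : ptopologicalType}.
Variable S : smooth_manifold R n M.
Local Notation V := 'rV[R]_n.

Definition C1_on_manifold (f : M -> R) := forall i : chart S, Ck 1 (chart_image i) (f \o chart_inv i : V -> R^o).

Lemma C1_diff f (i : chart S) u : C1_on_manifold f -> chart_image i u -> differentiable (f \o chart_inv i : V -> R^o) u.
Proof. by move=> hf iu; have [+ _] := hf i; apply. Qed.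

Lemma C1_derive_continuous f (i : chart S) u (w : V) : C1_on_manifold f -> chart_image i u ->
  {for u, continuous (fun u => 'd (f \o chart_inv i : V -> R^o) u w)}.
Proof.
move=> hf iu; have [_ /(_ w u iu)] := hf i.
apply: near_continuous_at; have := near_chart_image iu.
by apply: filterS => u' iu'; rewrite deriveE //; exact: C1_diff.
Qed.

Lemma C1_cov_continuous f (i : chart S) x j : C1_on_manifold f -> chart_dom i x ->
  {for x, continuous (fun y => cov_row i (mdiff S f y) 0 j)}.
Proof.
move=> hf ix; have iu : chart_image i (chart_coord i x) by exists x.
apply: (continuous_from_chart (F := fun u => 'd (f \o chart_inv i : V -> R^o) u (chart_vec j)) ix); last exact: C1_derive_continuous.
move=> y iy; have d : differentiable (f \o chart_inv i : V -> R^o) (chart_coord i y) by apply: C1_diff => //; exists y.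
have H := @mdiff_chart R n M S f i y (of_chart i y (chart_vec j)) iy d.
by rewrite mxE; refine (eq_trans H _); rewrite of_chartK.
Qed.

Lemma C1_continuous f : C1_on_manifold f -> continuous f.
Proof.
move=> hf x; have ix := mem_chart_at S x; set i := chart_at S x in ix.
apply: (continuous_from_chart (F := f \o chart_inv i) ix).
  by move=> y iy; rewrite /= coordK.
by apply: (@differentiable_continuous _ _ _ _ (f \o chart_inv i : V -> R^o)); apply: C1_diff => //; exists x.
Qed.

Lemma Borel_covector_C1 f (E : set (measurableTypeR R)) : measurable E -> C1_on_manifold f -> Borel_covector E (fun _ x => mdiff S f x).
Proof.
move=> mE hf i j.
apply: (measurable_comp (F := chart_dom i : set (borelType M)) (f := fun x : borelType M => cov_row i (mdiff S f x) 0 j)).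
- exact: chart_dom_measurable.
- by move=> _ [p [ip _] <-].
- apply: open_continuous_borel; first exact: dom_open.
  by move=> x ix; exact: C1_cov_continuous.
- by apply: measurable_funTS; exact: measurable_fst.
Qed.

Lemma potential_C1 (cM : compact [set: M]) W (P : proba R M) : C1_on_product S W -> C1_on_manifold (potential W P).
Proof.
move=> hW i; split; first by move=> u iu; have [] := potential_diff cM hW P iu.
move=> w u iu.
apply: (near_continuous_at (h := fun u => 'd (potential W P \o chart_inv i : V -> R^o) u w)).
  have := near_chart_image iu.
  by apply: filterS => u' iu'; rewrite deriveE //; have [] := potential_diff cM hW P iu'.
apply: (near_continuous_at (h := fun u => \sum_j w 0 j * \int[P]_y 'd (fun u : V => W (chart_inv i u) y : R^o) u (chart_vec j))).
  have := near_chart_image iu.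
  by apply: filterS => u' iu'; have [_ e] := potential_diff cM hW P iu'; exact: esym (e w).
apply: (cvg_sumR (F := nbhs u)) => j; apply: cvgM; first exact: cvg_cst.
apply/cvgrPdist_le => e e0.
have : \forall u' \near u, forall y, `|'d (fun u : V => W (chart_inv i u) y : R^o) u' (chart_vec j) - 'd (fun u : V => W (chart_inv i u) y : R^o) u (chart_vec j)| <= e.
  by apply: (near_compact_dist cM (P := fun u y => 'd (fun u : V => W (chart_inv i u) y : R^o) u (chart_vec j)) e0) => y; exact: W_partial_continuous.
apply: filterS2 (near_chart_image iu) => u' iu' h.
have cQ u2 : chart_image i u2 -> continuous (fun y => 'd (fun u : V => W (chart_inv i u) y : R^o) u2 (chart_vec j)).
  move=> iu2 y; apply: (@continuous_comp _ _ _ (fun y : M => (u2, y)) (fun p : V * M => 'd (fun u : V => W (chart_inv i u) p.2 : R^o) (p.1) (chart_vec j))).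
  - exact: pair_continuousl.
  - exact: W_partial_continuous.
refine (@Rintegral_dist_le R M cM P _ _ e (cQ u iu) (cQ u' iu') _).
by move=> y; rewrite distrC; exact: h.
Qed.

Lemma C1c_separated (cM : compact [set: M]) (T a b : R) (psi dpsi : R -> R) f : C1_on_manifold f ->
  (forall r, is_derive r (1 : R) psi (dpsi r)) -> continuous dpsi -> 0 < a -> b < T ->
  (forall r, (r < a) || (b < r) -> psi r = 0) ->
  C1c S T (fun x r => psi r * f x).
Proof.
move=> hf dpsiP cdpsi a0 bT psi0.
have dps r : differentiable (psi : R -> R) r by apply/derivable1_diffP; have [] := dpsiP r.
have dpsE r (s : R) : 'd (psi : R -> R) r s = s * dpsi r.
  have := diff1E (dps r) => /(congr1 (fun f : R -> R => f s)) E; refine (eq_trans E _).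
  by rewrite derive1E; have [_ ->] := dpsiP r.
split; last first.
  exists ([set: M] `*` `[a, b]); split.
  - by apply: compact_setX => //; exact: segment_compact.
  - move=> [x r] [_ /=]; rewrite !in_itv /= => /andP[ar rb]; split => //=.
    by rewrite (lt_le_trans a0 ar) (le_lt_trans rb bT).
  - move=> x r h; rewrite psi0 ?mul0r //; apply: contrapT => /negP.
    rewrite negb_or -!leNgt => ab; apply: h; split => //=.
move=> i.
have D (p : V * R) : chart_image i p.1 -> differentiable (fun p : V * R => psi p.2 * f (chart_inv i p.1) : R^o) p /\
   forall w, 'd (fun p : V * R => psi p.2 * f (chart_inv i p.1) : R^o) p w =
     psi p.2 * 'd (f \o chart_inv i : V -> R^o) (p.1) (w.1) + f (chart_inv i p.1) * (w.2 * dpsi p.2).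
  move=> ip.
  have [d e] := separated_diff (f := f \o chart_inv i) (C1_diff hf ip) (dps p.2).
  by split => // w; refine (eq_trans (e w) _); rewrite dpsE.
split; first by move=> p [ip _]; have [] := D p ip.
move=> w [u t] [/= iu tT].
apply: (near_continuous_at (h := fun p : V * R => psi p.2 * 'd (f \o chart_inv i : V -> R^o) (p.1) (w.1) + f (chart_inv i p.1) * (w.2 * dpsi p.2))).
  have : nbhs (u, t) (chart_image i `*` setT) by apply: nbhs_prod; [exact: near_chart_image|exact: filterT].
  apply: filterS => -[u' t'] [/= iu' _]; have [d e] := D (u', t') iu'.
  by rewrite deriveE //; exact: esym (e w).
have cfst : {for (u, t), continuous (fst : V * R -> V)} by exact: cvg_fst.
have csnd : {for (u, t), continuous (snd : V * R -> R)} by exact: cvg_snd.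
have cpsi : continuous psi by move=> r; exact: differentiable_continuous.
apply: cvgD; apply: cvgM.
- exact: (@continuous_comp _ _ _ (snd : V * R -> R) psi _ csnd (cpsi t)).
- exact: (@continuous_comp _ _ _ (fst : V * R -> V) (fun u => 'd (f \o chart_inv i : V -> R^o) u (w.1)) _ cfst (C1_derive_continuous hf iu)).
- apply: (@continuous_comp _ _ _ (fst : V * R -> V) (f \o chart_inv i) _ cfst).
  by apply: (@differentiable_continuous _ _ _ _ (f \o chart_inv i : V -> R^o)); exact: C1_diff.
- apply: cvgM; first exact: cvg_cst.
  exact: (@continuous_comp _ _ _ (snd : V * R -> R) dpsi _ csnd (cdpsi t)).
Qed.

End C1_functions.

(** * Increments along the continuity equation *)

Lemma mdiffZ {R : realType} {n : nat} {M : ptopologicalType} (S : smooth_manifold R n M) (c : R) (f : M -> R) x (w : tangent S x) :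
  C1_on_manifold S f -> mdiff S (fun y => c * f y) x w = c * mdiff S f x w.
Proof.
move=> hf.
have d : differentiable (f \o chart_inv (chart_at S x) : 'rV[R]_n -> R^o) (chart_coord (chart_at S x) x).
  by apply: C1_diff => //; exists x => //; exact: mem_chart_at.
exact: (f_equal (fun h : 'rV[R]_n -> R^o => h w) (diffZ c d)).
Qed.

Section continuity_equation.
Context {R : realType} {n : nat} {M : ptopologicalType}.
Variables (S : smooth_manifold R n M) (g : riemannian_metric S).
Hypothesis cM : compact [set: M].
Local Notation RR := (measurableTypeR R).
Local Notation leb := (@lebesgue_measure R).
Variables (T : R) (mu : R -> proba R M).
Hypothesis T0 : 0 < T.
Hypothesis nmu : narrowly_continuous T mu.

Definition clamped_measurable := measurable_clamp_kernel cM (manifold_second_countable S) (manifold_hausdorff S) (ltW T0) nmu.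

(** The measure mu_t(dx) dt. *)
Definition space_time : {measure set (borelType M * RR) -> \bar R} := joint_measure clamped_measurable.
Local Notation Lam := space_time.
Local Notation D := ([set` `]0, T[%R] : set RR).

Lemma space_time_cylinder (E : set RR) : measurable E -> Lam (setT `*` E) = leb E.
Proof.
move=> mE.
have -> : Lam (setT `*` E) = (\int[Lam]_(z in setT `*` E) (cst 1 z))%E.
  by rewrite integral_cst ?mul1e //; exact: measurableX.
rewrite ge0_integral_joint //.
rewrite (eq_integral (cst 1%E)) => [|t _]; last first.
  by rewrite (_ : (fun x => _) = cst 1%E) // integral_cst // mul1e [LHS]probability_setT.
by rewrite integral_cst // mul1e.
Qed.

Lemma time_clamp t : D t -> mu (clamp T t) = mu t.
Proof. by rewrite /= in_itv /= => /andP[t0 tT]; rewrite clamp_id // !ltW. Qed.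

Lemma ge0_space_time_integral (f : M * R -> \bar R) : measurable_fun (setT `*` D : set (borelType M * RR)) f ->
  (forall z, (setT `*` D) z -> 0 <= f z)%E ->
  (\int[Lam]_(z in setT `*` D) f z = \int[leb]_(t in D) \int[mu t]_x f (x, t))%E.
Proof.
move=> mf f0; rewrite ge0_integral_joint //.
by apply: eq_integral => t; rewrite inE => Dt; rewrite time_clamp.
Qed.

Lemma space_time_integral (f : M * R -> \bar R) : Lam.-integrable (setT `*` D) f ->
  (\int[Lam]_(z in setT `*` D) f z = \int[leb]_(t in D) \int[mu t]_x f (x, t))%E.
Proof.
move=> intf; rewrite integral_joint //.
by apply: eq_integral => t; rewrite inE => Dt; rewrite time_clamp.
Qed.

Let mXD : measurable (setT `*` D : set (borelType M * RR)).
Proof. by apply: measurableX => //; exact: measurable_itv. Qed.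

Lemma space_time_bounded_integrable (f : M * R -> R) (C : R) :
  measurable_fun (setT `*` D : set (borelType M * RR)) f -> (forall z, (setT `*` D) z -> `|f z| <= C) ->
  Lam.-integrable (setT `*` D) (EFin \o f).
Proof.
move=> mf fC; apply: measurable_bounded_integrable => //.
  rewrite space_time_cylinder; last exact: measurable_itv.
  by rewrite lebesgue_measure_itv /=; case: ifP => _; rewrite ?ltry // -EFinB ltry.
exists C; split; [exact: num_real|move=> y Cy z Dz; exact: le_trans (fC z Dz) (ltW Cy)].
Qed.

Section velocity.
Variable v : R -> forall x : M, tangent S x.
Hypothesis hv : CE g T mu v.

Lemma velocity_Borel : Borel_field D v.
Proof. by have [] := hv. Qed.

Lemma velocity_integrable : Lam.-integrable (setT `*` D) (fun p => (tnorm g (v p.2 p.1))%:E).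
Proof.
have mt : measurable_fun (setT `*` D : set (borelType M * RR)) (fun p => (tnorm g (v p.2 p.1))%:E).
  by apply/measurable_EFinP; apply: measurable_tnorm => //; exact: velocity_Borel.
apply/integrableP; split => //.
under eq_integral do rewrite gee0_abs ?lee_fin ?tnorm_ge0 //.
rewrite ge0_space_time_integral //; last by move=> z _; rewrite lee_fin tnorm_ge0.
by have [] := hv.
Qed.

(** The bound by |v| is what makes all pairings with v integrable, as the
    continuity equation only provides an L^1 velocity. *)
Lemma velocity_dominated (h : M * R -> R) C : measurable_fun (setT `*` D : set (borelType M * RR)) h ->
  (forall z, (setT `*` D) z -> `|h z| <= C * tnorm g (v z.2 z.1)) ->
  Lam.-integrable (setT `*` D) (EFin \o h).
Proof.
move=> mh hC.
apply: (le_integrable mXD (g := fun z => (C%:E * (tnorm g (v z.2 z.1))%:E))%E).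
- exact/measurable_EFinP.
- move=> z Dz; rewrite -EFinM !abse_EFin lee_fin; exact: le_trans (hC z Dz) (ler_norm _).
- exact: integrableZl velocity_integrable.
Qed.

Section differential.
Variables (f : M -> R) (C : R).
Hypothesis hf : C1_on_manifold S f.
Hypothesis fC : forall x (w : tangent S x), `|mdiff S f x w| <= C * tnorm g w.
Local Notation Df := (fun p : M * R => mdiff S f p.1 (v p.2 p.1)).
Local Notation F := (fun t => \int[mu (clamp T t)]_x f x).

Lemma measurable_mdiff : measurable_fun (setT `*` D : set (borelType M * RR)) Df.
Proof.
have mD : measurable D by exact: measurable_itv.
exact: (@measurable_pairing _ _ _ S cM D mD (fun _ x => mdiff S f x) v (Borel_covector_C1 mD hf) velocity_Borel).
Qed.

Let C_ge0 x (w : tangent S x) : 0 <= C * tnorm g w.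
Proof. exact: le_trans (fC w). Qed.

Lemma separated_weak_equation (psi dpsi : R -> R) a b :
  (forall r, is_derive r (1 : R) psi (dpsi r)) -> continuous dpsi -> 0 < a -> b < T ->
  (forall r, (r < a) || (b < r) -> psi r = 0) -> (forall r, `|psi r| <= 1) ->
  \int[leb]_(t in D) (dpsi t * F t) + \int[Lam]_(p in setT `*` D) (psi p.2 * Df p) = 0.
Proof.
move=> dP cd a0 bT psi0 psi1.
have tst := C1c_separated cM hf dP cd a0 bT psi0.
have [_ _ _ /(_ _ tst)] := hv.
have cpsi : continuous psi.
  by move=> r; apply: differentiable_continuous; apply/derivable1_diffP; have [] := dP r.
have ctf : continuous f := C1_continuous hf.
have [Cf [Cf0 fb]] := continuous_compact_bounded cM ctf.
have mpsi : measurable_fun (setT `*` D : set (borelType M * RR)) (fun p => psi p.2).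
  apply: measurable_funTS; apply: (measurableT_comp (f := psi : RR -> RR)); last exact: measurable_snd.
  exact: continuous_measurable_fun.
have mdpsi : measurable_fun (setT `*` D : set (borelType M * RR)) (fun p => dpsi p.2).
  apply: measurable_funTS; apply: (measurableT_comp (f := dpsi : RR -> RR)); last exact: measurable_snd.
  exact: continuous_measurable_fun.
have mf : measurable_fun (setT `*` D : set (borelType M * RR)) (fun p => f p.1).
  apply: measurable_funTS; apply: (measurableT_comp (f := f : borelType M -> RR)); last exact: measurable_fst.
  exact: continuous_borel.
have i2 : Lam.-integrable (setT `*` D) (EFin \o (fun p => psi p.2 * Df p)).
  apply: (velocity_dominated (C := C)); first by apply: measurable_funM => //; exact: measurable_mdiff.
  by move=> z _; rewrite normrM -[leRHS]mul1r ler_pM.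
have [Cd Cd0 hCd] : exists2 Cd : R, 0 <= Cd & forall t, D t -> `|dpsi t| <= Cd.
  have : compact (dpsi @` `[0, T]).
    by apply: continuous_compact; [exact: continuous_subspaceT|exact: segment_compact].
  move=> /compact_bounded [N [_ hN]]; exists (`|N| + 1); first by rewrite addr_ge0.
  move=> t; rewrite /= in_itv /= => /andP[t0 tT].
  apply: (hN (`|N| + 1)); first by rewrite (le_lt_trans (ler_norm _)) // ltrDl.
  by exists t => //=; rewrite in_itv /= !ltW.
have i1 : Lam.-integrable (setT `*` D) (EFin \o (fun p => dpsi p.2 * f p.1)).
  apply: (space_time_bounded_integrable (C := Cd * Cf)); first exact: measurable_funM.
  by move=> [x t] [_ /= Dt]; rewrite normrM ler_pM // hCd.
move=> E; pose h1 (p : M * R) := dpsi p.2 * f p.1; pose h2 (p : M * R) := psi p.2 * Df p.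
have E2 : (\int[Lam]_(p in setT `*` D) ((EFin \o h1) p + (EFin \o h2) p) = 0)%E.
  rewrite space_time_integral; last exact: integrableD.
  rewrite -E; apply: eq_integral => t _; apply: eq_integral => x _ /=.
  rewrite -EFinD; congr (_ + _)%:E.
    rewrite derive1E; have D1 := dP t.
    have := @is_deriveM R R psi (cst (f x)) t 1 _ _ D1 (is_derive_cst _ _ _).
    move=> [_ e]; refine (esym (eq_trans e _)).
    by rewrite scaler0 add0r /h1 mulrC.
  exact: esym (mdiffZ _ _ _).
rewrite integralD // in E2.
have E3 : (\int[leb]_(t in D) (dpsi t * F t)%:E = \int[Lam]_(p in setT `*` D) (EFin \o h1) p)%E.
  rewrite space_time_integral //; apply: eq_integral => t; rewrite inE => Dt.
  have If := continuous_probability_integrable cM (mu t) ctf.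
  by rewrite time_clamp // /Rintegral EFinM fineK ?integrable_fin_num // -integralZl.
rewrite /Rintegral E3 -fineD ?integrable_fin_num //.
by rewrite [X in fine X]E2.
Qed.

(** The test functions psi_k(t) f(x) rise on [s + e, s + 2 e] and fall on [t - 2
    e, t - e], with e tending to 0. The time derivative concentrates at s and t,
    where the integral of f is continuous in time; the term with Df(v) converges
    by dominated convergence. *)
Lemma increment_formula s t : 0 <= s -> s < t -> t <= T ->
  F t - F s = \int[Lam]_(p in setT `*` [set` `]s, t[%R]) Df p.
Proof.
move=> s0 st tT.
(* The bound e k <= (t - s) / 4 keeps the rise before the fall. *)
pose e k : R := (t - s) / 4 * harmonic k.
have e0 k : 0 < e k by rewrite /e mulr_gt0 ?divr_gt0 ?subr_gt0 ?ltr0n //= invr_gt0.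
have e4 k : e k <= (t - s) / 4.
  by rewrite /e ler_piMr ?divr_ge0 ?subr_ge0 ?ler0n //= ?invf_le1 ?ler1n ?ltr0n // ltW.
have elim d : 0 < d -> \forall k \near \oo, 2 * e k < d.
  move=> d0; have d2 : 0 < d / 2 by rewrite divr_gt0.
  have : e k @[k --> \oo] --> 0.
    by rewrite -[X in _ --> X](mulr0 ((t - s) / 4)); apply: cvgM; [exact: cvg_cst|exact: cvg_harmonic].
  move=> /cvgrPdist_lt /(_ _ d2); apply: filterS => k.
  by rewrite sub0r normrN gtr0_norm // ltr_pdivlMr // mulrC.
pose psi k r := rstep (s + e k) (e k) r - rstep (t - 2 * e k) (e k) r.
pose dpsi k r := drstep (s + e k) (e k) r - drstep (t - 2 * e k) (e k) r.
have psi_d k r : is_derive r (1 : R) (psi k) (dpsi k r).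
  by apply: is_deriveB; exact: rstep_derive.
have dpsi_c k : continuous (dpsi k).
  by move=> r; apply: cvgB; exact: drstep_continuous.
have psi0 k r : (r < s + e k) || (t - e k < r) -> psi k r = 0.
  have := e0 k; have := e4 k; move=> ? ? /orP[h|h]; rewrite /psi.
    by rewrite !rstep_before ?subr0 //; lra.
  by rewrite !rstep_after ?subrr //; lra.
have psi1 k r : `|psi k r| <= 1.
  have /andP[? ?] := rstep_itv (s + e k) (e k) r.
  have /andP[? ?] := rstep_itv (t - 2 * e k) (e k) r.
  by rewrite /psi ler_norml; lra.
have cF : continuous F.
  have ctf : continuous f := C1_continuous hf.
  exact: (narrow_clamp cM (ltW T0) nmu ctf).
have mean_s : \int[leb]_(r in D) (drstep (s + e k) (e k) r * F r) @[k --> \oo] --> F s.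
  apply/cvgrPdist_le => eta eta0; have [d [d0 hd]] := step_average T0 s cF eta0.
  apply: filterS (elim _ d0) => k ek; rewrite distrC; have := e0 k; have := e4 k => ? ?.
  by apply: hd => //; rewrite ?ltr_norml; lra.
have mean_t : \int[leb]_(r in D) (drstep (t - 2 * e k) (e k) r * F r) @[k --> \oo] --> F t.
  apply/cvgrPdist_le => eta eta0; have [d [d0 hd]] := step_average T0 t cF eta0.
  apply: filterS (elim _ d0) => k ek; rewrite distrC; have := e0 k; have := e4 k => ? ?.
  by apply: hd => //; rewrite ?ltr_norml; lra.
have weak k : \int[Lam]_(p in setT `*` D) (psi k p.2 * Df p) =
  \int[leb]_(r in D) (drstep (t - 2 * e k) (e k) r * F r) - \int[leb]_(r in D) (drstep (s + e k) (e k) r * F r).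
  have := e0 k; have := e4 k => ? ?.
  have a0 : 0 < s + e k by lra.
  have bT : t - e k < T by lra.
  have := separated_weak_equation (psi_d k) (dpsi_c k) a0 bT (psi0 k) (psi1 k).
  have i a : leb.-integrable D (EFin \o (fun r => drstep a (e k) r * F r)).
    by apply: itv_continuous_integrable => r; apply: cvgM; [exact: drstep_continuous|exact: cF].
  under eq_Rintegral do rewrite mulrBl.
  rewrite RintegralB // => /eqP; rewrite addrC addr_eq0 opprB => /eqP <-.
  by [].
have mDf := measurable_mdiff.
have mpsi k : measurable_fun (setT `*` D : set (borelType M * RR)) (fun p => psi k p.2).
  apply: measurable_funTS; apply: (measurableT_comp (f := psi k : RR -> RR)); last exact: measurable_snd.
  apply: continuous_measurable_fun => r; apply: differentiable_continuous.
  by apply/derivable1_diffP; have [] := psi_d k r.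
pose A : set (borelType M * RR) := setT `*` [set` `]s, t[%R].
have AD : A `<=` setT `*` D.
  by move=> [x r] [_ /=]; rewrite !in_itv /= => /andP[sr rt]; split => //; rewrite (le_lt_trans s0 sr) (lt_le_trans rt tT).
have inA p : (p \in A) = (s < p.2 < t).
  by apply/idP/idP; [rewrite inE => -[_]; rewrite /= in_itv|rewrite inE => h; split => //=; rewrite in_itv].
have lim : (\int[Lam]_(p in setT `*` D) (psi k p.2 * Df p)%:E)%E @[k --> \oo] -->
    (\int[Lam]_(p in setT `*` D) (((fun p => (Df p)%:E) \_ A) p))%E.
  apply: (dominated_cvg mXD (g := fun p => (C%:E * (tnorm g (v p.2 p.1))%:E)%E)).
  - by move=> k; apply/measurable_EFinP; apply: measurable_funM.
  - move=> p Dp; rewrite patchE inA; case: ifPn => [/andP[sp pt]|sp].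
      apply: cvg_near_cst; have d1 : 0 < p.2 - s by rewrite subr_gt0.
      have d2 : 0 < t - p.2 by rewrite subr_gt0.
      apply: filterS2 (elim _ d1) (elim _ d2) => k k1 k2.
      rewrite /psi rstep_after // ?rstep_before // ?subr0 ?mul1r //; lra.
    apply: cvg_near_cst; apply: nearW => k; rewrite psi0 ?mul0r //.
    have := e0 k => ?; move: sp; rewrite negb_and -!leNgt => /orP[h|h]; apply/orP; [left|right]; lra.
  - by [].
  - exact: integrableZl velocity_integrable.
  - move=> k p _; rewrite -EFinM abse_EFin lee_fin normrM -[leRHS]mul1r.
    by apply: ler_pM.
have lim2 : \int[Lam]_(p in setT `*` D) (psi k p.2 * Df p) @[k --> \oo] --> \int[Lam]_(p in A) Df p.
  have mA : measurable A by apply: measurableX => //; exact: measurable_itv.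
  have iA : Lam.-integrable A (EFin \o (fun p : M * R => Df p)).
    by apply: (integrableS mXD mA AD); apply: velocity_dominated => // z _; exact: fC.
  move: lim; rewrite -integral_mkcondr setIidr // => lim.
  by apply: (fine_cvg (a := \int[Lam]_(p in A) Df p)); rewrite /Rintegral fineK // integrable_fin_num.
have lim3 : \int[Lam]_(p in setT `*` D) (psi k p.2 * Df p) @[k --> \oo] --> F t - F s.
  by under eq_fun do rewrite weak; exact: cvgB mean_t mean_s.
exact: (cvg_unique _ lim3 lim2).
Qed.

End differential.
End velocity.
End continuity_equation.

(** * The chain rule for the energy *)

Section continuous_fubini.
Context {R : realType} {M : ptopologicalType}.
Hypothesis cM : compact [set: M].
Hypothesis M2 : @second_countable M.
Variables (P Q : proba R M) (F : M -> M -> R).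
Hypothesis cF : forall p, {for p, continuous (fun p : M * M => F p.1 p.2)}.

Lemma product_integrable : (P \x Q)%E.-integrable setT (EFin \o (fun p : M * M => F p.1 p.2)).
Proof.
have oT : open (setT : set (M * M)) by exact: openT.
apply: measurable_bounded_integrable => //.
- have E : (P \x Q)%E setT = (P setT * Q setT)%E.
    refine (eq_trans _ (product_measure1E P Q measurableT measurableT)).
    by congr (_ _); exact: esym (@setXTT _ _).
  refine (eq_ind_r (fun z => (z < +oo)%E) _ E).
  by rewrite [X in (X * _)%E](@probability_setT _ _ _ P) (@probability_setT _ _ _ Q) mul1e ltry.
- exact (@open_continuous_prod R M M2 M setT (fun p => F p.1 p.2) M2 oT (fun p _ => @cF p)).
have cMM : compact [set: M * M] by rewrite -setXTT; exact: compact_setX.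
have [N [_ hN]] := continuous_compact_bounded cMM cF.
by exists N; split => [|y Ny p _]; [exact: num_real|exact: le_trans (hN p) (ltW Ny)].
Qed.

Let slicel x : continuous (F x).
Proof.
move=> y; apply: (@continuous_comp _ _ _ (fun y : M => (x, y)) (fun p : M * M => F p.1 p.2)).
  exact: pair_continuousl.
exact: cF.
Qed.

Let slicer y : continuous (F^~ y).
Proof.
move=> x; apply: (@continuous_comp _ _ _ (fun x : M => (x, y)) (fun p : M * M => F p.1 p.2)); last exact: cF.
by apply: cvg_pair; [exact: cvg_id|exact: cvg_cst].
Qed.

Let fiberl x : (\int[Q]_y (F x y)%:E = (\int[Q]_y F x y)%:E)%E.
Proof. by rewrite /Rintegral fineK // integrable_fin_num //; exact: continuous_probability_integrable. Qed.

Let fiberr y : (\int[P]_x (F x y)%:E = (\int[P]_x F x y)%:E)%E.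
Proof. by rewrite /Rintegral fineK // integrable_fin_num //; exact: continuous_probability_integrable. Qed.

Lemma product_integral : \int[(P \x Q)%E]_p F p.1 p.2 = \int[P]_x \int[Q]_y F x y.
Proof.
rewrite /Rintegral; congr fine.
refine (eq_trans (esym (integral12_prod_meas1 product_integrable)) _).
by apply: eq_integral => x _; rewrite /fubini_F; exact: fiberl.
Qed.

Lemma integral_swap : \int[P]_x \int[Q]_y F x y = \int[Q]_y \int[P]_x F x y.
Proof.
rewrite /Rintegral; congr fine.
have -> : (\int[P]_x (fine (\int[Q]_y (F x y)%:E))%:E = \int[P]_x \int[Q]_y (F x y)%:E)%E.
  by apply: eq_integral => x _; rewrite fiberl.
refine (eq_trans (Fubini product_integrable) _).
by apply: eq_integral => y _; exact: fiberr.
Qed.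

End continuous_fubini.

Lemma average_dist {R : realType} (a b c z : R) : `|a - c| <= z -> `|b - c| <= z -> `|2^-1 * (a + b) - c| <= z.
Proof. by rewrite !ler_norml => /andP[? ?] /andP[? ?]; lra. Qed.

Lemma step_dist {R : realType} (x y z h1 h2 q1 q2 e : R) : `|y - x - h2| <= e * q2 -> `|x - z - h1| <= e * q1 ->
  `|y - z - (h1 + h2)| <= e * (q1 + q2).
Proof. by rewrite !ler_norml => /andP[? ?] /andP[? ?]; lra. Qed.

Lemma Rintegral_dist_dominated d {R : realType} (X : measurableType d) (m : {measure set X -> \bar R}) (D : set X)
    (f1 f2 q : X -> R) (e : R) : measurable D -> m.-integrable D (EFin \o f1) -> m.-integrable D (EFin \o f2) ->
  m.-integrable D (EFin \o q) -> (forall x, D x -> `|f1 x - f2 x| <= e * q x) ->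
  `|\int[m]_(x in D) f1 x - \int[m]_(x in D) f2 x| <= e * \int[m]_(x in D) q x.
Proof.
move=> mD i1 i2 iq h; rewrite -RintegralB //.
have iB : m.-integrable D (EFin \o (fun x => f1 x - f2 x)) by exact: (integrableB mD i1 i2).
apply: le_trans (le_normr_Rintegral mD iB) _; rewrite -RintegralZl //.
by apply: le_Rintegral => //; [exact: (integrable_norm iB)|exact: (integrableZl mD e iq)].
Qed.

Section chain_rule.
Context {R : realType} {n : nat} {M : ptopologicalType}.
Variables (S : smooth_manifold R n M) (g : riemannian_metric S).
Hypothesis cM : compact [set: M].
Local Notation RR := (measurableTypeR R).
Variables (T : R) (mu : R -> proba R M).
Hypothesis T0 : 0 < T.
Hypothesis nmu : narrowly_continuous T mu.
Variable W : M -> M -> R.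
Hypothesis hW : C1_on_product S W.
Hypothesis Wsym : forall x y, W x y = W y x.
Variable v : R -> forall x : M, tangent S x.
Hypothesis hv : CE g T mu v.
Local Notation Lam := (space_time S cM T0 nmu).
Local Notation D := ([set` `]0, T[%R] : set RR).
Local Notation cyl s t := (setT `*` ([set` `]s, t[%R] : set RR) : set (borelType M * RR)).
Local Notation Dpot t x := (mdiff S (potential W (mu (clamp T t))) x).
Local Notation M2 := (manifold_second_countable S).

Let cW p : {for p, continuous (fun p : M * M => W p.1 p.2)}.
Proof. by case: p => x y; exact: W_continuous. Qed.

Lemma energy_cross (P : proba R M) : energy W P = 2^-1 * \int[P]_x potential W P x.
Proof. by rewrite /energy (product_integral cM M2 P P cW). Qed.

(** The symmetry of W makes the mutual energy of two measures symmetric, by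
    Fubini. *)
Lemma cross_sym (P Q : proba R M) : \int[P]_x potential W Q x = \int[Q]_x potential W P x.
Proof.
refine (eq_trans (integral_swap cM M2 P Q cW) _).
by apply: eq_Rintegral => y _; apply: eq_Rintegral => x _; exact: Wsym.
Qed.

Lemma Borel_covector_potential : Borel_covector D (fun t x => Dpot t x).
Proof.
move=> i j.
apply: (eq_measurable_fun (fun p : borelType M * RR => dpot W i (mu (clamp T p.2)) j p.1)).
  by move=> p; rewrite inE => -[ip _]; rewrite cov_row_potential.
have o : open (chart_dom i `*` (setT : set R)).
  by rewrite openE => -[x t] [/= ix _]; apply: nbhs_prod; [exact: chart_dom_nbhs|exact: filterT].
have := open_continuous_prodR M2 o (fun p ip => dpot_continuous (t0 := p.2) (j := j) cM hW (ltW T0) nmu ip.1).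
apply: measurable_funS.
  apply: measurableX; first exact: chart_dom_measurable. exact: measurableT.
by move=> p [].
Qed.

Lemma cyl_measurable s t : measurable (cyl s t).
Proof. by apply: measurableX => //; exact: measurable_itv. Qed.

Lemma cyl_sub s t : 0 <= s -> t <= T -> cyl s t `<=` cyl 0 T.
Proof.
move=> s0 tT [x r] [_ /=]; rewrite !in_itv /= => /andP[sr rt]; split => //=.
by rewrite (le_lt_trans s0 sr) (lt_le_trans rt tT).
Qed.

(** A single instant is negligible, so open intervals may be concatenated. *)
Lemma cyl_integral_add (h : M * R -> R) a b c : Lam.-integrable (cyl 0 T) (EFin \o h) ->
  0 <= a -> a <= b -> b < c -> c <= T ->
  \int[Lam]_(p in cyl a c) h p = \int[Lam]_(p in cyl a b) h p + \int[Lam]_(p in cyl b c) h p.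
Proof.
move=> ih a0; rewrite le_eqVlt => /orP[/eqP <-|ab] bc cT.
  by rewrite [X in _ = X + _](_ : _ = 0) ?add0r // set_itv_ge ?setX0 ?Rintegral_set0 // bnd_simp ltxx.
have bt : cyl b c `<=` cyl a c.
  by move=> [x r] [_ /=]; rewrite !in_itv /= => /andP[br ->]; split => //=; rewrite (lt_trans ab br).
have ta : cyl a b `<=` cyl a c.
  by move=> [x r] [_ /=]; rewrite !in_itv /= => /andP[-> rb]; split => //=; rewrite (lt_trans rb bc).
have iac : Lam.-integrable (cyl a c) (EFin \o h).
  by apply: integrableS ih; [exact: cyl_measurable|exact: cyl_measurable|exact: cyl_sub].
pose N : set (borelType M * RR) := setT `*` ([set b] : set RR).
have mb : measurable ([set b] : set RR) by exact: measurable_set1.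
have mN : measurable N by exact: measurableX.
have N0 : Lam N = 0%E by rewrite space_time_cylinder // lebesgue_measure_set1.
have -> : \int[Lam]_(p in cyl a c) h p = \int[Lam]_(p in cyl a b `|` cyl b c) h p.
  rewrite /Rintegral (negligible_integral mN (cyl_measurable a c) iac N0).
  congr (fine (integral _ _ _)); apply/seteqP; split.
    move=> [x r] [[_ /=]]; rewrite !in_itv /= => /andP[ar rc] rb.
    have : r <> b by move=> rb'; apply: rb; split.
    move=> /eqP; rewrite neq_lt => /orP[rb'|rb']; [left|right]; split => //=.
      by rewrite ar rb'.
    by rewrite rb' rc.
  move=> [x r] [abr|bcr]; split; [exact: ta| |exact: bt| ].
    by move: abr => [_ /=]; rewrite in_itv /= => /andP[_ rb] [_ /= rb']; rewrite rb' ltxx in rb.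
  by move: bcr => [_ /=]; rewrite in_itv /= => /andP[rb _] [_ /= rb']; rewrite rb' ltxx in rb.
apply: Rintegral_setU; try exact: cyl_measurable.
  apply: integrableS iac; [exact: cyl_measurable| |by move=> p [/ta|/bt]].
  by apply: measurableU; exact: cyl_measurable.
apply/disj_setPS => -[x r] [[_ /=] + [_ /=]]; rewrite !in_itv /= => /andP[_ rb] /andP[br _].
by have := lt_trans rb br; rewrite ltxx.
Qed.

(** On ]s, t[ the symmetry of W gives the increment of the energy as the
    integral of the mean of D W[mu_s] and D W[mu_t] applied to v. The error with
    D W[mu_r] at the current time r is at most e times the integral of |v|,
    uniformly for short intervals, and these errors add up over a subdivision of
    [0, T]. *)
Lemma chain_rule : energy W (mu T) - energy W (mu 0) = \int[Lam]_(p in cyl 0 T) Dpot p.2 p.1 (v p.2 p.1).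
Proof.
have [C [C0 hC]] := potential_bound cM g hW (ltW T0) nmu.
pose h (p : M * R) := Dpot p.2 p.1 (v p.2 p.1).
pose q (p : M * R) := tnorm g (v p.2 p.1).
have mD : measurable D by exact: measurable_itv.
have mh : measurable_fun (cyl 0 T) h.
  exact: (@measurable_pairing _ _ _ S cM D mD (fun t x => Dpot t x) v Borel_covector_potential (velocity_Borel hv)).
have ih : Lam.-integrable (cyl 0 T) (EFin \o h).
  by apply: (velocity_dominated cM T0 nmu hv mh (C := C)) => z _; exact: hC.
have iq : Lam.-integrable (cyl 0 T) (EFin \o q) := velocity_integrable cM T0 nmu hv.
pose E t := energy W (mu (clamp T t)).
have step e d : (forall t s, 0 <= t <= T -> `|t - s| < d -> forall x (v : tangent S x),
    `|Dpot t x v - Dpot s x v| <= e * tnorm g v) -> forall s t, 0 <= s -> s < t -> t <= T -> t - s < d ->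
    `|E t - E s - \int[Lam]_(p in cyl s t) h p| <= e * \int[Lam]_(p in cyl s t) q p.
  move=> he s t s0 st tT tsd.
  pose ht (p : M * R) := Dpot t p.1 (v p.2 p.1).
  pose hs (p : M * R) := Dpot s p.1 (v p.2 p.1).
  have sub (u : M * R -> R) : Lam.-integrable (cyl 0 T) (EFin \o u) -> Lam.-integrable (cyl s t) (EFin \o u).
    by move=> iu; apply: integrableS iu; [exact: cyl_measurable|exact: cyl_measurable|exact: cyl_sub].
  have cst_int r : Lam.-integrable (cyl s t) (EFin \o (fun p : M * R => Dpot r p.1 (v p.2 p.1))).
    apply: sub; apply: (velocity_dominated cM T0 nmu hv (C := C)); last by move=> z _; exact: hC.
    exact: (measurable_mdiff cM hv (potential_C1 cM _ hW)).
  have inc r : \int[mu (clamp T t)]_x potential W (mu (clamp T r)) x - \int[mu (clamp T s)]_x potential W (mu (clamp T r)) x =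
      \int[Lam]_(p in cyl s t) Dpot r p.1 (v p.2 p.1).
    exact: (increment_formula cM T0 nmu hv (potential_C1 cM _ hW) (fun x w => hC r x w) s0 st tT).
  have -> : E t - E s = 2^-1 * (\int[Lam]_(p in cyl s t) ht p + \int[Lam]_(p in cyl s t) hs p).
    refine (eq_trans _ (f_equal (fun z => 2^-1 * z) (f_equal2 +%R (inc t) (inc s)))).
    refine (eq_trans (f_equal2 (fun a b : R => a - b) (energy_cross _) (energy_cross _)) _).
    (* c and b stand for the mutual energy of the measures at times s and t, in
       its two forms. *)
    have alg (a b c d' : R) : c = b -> 2^-1 * a - 2^-1 * d' = 2^-1 * ((a - b) + (c - d')) by move=> ->; ring.
    exact (alg _ _ _ _ (cross_sym _ _)).
  have diff_le r : (forall r', s < r' < t -> `|r - r'| < d) -> 0 <= r <= T ->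
      `|\int[Lam]_(p in cyl s t) Dpot r p.1 (v p.2 p.1) - \int[Lam]_(p in cyl s t) h p| <= e * \int[Lam]_(p in cyl s t) q p.
    move=> rd r0T; refine (Rintegral_dist_dominated (cyl_measurable s t) (cst_int r) (sub _ ih) (sub _ iq) _).
    by move=> [x r'] [_ /=]; rewrite in_itv /= => hr'; apply: he => //; exact: rd.
  have near_t : `|\int[Lam]_(p in cyl s t) ht p - \int[Lam]_(p in cyl s t) h p| <= e * \int[Lam]_(p in cyl s t) q p.
    apply: diff_le; last by lra.
    by move=> r' /andP[? ?]; rewrite ltr_norml; lra.
  have near_s : `|\int[Lam]_(p in cyl s t) hs p - \int[Lam]_(p in cyl s t) h p| <= e * \int[Lam]_(p in cyl s t) q p.
    apply: diff_le; last by lra.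
    by move=> r' /andP[? ?]; rewrite ltr_norml; lra.
  exact (average_dist near_t near_s).
have close e : 0 < e -> `|E T - E 0 - \int[Lam]_(p in cyl 0 T) h p| <= e * \int[Lam]_(p in cyl 0 T) q p.
  move=> e0; have [d [d0 hd]] := potential_modulus cM g hW (ltW T0) nmu e0.
  (* A subdivision of [0, T] into m intervals shorter than d. *)
  pose m := (Num.truncn (T / d)).+1.
  have m0 : 0 < m%:R :> R by rewrite ltr0n.
  have Tmd : T / m%:R < d.
    by rewrite ltr_pdivrMr // mulrC -ltr_pdivrMr // /m truncnS_gt.
  pose tk (k : nat) := k%:R * (T / m%:R).
  have tkS k : tk k.+1 = tk k + T / m%:R by rewrite /tk -natr1 mulrDl mul1r.
  have Tm0 : 0 < T / m%:R by rewrite divr_gt0.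
  have tk0 k : 0 <= tk k by rewrite mulr_ge0 // ltW.
  have tkT k : (k <= m)%N -> tk k <= T.
    by move=> km; rewrite /tk mulrCA ler_piMr ?(ltW T0) // ler_pdivrMr // mul1r ler_nat.
  have induct k : (k <= m)%N -> `|E (tk k) - E 0 - \int[Lam]_(p in cyl 0 (tk k)) h p| <= e * \int[Lam]_(p in cyl 0 (tk k)) q p.
    elim: k => [_|k IH km].
      rewrite {1 2 3}/tk mul0r set_itv_ge ?bnd_simp ?ltxx // setX0 !Rintegral_set0 subrr subr0 normr0.
      by rewrite mulr0.
    have lt : tk k < tk k.+1 by rewrite tkS ltrDl.
    have IH' := IH (ltnW km).
    have := step e d hd (tk k) (tk k.+1) (tk0 k) lt (tkT _ km).
    rewrite {1}tkS addrAC subrr add0r => /(_ Tmd) ST.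
    rewrite (cyl_integral_add ih (lexx 0) (tk0 k) lt (tkT _ km)) (cyl_integral_add iq (lexx 0) (tk0 k) lt (tkT _ km)).
    exact (step_dist ST IH').
  have := induct m (leqnn m); rewrite (_ : tk m = T) //.
  by rewrite /tk mulrCA divff ?mulr1 // gt_eqF.
have ET : E T = energy W (mu T) by rewrite /E clamp_id // lexx ltW.
have E0 : E 0 = energy W (mu 0) by rewrite /E clamp_id // lexx ltW.
(* The error e times the integral Q of |v| is arbitrarily small; Q + 1 avoids a
   zero denominator. *)
rewrite -ET -E0; apply/eqP; rewrite -subr_eq0 -normr_le0; apply/ler_addgt0Pr => e e0.
rewrite add0r; set Q := \int[Lam]_(p in cyl 0 T) q p in close.
have Q0 : 0 <= Q by apply: Rintegral_ge0 => p _; exact: tnorm_ge0.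
have eQ : 0 < e / (Q + 1) by rewrite divr_gt0 // ltr_wpDl.
apply: le_trans (close _ eQ) _.
by rewrite mulrAC ler_pdivrMr ?ltr_wpDl // ler_pM2l // lerDl.
Qed.

End chain_rule.

(** * Changing the velocity on a null set *)

Section test_functions.
Context {R : realType} {n : nat} {M : ptopologicalType}.
Variables (S : smooth_manifold R n M).
Hypothesis cM : compact [set: M].
Local Notation V := 'rV[R]_n.
Local Notation RR := (measurableTypeR R).
Variable T : R.
Local Notation D := ([set` `]0, T[%R] : set RR).
Variable phi : M -> R -> R.
Hypothesis hphi : C1c S T phi.

Definition chart_test (i : chart S) (p : V * R) : R^o := phi (chart_inv i p.1) p.2.

Lemma chart_test_diff (i : chart S) x t : chart_dom i x -> D t -> differentiable (chart_test i) (chart_coord i x, t).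
Proof. by move=> ix Dt; have [/(_ i) [+ _] _] := hphi; apply; split => //; exists x. Qed.

Lemma measurable_chart_test (i : chart S) (w : V * R) :
  measurable_fun (chart_dom i `*` D : set (borelType M * RR)) (fun p => 'D_w (chart_test i) (chart_coord i p.1, p.2)).
Proof.
have o : open (chart_dom i `*` ([set` `]0, T[%R] : set R)).
  rewrite openE => -[x t] [/= ix Dt]; apply: nbhs_prod; first exact: chart_dom_nbhs.
  by apply: open_nbhs_nbhs; split => //; exact: interval_open.
apply: (open_continuous_prodR (manifold_second_countable S) o) => -[x t] [/= ix Dt].
apply: (@continuous_comp _ _ _ (fun p : M * R => (chart_coord i p.1, p.2)) (fun q : V * R => 'D_w (chart_test i) q)).
  by apply: (@pair_map_continuous _ _ _ _ _ id); [exact: Defs.coord_continuous|exact: cvg_id].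
by have [/(_ i) [_ H] _] := hphi; apply: (H w (chart_coord i x, t)); split => //; exists x.
Qed.

(** Both sides are limits of the same difference quotients. *)
Lemma test_time_derivative (i : chart S) x t : chart_dom i x -> derive1 (phi x) t = 'D_(0, 1) (chart_test i) (chart_coord i x, t).
Proof.
move=> ix; rewrite derive1E /derive.
rewrite (_ : (fun h => _) = (fun h => h^-1 *: ((chart_test i \o shift (chart_coord i x, t)) (h *: (0, 1)) - chart_test i (chart_coord i x, t)))) //.
by apply/funext => h; rewrite /chart_test /= scaler0 add0r !coordK.
Qed.

Lemma test_differential (i : chart S) x t j : chart_dom i x -> D t ->
  cov_row i (mdiff S (phi^~ t) x) 0 j = 'D_(chart_vec j, 0) (chart_test i) (chart_coord i x, t).
Proof.
move=> ix Dt; have d := chart_test_diff ix Dt.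
have [d1 e1] := partial_diff d.
rewrite deriveE // mxE.
have H := @mdiff_chart R n M S (phi^~ t) i x (of_chart i x (chart_vec j)) ix d1.
refine (eq_trans H _); rewrite of_chartK //; exact: e1.
Qed.

Lemma measurable_test_time : measurable_fun (setT `*` D : set (borelType M * RR)) (fun p => derive1 (phi p.1) p.2).
Proof.
apply: (measurable_chartwise (S := S) cM) => [|i]; first exact: measurable_itv.
apply: (eq_measurable_fun (fun p : borelType M * RR => 'D_(0, 1) (chart_test i) (chart_coord i p.1, p.2))); last exact: measurable_chart_test.
by move=> p; rewrite inE => -[ip _]; rewrite (test_time_derivative _ ip).
Qed.

Lemma Borel_covector_test : Borel_covector D (fun t x => mdiff S (phi^~ t) x).
Proof.
move=> i j; apply: (eq_measurable_fun (fun p : borelType M * RR => 'D_(chart_vec j, 0) (chart_test i) (chart_coord i p.1, p.2))); last exact: measurable_chart_test.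
by move=> p; rewrite inE => -[ip Dp]; rewrite (test_differential _ ip Dp).
Qed.

Lemma measurable_test (v : R -> forall x : M, tangent S x) : Borel_field D v ->
  measurable_fun (setT `*` D : set (borelType M * RR)) (fun p => derive1 (phi p.1) p.2 + mdiff S (phi^~ p.2) p.1 (v p.2 p.1)).
Proof.
move=> mv; have mD : measurable D by exact: measurable_itv.
apply: measurable_funD; first exact: measurable_test_time.
exact: (@measurable_pairing _ _ _ S cM D mD (fun t x => mdiff S (phi^~ t) x) v Borel_covector_test mv).
Qed.

End test_functions.

Section ae_velocity.
Context {R : realType} {n : nat} {M : ptopologicalType}.
Variables (S : smooth_manifold R n M) (g : riemannian_metric S).
Hypothesis cM : compact [set: M].
Local Notation RR := (measurableTypeR R).
Local Notation leb := (@lebesgue_measure R).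
Variables (T : R) (mu : R -> proba R M).
Hypothesis T0 : 0 < T.
Hypothesis nmu : narrowly_continuous T mu.
Local Notation Lam := (space_time S cM T0 nmu).
Local Notation D := ([set` `]0, T[%R] : set RR).
Let mD : measurable D. Proof. exact: measurable_itv. Qed.

Lemma measurable_time_integral (f : M * R -> \bar R) : measurable_fun (setT `*` D : set (borelType M * RR)) f ->
  measurable_fun D (fun t => \int[mu t]_x f (x, t))%E.
Proof.
move=> mf; have := measurable_fiber_integral (clamped_measurable S cM T0 nmu) mD mf.
by apply: eq_measurable_fun => t; rewrite inE => Dt; rewrite time_clamp.
Qed.

(** Fubini for null sets: a function that vanishes almost everywhere in
    space-time vanishes on almost every fiber. *)
Lemma ae_fibers (f : M * R -> R) : measurable_fun (setT `*` D : set (borelType M * RR)) f ->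
  (forall p, (setT `*` D) p -> 0 <= f p) -> (\int[Lam]_(p in setT `*` D) (f p)%:E = 0)%E ->
  {ae leb, forall t, D t -> {ae mu t, forall x, f (x, t) = 0}}.
Proof.
move=> mf f0 F0.
have mf' : measurable_fun (setT `*` D : set (borelType M * RR)) (EFin \o f) by exact/measurable_EFinP.
have F0' : (\int[leb]_(t in D) \int[mu t]_x (f (x, t))%:E = 0)%E.
  by rewrite -F0 ge0_space_time_integral // => z Dz; rewrite lee_fin f0.
have ge t : D t -> (0 <= \int[mu t]_x (f (x, t))%:E)%E by move=> Dt; apply: integral_ge0 => x _; rewrite lee_fin f0.
have /(ae_eq_integral_abs leb mD (measurable_time_integral mf')) : (\int[leb]_(t in D) `|\int[mu t]_x (f (x, t))%:E| = 0)%E.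
  by rewrite -[RHS]F0'; apply: eq_integral => t; rewrite inE => Dt; rewrite gee0_abs // ge.
apply: filterS => t h Dt.
have mft : measurable_fun (setT : set (borelType M)) (fun x => (f (x, t))%:E) := measurable_fiber mD Dt mf'.
have /(ae_eq_integral_abs (mu t) measurableT mft) : (\int[mu t]_x `|(f (x, t))%:E| = 0)%E.
  by rewrite -[RHS](h Dt); apply: eq_integral => x _; rewrite gee0_abs // lee_fin f0.
by apply: filterS => x /(_ I) [].
Qed.

(** The velocity enters the continuity equation only through integrals on the
    fibers. *)
Lemma CE_ae_eq v w : CE g T mu v -> Borel_field D w ->
  {ae leb, forall t, D t -> {ae mu t, forall x, v t x = w t x}} -> CE g T mu w.
Proof.
move=> hv mw vw; have mv := velocity_Borel hv.
have trans (I J : M * R -> R) : measurable_fun (setT `*` D : set (borelType M * RR)) I ->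
    measurable_fun (setT `*` D : set (borelType M * RR)) J ->
    (forall x t, v t x = w t x -> I (x, t) = J (x, t)) ->
    (\int[leb]_(t in D) \int[mu t]_x (I (x, t))%:E = \int[leb]_(t in D) \int[mu t]_x (J (x, t))%:E)%E.
  move=> /measurable_EFinP mI /measurable_EFinP mJ IJ.
  apply: ae_eq_integral => //; [exact: measurable_time_integral mI|exact: measurable_time_integral mJ|].
  apply: filterS vw => t h Dt.
  have mIt : measurable_fun (setT : set (borelType M)) (fun x => (I (x, t))%:E) := measurable_fiber mD Dt mI.
  have mJt : measurable_fun (setT : set (borelType M)) (fun x => (J (x, t))%:E) := measurable_fiber mD Dt mJ.
  apply: ae_eq_integral => //.
  have ht := h Dt; rewrite /ae_eq; move: ht; apply: (@filterS _ _ (ae_filter_ringOfSetsType (mu t))) => x e _; by rewrite (IJ _ _ e).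
have [_ _ iv weak] := hv; refine (And4 nmu mw _ _).
  refine (eq_ind _ (fun z => (z < +oo)%E) iv _ _).
  apply: (trans (fun p => tnorm g (v p.2 p.1)) (fun p => tnorm g (w p.2 p.1))).
  - exact: measurable_tnorm.
  - exact: measurable_tnorm.
  - by move=> x t /= ->.
move=> phi tphi; rewrite -[RHS](weak phi tphi); apply/esym.
apply: (trans (fun p => derive1 (phi p.1) p.2 + mdiff S (phi^~ p.2) p.1 (v p.2 p.1))
   (fun p => derive1 (phi p.1) p.2 + mdiff S (phi^~ p.2) p.1 (w p.2 p.1))).
- exact: measurable_test.
- exact: measurable_test.
- by move=> x t /= ->.
Qed.

End ae_velocity.

(** * The dissipation as a square *)

Section dissipation_identity.
Context {R : realType} {n : nat} {M : ptopologicalType}.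
Variables (S : smooth_manifold R n M) (g : riemannian_metric S).
Hypothesis cM : compact [set: M].
Local Notation V := 'rV[R]_n.
Local Notation RR := (measurableTypeR R).
Local Notation leb := (@lebesgue_measure R).
Variables (T : R) (mu : R -> proba R M).
Hypothesis T0 : 0 < T.
Hypothesis nmu : narrowly_continuous T mu.
Variables (K W : M -> M -> R).
Hypothesis cK : continuous (fun p : M * M => K p.1 p.2).
Hypothesis K_pos : exists2 C : R, 0 < C & forall x y, C <= K x y.
Hypothesis hW : C1_on_product S W.
Hypothesis Wsym : forall x y, W x y = W y x.
Local Notation Lam := (space_time S cM T0 nmu).
Local Notation D := ([set` `]0, T[%R] : set RR).
Local Notation XD := (setT `*` D : set (borelType M * RR)).
Local Notation Dpot t x := (mdiff S (potential W (mu (clamp T t))) x).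
Local Notation m p := (mobility K (mu (clamp T p.2)) p.1).
Local Notation M2 := (manifold_second_countable S).
Local Notation grad := (fun t x => gradient_velocity g K W (mu t) x).

Let mD : measurable D. Proof. exact: measurable_itv. Qed.
Let mXD : measurable XD. Proof. exact: measurableX. Qed.

Let K_slice x : continuous (K x).
Proof.
move=> y; apply: (@continuous_comp _ _ _ (fun y : M => (x, y)) (fun p : M * M => K p.1 p.2)).
  exact: pair_continuousl.
exact: cK.
Qed.

Lemma mobility_lower (C : R) (P : proba R M) x : (forall x y, C <= K x y) -> C <= mobility K P x.
Proof.
move=> hC; have -> : C = \int[P]_y cst C y.
  by rewrite Rintegral_cst // [fine _](_ : _ = 1) ?mulr1 // [X in fine X](@probability_setT _ _ _ P).
apply: le_Rintegral => //.
- by apply: continuous_probability_integrable => //; exact: cst_continuous.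
- exact: continuous_probability_integrable.
Qed.

Lemma mobility_gt0 (P : proba R M) x : 0 < mobility K P x.
Proof. have [C C0 hC] := K_pos; exact: lt_le_trans C0 (mobility_lower _ _ hC). Qed.

Lemma measurable_mobility : measurable_fun XD (fun p => m p).
Proof.
apply: measurable_funTS.
have c (p : M * R) : setT p -> {for p, continuous (fun p : M * R => m p)}.
  by case: p => x t _; exact: (mobility_continuous cM (ltW T0) nmu cK).
exact (@open_continuous_prodR R M M2 setT (fun p : M * R => m p) openT c).
Qed.

Lemma Borel_gradient : Borel_field (S := S) D grad.
Proof.
move=> i j.
apply: (eq_measurable_fun (fun p : borelType M * RR =>
   to_chart i ((fun t x => (- (m (x, t))^-1) *: (riesz g (Dpot t x) : V) : tangent S x) p.2 p.1) 0 j)).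
  move=> [x t]; rewrite inE => -[/= ix Dt].
  by rewrite /gradient_velocity (time_clamp mu Dt) J2_riesz scaleNr.
refine (@Borel_fieldZ R n M S D mD (fun p => - (m p)^-1) (fun t x => riesz g (Dpot t x)) _ _ i j).
  by apply: measurable_funN; apply: measurable_inv => //; exact: measurable_mobility.
by apply: Borel_riesz => //; exact: Borel_covector_potential.
Qed.

Lemma kinetic_action (u : R -> forall x : M, tangent S x) : Borel_field D u ->
  measurable_fun XD (fun p => m p * tnorm g (u p.2 p.1) ^+ 2) /\
  (\int[leb]_(t in D) kinetic g K (mu t) (u t) = \int[Lam]_(p in XD) (m p * tnorm g (u p.2 p.1) ^+ 2)%:E)%E.
Proof.
move=> mu_.
have mk : measurable_fun XD (fun p => m p * tnorm g (u p.2 p.1) ^+ 2).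
  apply: measurable_funM; first exact: measurable_mobility.
  by apply: measurable_funX; exact: measurable_tnorm.
split => //; rewrite ge0_space_time_integral.
- by apply: eq_integral => t; rewrite inE => Dt; rewrite /kinetic /= time_clamp.
- exact/measurable_EFinP.
- by move=> z _; rewrite lee_fin mulr_ge0 ?exprn_ge0 ?tnorm_ge0 // ltW // mobility_gt0.
Qed.

(** The gradient velocity has norm m^-1 |xi|, where xi is the differential of
    the potential. *)
Lemma slope_kinetic t : slope_term g K W (mu t) = kinetic g K (mu t) (grad t).
Proof.
by apply: eq_integral => x _; rewrite /gradient_velocity tnorm_scaled_J2 // mobility_gt0.
Qed.

Lemma slope_velocity t x : D t -> (m (x, t))^-1 * dual_norm g (Dpot t x) ^+ 2 = m (x, t) * tnorm g (grad t x) ^+ 2.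
Proof. by move=> Dt; rewrite /= (time_clamp mu Dt) /gradient_velocity tnorm_scaled_J2 // mobility_gt0. Qed.

Lemma slope_pairing t x : D t -> Dpot t x (grad t x) = - (m (x, t) * tnorm g (grad t x) ^+ 2).
Proof.
move=> Dt; rewrite -slope_velocity //= (time_clamp mu Dt) /gradient_velocity.
by apply: pairing_scaled_J2; exact: mobility_gt0.
Qed.

(** The differential of the potential is bounded and the mobility is bounded
    below. *)
Lemma gradient_bounded : exists B : R, forall t x, D t -> tnorm g (grad t x) <= B.
Proof.
have [C [C0 hC]] := potential_bound cM g hW (ltW T0) nmu; have [C1 C10 hC1] := K_pos.
exists (C1^-1 * C) => t x Dt.
rewrite /gradient_velocity -scaleNr tnormZ normrN J2_riesz -dual_normE.
rewrite gtr0_norm ?invr_gt0 ?mobility_gt0 //; apply: ler_pM.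
- by rewrite invr_ge0 ltW // mobility_gt0.
- exact: dual_norm_ge0.
- by rewrite lef_pV2 ?posrE ?mobility_gt0 //; exact: mobility_lower.
- by apply: dual_norm_bound => // v; rewrite -(time_clamp mu Dt).
Qed.

Lemma slope_bounded : exists B : R, forall t x, D t -> m (x, t) * tnorm g (grad t x) ^+ 2 <= B.
Proof.
have [B hB] := gradient_bounded.
have cMM : compact [set: M * M] by rewrite -setXTT; exact: compact_setX.
have [N [N0 hN]] := continuous_compact_bounded cMM cK.
exists (N * B ^+ 2) => t x Dt; apply: ler_pM.
- by apply: ltW; exact: mobility_gt0.
- by rewrite exprn_ge0 ?tnorm_ge0.
- apply: le_trans (ler_norm _) _.
  have := @Rintegral_dist_le R M cM (mu (clamp T t)) (K x) (cst 0) N (@K_slice x) (fun y => cvg_cst 0).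
  rewrite (@Rintegral_cst _ _ _ (mu (clamp T t))) // mul0r subr0; apply.
  by move=> y; rewrite subr0; exact: (hN (x, y)).
- by rewrite lerXn2r ?nnegrE ?tnorm_ge0 ?hB // (le_trans _ (hB t x Dt)) // tnorm_ge0.
Qed.

Let slo (p : M * R) := m p * tnorm g (grad p.2 p.1) ^+ 2.

Lemma slope_integrable : Lam.-integrable XD (EFin \o slo).
Proof.
have [B hB] := slope_bounded.
apply: (@space_time_bounded_integrable R n M S cM T mu T0 nmu slo B).
  by have [] := kinetic_action Borel_gradient.
move=> [x t] [_ /= Dt]; rewrite ger0_norm; first exact: hB.
by rewrite mulr_ge0 ?exprn_ge0 ?tnorm_ge0 // ltW // mobility_gt0.
Qed.

Lemma slope_action : (\int[leb]_(t in D) slope_term g K W (mu t) = (\int[Lam]_(p in XD) slo p)%:E)%E.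
Proof.
rewrite /Rintegral fineK ?(integrable_fin_num _ slope_integrable) //.
have [_ <-] := kinetic_action Borel_gradient.
by apply: eq_integral => t _; rewrite slope_kinetic.
Qed.

Section along.
Variable v : R -> forall x : M, tangent S x.
Hypothesis hv : CE g T mu v.
Let kin (p : M * R) := m p * tnorm g (v p.2 p.1) ^+ 2.
Let pairing (p : M * R) : R := Dpot p.2 p.1 (v p.2 p.1).
Let sq (p : M * R) := m p * tnorm g ((v p.2 p.1 : V) + (m p)^-1 *: (J2 g (Dpot p.2 p.1) : V) : tangent S p.1) ^+ 2.

Lemma pairing_integrable : Lam.-integrable XD (EFin \o pairing).
Proof.
have [C [C0 hC]] := potential_bound cM g hW (ltW T0) nmu.
apply: (velocity_dominated cM T0 nmu hv (C := C)) => [|z _]; last exact: hC.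
exact: (@measurable_pairing _ _ _ S cM D mD (fun t x => Dpot t x) v (Borel_covector_potential cM T0 nmu hW) (velocity_Borel hv)).
Qed.

Let kin_measurable : measurable_fun XD kin.
Proof. by have [] := kinetic_action (velocity_Borel hv). Qed.

Let kin_ge0 p : 0 <= kin p.
Proof. by rewrite mulr_ge0 ?exprn_ge0 ?tnorm_ge0 // ltW // mobility_gt0. Qed.

Let action := (\int[leb]_(t in D) kinetic g K (mu t) (v t))%E.

(** The energy difference and the slope part are finite, so an infinite action
    cannot be compensated. *)
Lemma dissipation_infinite : action = +oo%E -> dissipation g K W T mu v = +oo%E.
Proof.
move=> a; rewrite /dissipation -[X in (_ + _ * X + _)%E]/action a slope_action.
by rewrite mulry gtr0_sg // mul1e.
Qed.

Lemma finite_action_integrable : (action < +oo)%E -> Lam.-integrable XD (EFin \o kin).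
Proof.
have [_ e] := kinetic_action (velocity_Borel hv).
move=> a; apply/integrableP; split; first exact/measurable_EFinP.
rewrite (eq_integral (fun p : borelType M * RR => (kin p)%:E)) => [|p _]; last by rewrite gee0_abs ?lee_fin.
by move: a; rewrite /action e.
Qed.

(** By the chain rule the energy difference is the integral of the cross term of
    the completed square. *)
Lemma dissipation_square : (action < +oo)%E ->
  Lam.-integrable XD (EFin \o sq) /\ dissipation g K W T mu v = (2^-1 * \int[Lam]_(p in XD) sq p)%:E.
Proof.
move=> a; have ik := finite_action_integrable a; have [_ e] := kinetic_action (velocity_Borel hv).
have ip := pairing_integrable; have isl := slope_integrable.
have i2 : Lam.-integrable XD (EFin \o (fun p => 2 * pairing p)) by exact: (integrableZl mXD 2 ip).
have ikp : Lam.-integrable XD (EFin \o (fun p => kin p + 2 * pairing p)) by exact: (integrableD mXD ik i2).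
have i3 : Lam.-integrable XD (EFin \o (fun p => kin p + 2 * pairing p + slo p)) by exact: (integrableD mXD ikp isl).
have E p : XD p -> sq p = kin p + 2 * pairing p + slo p.
  case: p => x t [_ Dt]; refine (eq_trans (completed_square g _ _ (mobility_gt0 _ _)) _).
  exact (f_equal (fun z => kin (x, t) + 2 * pairing (x, t) + z) (slope_velocity x Dt)).
split.
  by apply: (eq_integrable mXD (EFin \o (fun p => kin p + 2 * pairing p + slo p)) (EFin \o sq)) i3 => p; rewrite inE => Dp /=; rewrite E.
have -> : \int[Lam]_(p in XD) sq p = \int[Lam]_(p in XD) kin p + 2 * \int[Lam]_(p in XD) pairing p + \int[Lam]_(p in XD) slo p.
  rewrite (@eq_Rintegral _ _ _ Lam XD (fun p => kin p + 2 * pairing p + slo p) sq) => [|p]; last by rewrite inE; exact: E.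
  by rewrite RintegralD // RintegralD // RintegralZl.
have ka : action = (\int[Lam]_(p in XD) kin p)%:E.
  by rewrite /action e /Rintegral fineK // (integrable_fin_num _ ik).
rewrite /dissipation -[X in (_ + _ * X + _)%E]/action ka slope_action (chain_rule cM T0 nmu hW Wsym hv).
rewrite -!EFinM -!EFinD; congr EFin.
have alg (x y z : R) : y + 2^-1 * x + 2^-1 * z = 2^-1 * (x + 2 * y + z) by field.
exact: alg.
Qed.

Lemma dissipation_ge0 : (0 <= dissipation g K W T mu v)%E.
Proof.
have [a|] := ltP action +oo%E; last by rewrite leye_eq => /eqP /dissipation_infinite ->.
have [_ ->] := dissipation_square a.
rewrite lee_fin mulr_ge0 // ?invr_ge0 //; apply: Rintegral_ge0 => p _.
by rewrite mulr_ge0 ?exprn_ge0 ?tnorm_ge0 // ltW // mobility_gt0.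
Qed.

(** The integral of m |v - w|^2 vanishes, so v coincides almost everywhere with
    the gradient velocity w. *)
Lemma null_dissipation : dissipation g K W T mu v = 0%E -> CE g T mu grad.
Proof.
have [a|] := ltP action +oo%E; last by rewrite leye_eq => /eqP /dissipation_infinite ->.
have [isq ->] := dissipation_square a => -[] /eqP; rewrite mulf_eq0 invr_eq0 pnatr_eq0 /= => /eqP z.
have Z : (\int[Lam]_(p in XD) (sq p)%:E = 0)%E.
  by rewrite -[LHS]fineK ?(integrable_fin_num _ isq) // [fine _]z.
have msq : measurable_fun XD sq by apply/measurable_EFinP; exact: measurable_int isq.
have sq0 p : XD p -> 0 <= sq p by move=> _; rewrite mulr_ge0 ?exprn_ge0 ?tnorm_ge0 // ltW // mobility_gt0.
apply: (CE_ae_eq cM T0 nmu hv Borel_gradient).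
have := ae_fibers msq sq0 Z; apply: filterS => t h Dt.
have ht := h Dt; move: ht; apply: (@filterS _ _ (ae_filter_ringOfSetsType (mu t))) => x.
move=> /eqP; rewrite mulf_eq0 gt_eqF ?mobility_gt0 //= sqrf_eq0 => /eqP /tnorm_eq0 /= e.
apply/eqP; rewrite /gradient_velocity -addr_eq0 -(time_clamp mu Dt); exact/eqP.
Qed.

End along.

(** The chain rule is applied to the gradient velocity w and not to v: xi(w) is
    minus the slope density, so the energy decreases by the whole slope term. *)
Lemma weak_solution_dissipation v : CE g T mu v -> CE g T mu grad ->
  (\int[leb]_(t in D) kinetic g K (mu t) (v t) <= \int[leb]_(t in D) slope_term g K W (mu t))%E ->
  (dissipation g K W T mu v <= 0)%E.
Proof.
move=> hv hw; rewrite slope_action => kle.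
have a : (\int[leb]_(t in D) kinetic g K (mu t) (v t) < +oo)%E by rewrite (le_lt_trans kle) // ltry.
have dE : energy W (mu T) - energy W (mu 0) = - \int[Lam]_(p in XD) slo p.
  rewrite (chain_rule cM T0 nmu hW Wsym hw) -[RHS]mulN1r -RintegralZl //; last exact: slope_integrable.
  apply: eq_Rintegral => -[x t]; rewrite inE => -[_ /= Dt].
  rewrite mulN1r; exact: slope_pairing.
have ik := finite_action_integrable hv a; have [_ e] := kinetic_action (velocity_Borel hv).
rewrite e in kle; rewrite /dissipation slope_action dE e.
rewrite -[X in (_ + _ * X + _)%E]fineK ?(integrable_fin_num _ ik) //.
rewrite -[X in (X <= _)%E]fineK ?(integrable_fin_num _ ik) // in kle.
rewrite lee_fin in kle.
rewrite -!EFinM -!EFinD lee_fin.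
have alg (x s : R) : x <= s -> - s + 2^-1 * x + 2^-1 * s <= 0 by lra.
exact: alg.
Qed.

End dissipation_identity.

(** * Affine changes of time *)

(** Infinite values must be ruled out, since the difference of two infinities is
    -oo. *)
Lemma scaled_diff_eq0 {R : realType} (c : R) (p q : \bar R) : 0 < c -> (0 <= p)%E -> (0 <= q)%E ->
  (c%:E * p - c%:E * q = 0)%E -> (p - q = 0)%E.
Proof.
move=> c0.
have cy : (c%:E * +oo = +oo)%E by rewrite mulry gtr0_sg // mul1e.
case: p => [p| |] p0; last by move: p0; rewrite leNgt ltNy0.
  case: q => [q| |] q0; last by move: q0; rewrite leNgt ltNy0.
    rewrite -!EFinM -!EFinB => -[] /eqP.
    by rewrite -mulrBr mulf_eq0 gt_eqF // orFb => /eqP ->.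
  by rewrite cy -EFinM addeC.
case: q => [q| |] q0; last by move: q0; rewrite leNgt ltNy0.
  by rewrite cy -EFinM.
by rewrite cy.
Qed.

Section affine_change.
Context {R : realType}.
Local Notation leb := (@lebesgue_measure R).
Local Notation RR := (measurableTypeR R).
Variables (a c : R).
Hypothesis c0 : 0 < c.
Let phi (s : RR) : RR := a + c * s.

Lemma affine_measurable : measurable_fun [set: RR] phi.
Proof.
apply: continuous_measurable_fun => s; apply: cvgD; first exact: cvg_cst.
by apply: cvgM; [exact: cvg_cst|exact: cvg_id].
Qed.

Lemma affine_preimage : phi @^-1` ([set` `]a, (a + c)[%R] : set RR) = [set` `]0, 1[%R].
Proof.
apply/seteqP; split => s; rewrite /phi /= !in_itv /= ltrDl ltrD2l pmulr_rgt0 //.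
  by move=> /andP[-> h]; rewrite -(@ltr_pM2l _ c) // mulr1.
by move=> /andP[-> h]; rewrite -[X in _ < X]mulr1 ltr_pM2l.
Qed.

Let scaled : {measure set RR -> \bar R} := mscale (NngNum (ltW c0)) (measure_function_pushforward__canonical__measure_function_Measure leb affine_measurable).

(** Both measures agree on half-open intervals. *)
Lemma lebesgue_affine (A : set RR) : measurable A -> leb A = scaled A.
Proof.
apply: lebesgue_measure_unique => X [[x y] _ <-].
rewrite /scaled /= /mscale /pushforward /=.
rewrite -[pushforward _ _ _]/(leb (phi @^-1` `]x, y])).
have -> : phi @^-1` `]x, y] = [set` `](x - a) / c, (y - a) / c]%R].
  by apply/seteqP; split => s; rewrite /phi /= !in_itv /= ltr_pdivrMr // ler_pdivlMr // ltrBlDl lerBrDl (mulrC c).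
rewrite !lebesgue_measure_itv /= !lte_fin ltr_pM2r ?invr_gt0 // ltrD2r.
case: ifP => _; last by rewrite mule0.
by rewrite -!EFinB -EFinM; congr EFin; field; rewrite gt_eqF.
Qed.

Lemma ge0_integral_affine (h : R -> \bar R) : measurable_fun ([set` `]a, (a + c)[%R] : set RR) h ->
  (forall t, (0 <= h t)%E) ->
  (\int[leb]_(t in [set` `]a, (a + c)[%R]) h t = c%:E * \int[leb]_(s in [set` `]0%R, 1%R[]) h (a + c * s)%R)%E.
Proof.
move=> mh h0.
have mI : measurable ([set` `]a, (a + c)[%R] : set RR) by exact: measurable_itv.
rewrite (@eq_measure_integral _ _ _ _ scaled leb) => [|A mA _]; last exact: lebesgue_affine.
rewrite ge0_integral_mscale //; congr (_ * _)%E.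
by rewrite (ge0_integral_pushforward affine_measurable) // affine_preimage.
Qed.

(** This version for signed functions asks for no integrability: a zero integral
    already forces the positive and negative parts to have the same finite
    integral. *)
Lemma integral_affine_eq0 (h : R -> \bar R) : measurable_fun ([set` `]a, (a + c)[%R] : set RR) h ->
  (\int[leb]_(t in [set` `]a, (a + c)[%R]) h t = 0)%E ->
  (\int[leb]_(s in [set` `]0%R, 1%R[]) h (a + c * s)%R = 0)%E.
Proof.
move=> mh; rewrite [LHS]integralE.
rewrite (ge0_integral_affine (measurable_funepos mh)) // (ge0_integral_affine (measurable_funeneg mh)) //.
set p := (\int[leb]_(s in _) (h^\+)%E _)%E; set q := (\int[leb]_(s in _) (h^\-)%E _)%E.
have -> : (\int[leb]_(s in [set` `]0%R, 1%R[]) h (a + c * s)%R = p - q)%E.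
  by rewrite integralE; congr (_ - _)%E; apply: eq_integral => s _; rewrite ?funeposE ?funenegE.
have p0 : (0 <= p)%E by apply: integral_ge0.
have q0 : (0 <= q)%E by apply: integral_ge0.
exact: scaled_diff_eq0.
Qed.

End affine_change.

(** * Rescaled test functions *)

Lemma rescale_map_diff {R : realType} (U : normedModType R) (a c : R) (p : U * R) :
  differentiable (fun q : U * R => (q.1, (q.2 - a) / c)) p /\
  forall w, 'd (fun q : U * R => (q.1, (q.2 - a) / c)) p w = (w.1, w.2 / c).
Proof.
pose L0 (w : U * R) := (w.1, w.2 / c).
have lf : linear L0 by move=> k u w; rewrite /L0 /=; congr pair; rewrite mulrDl -mulrA.
pose L : {linear (U * R)%type -> (U * R)%type} := HB.pack L0 (GRing.isLinear.Build _ _ _ _ _ lf).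
have [|e e0|d e] := @diff_intro R _ _ (fun q : U * R => (q.1, (q.2 - a) / c)) p L.
- move=> q; have h1 : fst q' @[q' --> q] --> fst q by exact: cvg_fst.
  have h2 : q'.2 / c @[q' --> q] --> q.2 / c by apply: cvgM; [exact: cvg_snd|exact: cvg_cst].
  exact: (cvg_pair h1 h2).
- have N : forall h : (U * R)%type, `|((h + p).1, ((h + p).2 - a) / c) - (p.1, (p.2 - a) / c) - L h| <= e * `|h|.
    move=> h; rewrite (_ : _ - _ = 0) ?normr0 ?mulr_ge0 // ?ltW //.
    congr pair; rewrite /= ?addrK ?subrr //.
    by ring.
  exact: (@filterE _ (nbhs (0 : (U * R)%type)) (nbhs_filter _) _ N).
by split => // w; rewrite e.
Qed.

Lemma cotangentZ {R : realType} {n : nat} {M : ptopologicalType} (S : smooth_manifold R n M) x (xi : cotangent S x) (c : R) (v : tangent S x) :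
  xi (c *: (v : 'rV[R]_n) : tangent S x) = c * xi v.
Proof. by rewrite linearZ. Qed.

Section rescaled_test.
Context {R : realType} {n : nat} {M : ptopologicalType}.
Variables (S : smooth_manifold R n M).
Local Notation V := 'rV[R]_n.
Variables (T a c : R).
Hypothesis a0 : 0 <= a.
Hypothesis c0 : 0 < c.
Hypothesis acT : a + c <= T.
Variable phi : M -> R -> R.
Hypothesis hphi : C1c S 1 phi.

(** The factor c compensates the factor 1/c that the change of time produces in
    the time derivative; so the equation is transported without dividing by c.
    *)
Definition rescaled_test (x : M) (t : R) := if a < t < a + c then c * phi x ((t - a) / c) else 0.

Let A (p : V * R) := (p.1, (p.2 - a) / c).

Let in01 t : a < t < a + c -> 0 < (t - a) / c < 1.
Proof. by move=> /andP[h1 h2]; rewrite divr_gt0 ?subr_gt0 //= ltr_pdivrMr // mul1r ltrBlDl. Qed.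

Let near_inside t : a < t < a + c -> \forall t' \near t, a < t' < a + c.
Proof.
move=> h; have : open_nbhs t [set` `]a, (a + c)[%R].
  by split; [exact: interval_open|rewrite /= in_itv].
by move/open_nbhs_nbhs; apply: filterS => t' /=; rewrite in_itv.
Qed.

(** The support in time is a compact subset of ]a, a + c[, so the extension by 0
    is locally either the rescaled function or 0. *)
Lemma rescaled_test_support : exists L : set R, [/\ closed L, (forall t, L t -> a < t < a + c) &
  exists K : set (M * R), [/\ compact K, K `<=` setT `*` L & forall x t, ~ K (x, t) -> rescaled_test x t = 0]].
Proof.
have [_ [K [cK K1 K0]]] := hphi.
have KI x t : K (x, t) -> 0 < t < 1 by move=> /K1 [_ /=]; rewrite in_itv.
pose f (q : M * R) := a + c * q.2.
have cf : continuous f.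
  by move=> q; apply: cvgD; [exact: cvg_cst|apply: cvgM; [exact: cvg_cst|exact: cvg_snd]].
exists (f @` K); split.
- apply: compact_closed; first exact: Rhausdorff.
  by apply: continuous_compact => //; exact: continuous_subspaceT.
- move=> _ [[x t] /KI /andP[t0 t1] <-]; rewrite /f /= ltrDl mulr_gt0 //= ltrD2l.
  by rewrite -[X in _ < X]mulr1 ltr_pM2l.
exists ((fun q : M * R => (q.1, f q)) @` K); split.
- apply: continuous_compact => //; apply: continuous_subspaceT => q.
  have h1 : fst q' @[q' --> q] --> fst q by exact: cvg_fst.
  exact: (cvg_pair h1 (cf q)).
- by move=> _ [q Kq <-]; split => //=; exists q.
- move=> x t h; rewrite /rescaled_test; case: ifP => // _.
  rewrite K0 ?mulr0 // => Kt; apply: h; exists (x, (t - a) / c) => //.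
  by rewrite /f /=; congr pair; field; rewrite gt_eqF.
Qed.

Lemma rescaled_test_inside (i : chart S) u t : chart_image i u -> a < t < a + c ->
  differentiable (chart_test rescaled_test i) (u, t) /\
  forall w, 'd (chart_test rescaled_test i) (u, t) w = c * 'd (chart_test phi i) (u, (t - a) / c) (w.1, w.2 / c).
Proof.
move=> iu ht.
have dF : differentiable (chart_test phi i) (u, (t - a) / c).
  by have [/(_ i) [+ _] _] := hphi; apply; split => //=; rewrite in_itv /= in01.
have [dA eA] := rescale_map_diff a c (u, t).
have dC := differentiable_chain (f := A) (x := (u, t)) (erefl _) dA dF.
have dZ := differentiableZ c dC.
have N : \forall p \near (u, t), (c *: (chart_test phi i \o A : V * R -> R^o)) p = chart_test rescaled_test i p.
  have : nbhs (u, t) (setT `*` [set t' | a < t' < a + c]).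
    by apply: nbhs_prod; [exact: filterT|exact: near_inside].
  by apply: filterS => -[u' t'] [_ /= h]; rewrite /chart_test /rescaled_test /= h.
split; first exact: near_eq_differentiable N dZ.
move=> w; refine (eq_trans (esym (near_eq_diff N dZ w)) _).
refine (eq_trans (f_equal (fun h : V * R -> R^o => h w) (diffZ c dC)) _).
refine (f_equal (fun z => c * z) (eq_trans (diff_chain w (erefl _) dA dF) _)).
by rewrite eA.
Qed.

Lemma rescaled_test_outside (i : chart S) u t (L : set R) : closed L ->
  (forall x s, ~ L s -> rescaled_test x s = 0) -> ~ L t ->
  differentiable (chart_test rescaled_test i) (u, t) /\
  forall w, 'd (chart_test rescaled_test i) (u, t) w = 0.
Proof.
move=> cL L0 Lt.
have N : \forall p \near (u, t), cst 0 p = chart_test rescaled_test i p.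
  have : nbhs (u, t) (setT `*` ~` L).
    apply: nbhs_prod; [exact: filterT|]; apply: open_nbhs_nbhs; split => //.
    by rewrite openC.
  by apply: filterS => -[u' t'] [_ /= h]; rewrite /chart_test L0.
have dc : differentiable (cst 0 : V * R -> R^o) (u, t) by exact: differentiable_cst.
split; first exact: near_eq_differentiable N dc.
by move=> w; rewrite -(near_eq_diff N dc) diff_cst.
Qed.

Lemma rescaled_test_C1c : C1c S T rescaled_test.
Proof.
have [L [cL LI [K [cK KL K0]]]] := rescaled_test_support.
have L0 x s : ~ L s -> rescaled_test x s = 0 by move=> h; apply: K0 => /KL [].
have LT t : L t -> 0 < t < T.
  by move=> /LI /andP[h1 h2]; rewrite (le_lt_trans a0 h1) (lt_le_trans h2 acT).
split; last first.
  exists K; split => // -[x t] /KL [_ /= /LT]; by rewrite in_itv.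
move=> i.
(* The open interval and the complement of the support in time form an open
   cover. *)
have cases t : (a < t < a + c) \/ ~ L t.
  by have [/LI|] := pselect (L t); [left|right].
split; first move=> [u t] [/= iu _].
  have [h|h] := cases t; first by have [] := rescaled_test_inside iu h.
  by have [] := rescaled_test_outside i u cL L0 h.
move=> w [u t] [/= iu _]; have [h|h] := cases t.
  apply: (near_continuous_at (h := fun p => c * 'D_(w.1, w.2 / c) (chart_test phi i) (A p))).
    have : nbhs (u, t) (chart_image i `*` [set t' | a < t' < a + c]).
      by apply: nbhs_prod; [exact: near_chart_image|exact: near_inside].
    apply: filterS => -[u' t'] [/= iu' h']; have [d e] := rescaled_test_inside iu' h'.
    rewrite deriveE; last first.
      by have [/(_ i) [+ _] _] := hphi; apply; split => //=; rewrite in_itv /= in01.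
    by rewrite [RHS]deriveE.
  apply: cvgM; first exact: cvg_cst.
  apply: (@continuous_comp _ _ _ A (fun q => 'D_(w.1, w.2 / c) (chart_test phi i) q)).
    by apply: differentiable_continuous; have [] := rescale_map_diff a c (u, t).
  have [/(_ i) [_ H] _] := hphi; apply: (H (w.1, w.2 / c) (A (u, t))).
  by split => //=; rewrite in_itv /= in01.
apply: (near_continuous_at (h := cst 0)); last exact: cvg_cst.
have : nbhs (u, t) (setT `*` ~` L).
  by apply: nbhs_prod; [exact: filterT|apply: open_nbhs_nbhs; split => //; rewrite openC].
apply: filterS => -[u' t'] [_ /= h']; have [d e] := rescaled_test_outside i u' cL L0 h'.
by rewrite deriveE.
Qed.

(** The integrand of the weak equation for w on ]a, a + c[ is, at the rescaled
    time, that for the velocity c w on ]0, 1[. *)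
Lemma rescaled_test_integrand x s (w : tangent S x) : 0 < s < 1 ->
  derive1 (rescaled_test x) (a + c * s) + mdiff S (rescaled_test^~ (a + c * s)) x w =
  derive1 (phi x) s + mdiff S (phi^~ s) x (c *: (w : V) : tangent S x).
Proof.
move=> s01; have /andP[s0 s1] := s01.
have ix := mem_chart_at S x; set i := chart_at S x in ix.
have iu : chart_image i (chart_coord i x) by exists x.
have hin : a < a + c * s < a + c by rewrite ltrDl mulr_gt0 //= ltrD2l -[X in _ < X]mulr1 ltr_pM2l.
have es : (a + c * s - a) / c = s by field; rewrite gt_eqF.
have [d e] := rescaled_test_inside iu hin; rewrite es in e.
have Ds : ([set` `]0, 1[%R] : set R) s by rewrite /= in_itv.
have dphi := chart_test_diff hphi ix Ds.
congr (_ + _).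
  have E1 := eq_trans (test_time_derivative rescaled_test (a + c * s) ix) (eq_trans (deriveE ((0, 1) : (V * R)%type) d) (e ((0, 1) : (V * R)%type))).
  have E2 := eq_trans (test_time_derivative phi s ix) (deriveE ((0, 1) : (V * R)%type) dphi).
  refine (eq_trans E1 (eq_trans _ (esym E2))).
  have E3 : ((0 : V), 1 / c) = c^-1 *: (0, 1) by congr pair; rewrite /= ?scaler0 // /GRing.scale /= mulr1 mul1r.
  refine (eq_trans (f_equal (fun z => c * 'd (chart_test phi i) (chart_coord i x, s) z) E3) _).
  refine (eq_trans (f_equal (fun z => c * z) (linearZ _ _)) _).
  have cK (z : R) : c * (c^-1 * z) = z by rewrite mulrA divff ?mul1r // gt_eqF.
  exact (cK _).
have -> : rescaled_test^~ (a + c * s) = (fun y => c * phi y s).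
  by apply/funext => y; rewrite /rescaled_test hin es.
have [d1 e1] := partial_diff dphi.
refine (eq_trans (f_equal (fun h : V -> R^o => h w) (diffZ c d1)) _).
exact (esym (cotangentZ (mdiff S (phi^~ s) x) c w)).
Qed.

Lemma rescaled_test_zero x t (w : tangent S x) : ~~ (a < t < a + c) ->
  derive1 (rescaled_test x) t + mdiff S (rescaled_test^~ t) x w = 0.
Proof.
move=> ht; have [L [cL LI [K [cK KL K0]]]] := rescaled_test_support.
have L0 y s : ~ L s -> rescaled_test y s = 0 by move=> h; apply: K0 => /KL [].
have Lt : ~ L t by move=> /LI h; rewrite h in ht.
have ix := mem_chart_at S x; set i := chart_at S x in ix.
have [d e] := rescaled_test_outside i (chart_coord i x) cL L0 Lt.
rewrite (test_time_derivative rescaled_test _ ix) deriveE // e add0r.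
have -> : rescaled_test^~ t = cst 0 by apply/funext => y; exact: L0.
by rewrite /mdiff (_ : _ \o _ = cst 0) ?diff_cst.
Qed.

End rescaled_test.

(** * Rescaled solutions and the transport distance *)

Section rescaled_curve.
Context {R : realType} {n : nat} {M : ptopologicalType}.
Variables (S : smooth_manifold R n M) (g : riemannian_metric S).
Hypothesis cM : compact [set: M].
Local Notation V := 'rV[R]_n.
Local Notation RR := (measurableTypeR R).
Local Notation leb := (@lebesgue_measure R).
Variables (T : R) (mu : R -> proba R M).
Hypothesis T0 : 0 < T.
Hypothesis nmu : narrowly_continuous T mu.
Variable K : M -> M -> R.
Hypothesis cK : continuous (fun p : M * M => K p.1 p.2).
Hypothesis K_pos : exists2 C : R, 0 < C & forall x y, C <= K x y.
Variable w : R -> forall x : M, tangent S x.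
Hypothesis hw : CE g T mu w.
Variables (a c : R).
Hypothesis a0 : 0 <= a.
Hypothesis c0 : 0 < c.
Hypothesis acT : a + c <= T.
Local Notation D := ([set` `]0, T[%R] : set RR).
Local Notation I01 := ([set` `]0%R, 1%R[] : set RR).
Local Notation I := ([set` `]a, (a + c)[%R] : set RR).
Local Notation m p := (mobility K (mu (clamp T p.2)) p.1).

Let mD : measurable D. Proof. exact: measurable_itv. Qed.
Let mI : measurable I. Proof. exact: measurable_itv. Qed.
Let m01 : measurable I01. Proof. exact: measurable_itv. Qed.

Let ID : I `<=` D.
Proof. by move=> t /=; rewrite !in_itv /= => /andP[h1 h2]; rewrite (le_lt_trans a0 h1) (lt_le_trans h2 acT). Qed.

Let to_I s : I01 s -> I (a + c * s).
Proof. by rewrite /= !in_itv /= => /andP[s0 s1]; rewrite ltrDl mulr_gt0 //= ltrD2l -[X in _ < X]mulr1 ltr_pM2l. Qed.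

Let to_D s : I01 s -> D (a + c * s). Proof. by move=> /to_I /ID. Qed.

Lemma measurable_rescaled d (Z : sigmaRingType d) (h : R -> Z) : measurable_fun I h -> measurable_fun I01 (fun s => h (a + c * s)).
Proof.
move=> mh; apply: (measurable_comp mI _ mh).
  by move=> _ [s s01 <-]; exact: to_I.
by apply: measurable_funTS; exact: affine_measurable.
Qed.

Lemma rescaled_integral (h : R -> \bar R) (k : R) : measurable_fun I h -> (forall t, 0 <= h t)%E -> 0 <= k ->
  (\int[leb]_(s in I01) (k%:E * h (a + c * s)%R) = (k / c)%:E * \int[leb]_(t in I) h t)%E.
Proof.
move=> mh h0 k0; rewrite (ge0_integral_affine c0) // ge0_integralZl //; last exact: measurable_rescaled.
by rewrite muleA -EFinM divfK // gt_eqF.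
Qed.

Definition rescaled_curve (s : R) : proba R M := mu (a + c * s).
Definition rescaled_velocity (s : R) (x : M) : tangent S x := c *: (w (a + c * s) x : V).

Let mw := velocity_Borel hw.

Lemma rescaled_narrow : narrowly_continuous 1 rescaled_curve.
Proof.
move=> f cf _.
have cF : continuous (fun s => \int[mu (clamp T (a + c * s))]_x f x).
  move=> s; apply: (@continuous_comp _ _ _ (fun s => a + c * s) (fun t => \int[mu (clamp T t)]_x f x)).
    by apply: cvgD; [exact: cvg_cst|apply: cvgM; [exact: cvg_cst|exact: cvg_id]].
  exact: (narrow_clamp cM (ltW T0) nmu cf).
apply: (@subspace_eq_continuous _ _ _ (fun s => \int[mu (clamp T (a + c * s))]_x f x)); last exact: continuous_subspaceT.
move=> s; rewrite inE /= in_itv /= => /andP[s0 s1]; rewrite /rescaled_curve clamp_id //.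
rewrite addr_ge0 ?mulr_ge0 ?(ltW c0) //= (le_trans _ acT) // lerD2l.
by rewrite -[X in _ <= X]mulr1 ler_pM2l.
Qed.

Lemma rescaled_Borel : Borel_field I01 rescaled_velocity.
Proof.
move=> i j.
rewrite (_ : (fun p => _) = (fun p : borelType M * RR => c * to_chart i (w (a + c * p.2) p.1) 0 j)); last first.
  by apply/funext => p; rewrite /rescaled_velocity to_chartZ mxE.
apply: measurable_funM => //.
have mdom : measurable (chart_dom i `*` D : set (borelType M * RR)).
  by apply: measurableX => //; exact: chart_dom_measurable.
pose F (q : borelType M * RR) := to_chart i (w q.2 q.1) 0 j.
pose G (p : borelType M * RR) : borelType M * RR := (p.1, a + c * p.2).
have mF : measurable_fun (chart_dom i `*` D : set (borelType M * RR)) F := @mw i j.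
apply: (measurable_comp (f := F) (g := G) mdom _ mF).
  by move=> _ [[x s] [/= ix /to_D Ds] <-].
apply: measurable_funTS; apply: measurable_fun_pair; first exact: measurable_fst.
by apply: (measurableT_comp (affine_measurable a c)); exact: measurable_snd.
Qed.

Let kin_fiber t : D t -> measurable_fun (setT : set (borelType M)) (fun x => mobility K (mu t) x * tnorm g (w t x) ^+ 2).
Proof.
move=> Dt; have [mk _] := kinetic_action g cM T0 nmu cK K_pos mw.
by have := measurable_fiber mD Dt mk; rewrite /= (time_clamp mu Dt).
Qed.

Lemma kinetic_ge0 (P : proba R M) (u : forall x : M, tangent S x) : (0 <= kinetic g K P u)%E.
Proof.
apply: integral_ge0 => x _; rewrite lee_fin mulr_ge0 ?exprn_ge0 ?tnorm_ge0 //.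
by apply: ltW; exact: mobility_gt0.
Qed.

Lemma measurable_kinetic : measurable_fun D (fun t => kinetic g K (mu t) (w t)).
Proof.
have [mk _] := kinetic_action g cM T0 nmu cK K_pos mw.
have mk' : measurable_fun (setT `*` D : set (borelType M * RR)) (fun p => (m p * tnorm g (w p.2 p.1) ^+ 2)%:E).
  exact/measurable_EFinP.
apply: (eq_measurable_fun (fun t => \int[mu t]_x (m (x, t) * tnorm g (w t x) ^+ 2)%:E)%E).
  by move=> t; rewrite inE => Dt; rewrite /kinetic /= (time_clamp mu Dt).
exact: (measurable_time_integral S (f := fun p : M * R => (m p * tnorm g (w p.2 p.1) ^+ 2)%:E) cM T0 nmu mk').
Qed.

(** The speed is multiplied by c and the time divided by c, so the quadratic
    action is multiplied by c. *)
Lemma rescaled_action :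
  (\int[leb]_(s in I01) kinetic g K (rescaled_curve s) (rescaled_velocity s) =
   c%:E * \int[leb]_(t in I) kinetic g K (mu t) (w t))%E.
Proof.
have e : (c = c ^+ 2 / c) by field; rewrite gt_eqF.
rewrite [X in (X%:E * _)%E]e.
rewrite -rescaled_integral.
- apply: eq_integral => s; rewrite inE => /to_D Ds; rewrite /kinetic.
  rewrite -ge0_integralZl //.
  + apply: eq_integral => x _; rewrite /rescaled_velocity tnormZ gtr0_norm // -EFinM; congr EFin.
    by rewrite /rescaled_curve exprMn mulrCA.
  + by apply/measurable_EFinP; exact: kin_fiber.
  + move=> x _; rewrite lee_fin mulr_ge0 ?exprn_ge0 ?tnorm_ge0 //.
    by apply: ltW; exact: mobility_gt0.
  + by rewrite lee_fin exprn_ge0 // ltW.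
- exact: measurable_funS mD ID measurable_kinetic.
- by move=> t; exact: kinetic_ge0.
- by rewrite exprn_ge0 // ltW.
Qed.

(** The weak equation on ]0, T[ is tested with the rescaled test functions,
    whose contribution outside ]a, a + c[ vanishes. *)
Lemma rescaled_CE : CE g 1 rescaled_curve rescaled_velocity.
Proof.
have [_ _ iw weak] := hw; refine (And4 rescaled_narrow rescaled_Borel _ _).
- have mt : measurable_fun (setT `*` D : set (borelType M * RR)) (fun p => (tnorm g (w p.2 p.1))%:E).
    by apply/measurable_EFinP; apply: measurable_tnorm.
  have mh : measurable_fun D (fun t => \int[mu t]_x (tnorm g (w t x))%:E)%E.
    exact: (measurable_time_integral S (f := fun p : M * R => (tnorm g (w p.2 p.1))%:E) cM T0 nmu mt).
  have h0 t : (0 <= \int[mu t]_x (tnorm g (w t x))%:E)%E.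
    by apply: integral_ge0 => x _; rewrite lee_fin tnorm_ge0.
  have -> : (\int[leb]_(t in I01) \int[rescaled_curve t]_x (tnorm g (rescaled_velocity t x))%:E =
      \int[leb]_(t in I) \int[mu t]_x (tnorm g (w t x))%:E)%E.
    have e1 : 1%E = (c / c)%:E by rewrite divff // gt_eqF.
    rewrite -[RHS]mul1e [X in _ = (X * _)%E]e1 -rescaled_integral //; [|exact: measurable_funS mD ID mh|exact: ltW].
    apply: eq_integral => s; rewrite inE => /to_D Ds.
    rewrite -ge0_integralZl //.
    + by apply: eq_integral => x _; rewrite /rescaled_velocity tnormZ gtr0_norm.
    + exact: (measurable_fiber mD Ds mt).
    + by move=> x _; rewrite lee_fin tnorm_ge0.
    + by rewrite lee_fin ltW.
  apply: le_lt_trans iw; apply: ge0_subset_integral => //.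
move=> phi hphi.
pose psi := rescaled_test a c phi.
have hpsi : C1c S T psi by exact: rescaled_test_C1c.
pose h t := (\int[mu t]_x (derive1 (psi x) t + mdiff S (psi^~ t) x (w t x))%:E)%E.
have mh : measurable_fun D h.
  have mt : measurable_fun (setT `*` D : set (borelType M * RR)) (fun p => (derive1 (psi p.1) p.2 + mdiff S (psi^~ p.2) p.1 (w p.2 p.1))%:E).
    by apply/measurable_EFinP; apply: (measurable_test cM hpsi).
  exact: (measurable_time_integral S (f := fun p : M * R => (derive1 (psi p.1) p.2 + mdiff S (psi^~ p.2) p.1 (w p.2 p.1))%:E) cM T0 nmu mt).
have h_out t : ~ I t -> h t = 0%E.
  move=> It; rewrite /h; apply: integral0_eq => x _.
  rewrite (rescaled_test_zero c0 hphi) //.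
  by apply/negP => hI; apply: It; rewrite /= in_itv.
have hI : (\int[leb]_(t in I) h t = 0)%E.
  rewrite -[RHS](weak psi hpsi) -[I](setIidr ID) integral_mkcondr.
  apply: eq_integral => t _; rewrite patchE; case: ifPn => // /negP It.
  by rewrite [RHS]h_out // => It'; apply: It; rewrite inE.
have := integral_affine_eq0 c0 (measurable_funS mD ID mh) hI => <-.
apply: eq_integral => s; rewrite inE /= in_itv /= => s01; apply: eq_integral => x _.
exact (f_equal EFin (esym (rescaled_test_integrand a c0 hphi (w (a + c * s) x) s01))).
Qed.

(** The rescaled pair is a competitor in the definition of the distance. *)
Lemma Wm2_action : (Wm2 g K (mu a) (mu (a + c)) <= sqrte (c%:E * \int[leb]_(t in I) kinetic g K (mu t) (w t)))%E.
Proof.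
rewrite /Wm2 lee_sqrt; last first.
  by apply: mule_ge0; [rewrite lee_fin ltW|apply: integral_ge0 => t _; exact: kinetic_ge0].
apply: ereal_inf_lbound; exists rescaled_curve, rescaled_velocity; split; last by rewrite rescaled_action.
split; first exact: rescaled_CE.
- by move=> A _; rewrite /rescaled_curve mulr0 addr0.
- by move=> A _; rewrite /rescaled_curve mulr1.
Qed.

End rescaled_curve.

(** * Metric derivative and the equality case *)

Section metric_derivative_bound.
Context {R : realType} {X : Type}.
Local Notation leb := (@lebesgue_measure R).
Local Notation RR := (measurableTypeR R).
Variables (d : X -> X -> \bar R) (c : R -> X) (T : R) (k : R -> R) (B : R).
Local Notation D := ([set` `]0, T[%R] : set RR).
Hypothesis mk : measurable_fun D k.
Hypothesis kB : forall t, D t -> 0 <= k t <= B.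
Hypothesis dk : forall a b, 0 <= a -> a < b -> b <= T ->
  (d (c a) (c b) <= sqrte ((b - a)%:E * \int[leb]_(t in [set` `]a, b[%R]) (k t)%:E))%E.

Let mD : measurable D. Proof. exact: measurable_itv. Qed.

Let k_integrable : leb.-integrable D (EFin \o k).
Proof.
apply: measurable_bounded_integrable => //.
  have : (leb [set` `]0, T[%R] < +oo)%E.
    by rewrite lebesgue_measure_itv /=; case: ifP => _; rewrite ?ltry // -EFinB ltry.
  by [].
exists B; split; [exact: num_real|move=> y By t Dt].
by rewrite /=; have /andP[k0 kt] := kB Dt; rewrite ger0_norm // (le_trans kt (ltW By)).
Qed.

Let k0 := k \_ D.

Let k0_integrable : leb.-integrable setT (EFin \o k0).
Proof. by move: k_integrable; rewrite (integrable_mkcond _ mD) /k0 restrict_EFin. Qed.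

Let F y := \int[leb]_(t in [set` `]0, y]%R]) k0 t.

Let increment a b : 0 <= a -> a < b -> b < T ->
  (\int[leb]_(t in [set` `]a, b[%R]) (k t)%:E = (F b - F a)%:E)%E.
Proof.
move=> a0 ab bT.
have sub (E : set RR) : measurable E -> leb.-integrable E (EFin \o k0).
  by move=> mE; apply: integrableS k0_integrable.
rewrite /F Rintegral_itvB ?bnd_simp ?(ltW ab) //; last by apply: sub; exact: measurable_itv.
rewrite -Rintegral_itv_bndo_bndc; last by apply: sub; exact: measurable_itv.
rewrite /Rintegral fineK; last by apply: integrable_fin_num; [exact: measurable_itv|apply: sub; exact: measurable_itv].
apply: eq_integral => t; rewrite inE /= in_itv /= => /andP[at_ tb].
by rewrite /k0 patchE mem_set //= in_itv /= (le_lt_trans a0 at_) (lt_trans tb bT).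
Qed.

(** At a Lebesgue point t of k, the mean of k on ]t + h, t[ converges to k(t)
    when h < 0 tends to 0. Only the left difference quotients are used: for them
    the distance is taken in the direction of time. *)
Lemma metric_derivative_le : {ae leb, forall t, 0 < t < T ->
  forall l, has_metric_derivative d c t l -> (l <= (Num.sqrt (k t))%:E)%E}.
Proof.
have iy y : leb.-integrable [set` Interval (BRight 0) (BRight y)] (EFin \o k0).
  by apply: (integrableS _ _ _ k0_integrable) => //; exact: measurable_itv.
have ftc := @FTC1 R k0 (BRight 0) iy (integrable_locally mD k_integrable).
move: ftc; rewrite /=; apply: (@filterS _ _ (ae_filter_ringOfSetsType leb)) => t H /andP[t0 tT] l hl.
have [|dF eF] := H; first by rewrite lte_fin.
have kt : k0 t = k t by rewrite /k0 patchE mem_set //= in_itv /= t0 tT.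
rewrite kt in eF.
have q : h^-1 * (F (h + t) - F t) @[h --> 0^'] --> k t.
  rewrite -eF; have := dF; rewrite /derivable /=.
  by under eq_fun do rewrite [_ *: 1]mulr1.
have q2 : (Num.sqrt (h^-1 * (F (h + t) - F t)))%:E @[h --> 0^'-] --> (Num.sqrt (k t))%:E.
  apply: cvg_EFin; first by near=> h.
  apply: (cvg_comp _ _ (cvg_dnbhs_at_left q)); exact: sqrt_continuous.
apply: (lee_cvg_to (cvg_dnbhs_at_left hl) q2).
near=> h.
have h0 : h < 0 by near: h; exact: nbhs_left_lt.
have ht : - t < h by near: h; apply: nbhs_left_gt; rewrite oppr_lt0.
have a0 : 0 <= t + h by lra.
have ab : t + h < t by lra.
have := dk a0 ab (ltW tT); rewrite (increment a0 ab tT) => le1.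
rewrite ltr0_norm //.
have hn : 0 < - h by rewrite oppr_gt0.
have inv0 : (0 <= ((- h)^-1)%:E)%E by rewrite lee_fin invr_ge0 ltW.
apply: le_trans (lee_wpmul2r inv0 le1) _.
rewrite -[X in (X <= _)%E]/((Num.sqrt ((t - (t + h)) * (F t - F (t + h))) * (- h)^-1)%:E) lee_fin.
(* The distance over |h| is the square root of a difference quotient of F. *)
have -> : (t - (t + h)) * (F t - F (t + h)) = (- h) ^+ 2 * (h^-1 * (F (h + t) - F t)).
  by rewrite [h + t]addrC; field; rewrite lt_eqF.
rewrite sqrtrM ?exprn_ge0 ?(ltW hn) // sqrtr_sqr gtr0_norm //.
by rewrite mulrAC divff ?mul1r // gt_eqF.
Unshelve. all: by end_near. Qed.

End metric_derivative_bound.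

Section optimality.
Context {R : realType} {n : nat} {M : ptopologicalType}.
Variables (S : smooth_manifold R n M) (g : riemannian_metric S).
Hypothesis cM : compact [set: M].
Local Notation RR := (measurableTypeR R).
Local Notation leb := (@lebesgue_measure R).
Variables (T : R) (mu : R -> proba R M).
Hypothesis T0 : 0 < T.
Hypothesis nmu : narrowly_continuous T mu.
Variables (K W : M -> M -> R).
Hypothesis cK : continuous (fun p : M * M => K p.1 p.2).
Hypothesis K_pos : exists2 C : R, 0 < C & forall x y, C <= K x y.
Hypothesis hW : C1_on_product S W.
Local Notation D := ([set` `]0, T[%R] : set RR).
Local Notation grad := (fun t x => gradient_velocity g K W (mu t) x).
Hypothesis hgrad : CE g T mu grad.
Variable v : R -> forall x : M, tangent S x.
Hypothesis hCE : CE g T mu v.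
Hypothesis hv : {ae leb, forall t, 0 < t < T ->
  has_metric_derivative (Wm2 g K) mu t (sqrte (kinetic g K (mu t) (v t)))}.

Let mD : measurable D. Proof. exact: measurable_itv. Qed.
Let k t := fine (kinetic g K (mu t) (grad t)).

Let grad_kinetic : exists B, forall t, D t -> kinetic g K (mu t) (grad t) = (k t)%:E /\ 0 <= k t <= B.
Proof.
have [B hB] := slope_bounded g cM T0 nmu cK K_pos hW; exists B => t Dt.
have k0 : (0 <= kinetic g K (mu t) (grad t))%E by exact: kinetic_ge0.
have kB : (kinetic g K (mu t) (grad t) <= B%:E)%E.
  have -> : B%:E = (\int[mu t]_x (cst B%:E x))%E.
    by rewrite integral_cst // [X in (_ * X)%E](@probability_setT _ _ _ (mu t)) mule1.
  apply: ge0_le_integral => //.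
  - by move=> x _; rewrite lee_fin mulr_ge0 ?exprn_ge0 ?tnorm_ge0 // ltW // mobility_gt0.
  - apply/measurable_EFinP.
    have [mk _] := kinetic_action g cM T0 nmu cK K_pos (velocity_Borel hgrad).
    by have := measurable_fiber mD Dt mk; rewrite /= (time_clamp mu Dt).
  - move=> x _; rewrite lee_fin; have := hB t x Dt.
    by rewrite /= (time_clamp mu Dt).
have kf : kinetic g K (mu t) (grad t) \is a fin_num by rewrite ge0_fin_numE // (le_lt_trans kB) // ltry.
have ek : kinetic g K (mu t) (grad t) = (k t)%:E by rewrite /k fineK.
by split => //; rewrite ek !lee_fin in k0 kB; rewrite k0 kB.
Qed.

(** Almost everywhere, the square root of the action density of v is the metric
    derivative of mu, which is bounded by the square root of the action density
    of any velocity of mu, here the gradient velocity. *)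
Lemma kinetic_le_slope : (\int[leb]_(t in D) kinetic g K (mu t) (v t) <= \int[leb]_(t in D) slope_term g K W (mu t))%E.
Proof.
have [B hB] := grad_kinetic.
have mgrad := measurable_kinetic cM T0 nmu cK K_pos hgrad.
have mk : measurable_fun D k by apply: measurableT_comp.
have dk a b : 0 <= a -> a < b -> b <= T ->
    (Wm2 g K (mu a) (mu b) <= sqrte ((b - a)%:E * \int[leb]_(t in [set` `]a, b[%R]) (k t)%:E))%E.
  move=> a0 ab bT; have c0 : 0 < b - a by rewrite subr_gt0.
  have e : a + (b - a) = b by rewrite addrC subrK.
  have acT : a + (b - a) <= T by rewrite e.
  have := Wm2_action cM T0 nmu cK K_pos hgrad a0 c0 acT; rewrite e.
  have e2 : (\int[leb]_(t in [set` `]a, b[%R]) kinetic g K (mu t) (grad t) = \int[leb]_(t in [set` `]a, b[%R]) (k t)%:E)%E; last by rewrite e2.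
  apply: eq_integral => t; rewrite inE /= in_itv /= => /andP[at_ tb].
  have Dt : D t by rewrite /= in_itv /= (le_lt_trans a0 at_) (lt_le_trans tb bT).
  by have [] := hB t Dt.
have opt := metric_derivative_le mk (fun t Dt => proj2 (hB t Dt)) dk.
apply: ae_ge0_le_integral => //.
- by move=> t _; exact: kinetic_ge0.
- exact: measurable_kinetic hCE.
- by move=> t _; rewrite slope_kinetic //; exact: kinetic_ge0.
- by apply: eq_measurable_fun mgrad => t _; rewrite slope_kinetic.
move: hv opt; apply: (@filterS2 _ _ (ae_filter_ringOfSetsType leb)) => t h1 h2 Dt.
have t0T : 0 < t < T by move: Dt; rewrite /= in_itv.
have := h2 t0T _ (h1 t0T); rewrite slope_kinetic // ; have [-> /andP[k0 _]] := hB t Dt.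
by rewrite -[X in (_ <= X)%E]/(sqrte (k t)%:E) lee_sqrt // lee_fin.
Qed.

End optimality.

Theorem lemma2p7 (R : realType) (n : nat) (M : ptopologicalType)
    (S : smooth_manifold R n M) (g : riemannian_metric S)
    (hM : compact [set: M])
    (K : M -> M -> R)
    (hKcont : continuous (fun p : M * M => K p.1 p.2))
    (hKpos : exists2 C : R, 0 < C & forall x y, C <= K x y)
    (W : M -> M -> R) (hWC1 : C1_on_product S W)
    (hWsym : forall x y, W x y = W y x)
    (T : R) (hT : 0 < T)
    (mu : R -> proba R M) (v : R -> forall x : M, tangent S x)
    (hAC : absolutely_continuous_curve (Wm2 g K) T mu)
    (hCE : CE g T mu v)
    (hv : {ae (@lebesgue_measure R), forall t, 0 < t < T ->
       has_metric_derivative (Wm2 g K) mu t (sqrte (kinetic g K (mu t) (v t)))}) :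
  (0 <= dissipation g K W T mu v)%E /\
  (dissipation g K W T mu v = 0%E <->
   CE g T mu (fun t x => gradient_velocity g K W (mu t) x)).
Proof.
have [nmu _ _ _] := hCE.
have D0 := dissipation_ge0 hM hT nmu hKcont hKpos hWC1 hWsym hCE.
split => //; split; first exact: (null_dissipation hM hT nmu hKcont hKpos hWC1 hWsym hCE).
move=> hgrad; apply/eqP; rewrite eq_le D0 andbT.
apply: (weak_solution_dissipation hM hT nmu hKcont hKpos hWC1 hWsym hCE hgrad).
exact: (kinetic_le_slope hM hT nmu hKcont hKpos hWC1 hgrad hCE hv).
Qed.
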